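(* Let $k$ be a number field, $i\ge1$, $K^{(i+1)}$ a $\mathbb{Z}_p^{i+1}$-extension of $k$, and $X$ a finitely generated torsion $\Lambda(K^{(i+1)}/k)$-module with $X\sim\bigoplus_{l=1}^t\Lambda(K^{(i+1)}/k)/(f_l)$, $f_l\ne0$. Then for generic $\mathbb{Z}_p^i$-extensions $K^{(i)}\subset K^{(i+1)}$ of $k$, $(X_{\mathrm{Gal}(K^{(i+1)}/K^{(i)})})^{\dagger}\sim\bigoplus_{l=1}^t\Lambda^{\dagger}(K^{(i)}/k)/(\overline{f_l})$ as $\Lambda^{\dagger}(K^{(i)}/k)$-modules.
   Context: $p$ is a fixed prime. For a $\mathbb{Z}_p^d$-extension $K/k$, $\Lambda(K/k)=\mathbb{Z}_p[[\mathrm{Gal}(K/k)]]$. Over a noetherian integrally closed domain, pseudo-null means finitely generated with annihilator of height $\ge2$, and $X\sim Y$ means there is a homomorphism $X\to Y$ with pseudo-null kernel and cokernel. For a $\mathbb{Z}_p$-extension $K/k$, $\Lambda^{\dagger}(K/k)=\Lambda(K/k)[1/(\gamma-1)\mid\gamma\in\mathrm{Gal}(K/k),\gamma\ne1]$; for $i\ge2$, $\Lambda^{\dagger}(K^{(i)}/k)=\Lambda(K^{(i)}/k)$. For a $\Lambda(K^{(i)}/k)$-module $Y$, $Y^{\dagger}=\Lambda^{\dagger}(K^{(i)}/k)\otimes_{\Lambda(K^{(i)}/k)}Y$. The coinvariants $X_{\mathrm{Gal}(K^{(i+1)}/K^{(i)})}$ are regarded as a $\Lambda(K^{(i)}/k)$-module,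 and $\overline{f_l}$ is the image of $f_l$ under $\Lambda(K^{(i+1)}/k)\to\Lambda(K^{(i)}/k)$. Measure: for a free $\mathbb{Z}_p$-module $M$ of rank $d$, $\mathrm{Gr}(i,M)$ is the set of submodules $N$ with $M/N$ free of rank $i$, with the quotient topology and pushforward of normalized Haar measure from $\mathrm{Aut}(M)\cong\mathrm{GL}_d(\mathbb{Z}_p)$ via $g\mapsto g(N_0)$. $\mathbb{Z}_p^i$-extensions $K^{(i)}\subset K^{(i+1)}$ correspond to $\mathrm{Gr}(i,\mathrm{Gal}(K^{(i+1)}/k))$ via $K^{(i)}\leftrightarrow\mathrm{Gal}(K^{(i+1)}/K^{(i)})$. ''Generic $K^{(i)}$ satisfy $P$'' means a closed measure-zero set contains all $K^{(i)}$ failing $P$. *)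

(* Defs.v *)
From HB Require Import structures.
From mathcomp Require Import all_boot all_order all_algebra.
From mathcomp Require Import generic_quotient.
From mathcomp Require Import all_classical all_reals all_analysis.
From mathcomp Require Import ring.

Set Implicit Arguments.
Unset Strict Implicit.
Unset Printing Implicit Defensive.

Import GRing.Theory.
Local Open Scope classical_set_scope.
Local Open Scope ring_scope.

(* [padic_int p] is the inverse limit of the rings Z/p^n: the component of index n
   is represented by the integer [zp_val x n], reduced modulo p^n. *)
Record padic_int (p : nat) := MkZp {
  zp_val :> nat -> int;
  zp_compat : forall n, zp_val n = (zp_val n.+1 %% (p ^ n)%N%:Z)%Z }.

Section PadicIntegers.
Variable p : nat.
Local Notation q n := ((p ^ n)%N%:Z).

Lemma zp_eq (x y : padic_int p) : (forall n, x n = y n) -> x = y.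
Proof.
case: x => x hx; case: y => y hy /= /funext e.
by subst y; congr MkZp; exact: Prop_irrelevance.
Qed.

HB.instance Definition _ := gen_eqMixin (padic_int p).
HB.instance Definition _ := gen_choiceMixin (padic_int p).

Lemma zp_mod (x : padic_int p) n : (x n %% q n)%Z = x n.
Proof. by rewrite zp_compat modz_mod. Qed.

Lemma modz_pS (a : int) n : ((a %% q n.+1)%Z %% q n)%Z = (a %% q n)%Z.
Proof.
have e : q n.+1 = p%:Z * q n by rewrite expnS PoszM.
rewrite [in RHS](divz_eq a (q n.+1)).
by rewrite {3}e mulrA modzMDl.
Qed.

Lemma zp_compat_seq (s : nat -> int) :
    (forall n, (s n.+1 %% q n = s n %% q n)%Z) ->
  forall n, (s n %% q n)%Z = ((s n.+1 %% q n.+1)%Z %% q n)%Z.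
Proof. by move=> h n; rewrite modz_pS h. Qed.

Definition zp_mk s (h : forall n, (s n.+1 %% q n = s n %% q n)%Z) : padic_int p :=
  MkZp (zp_compat_seq h).

Lemma zp_mod_eq (x : padic_int p) n : (x n.+1 %% q n = x n %% q n)%Z.
Proof. by rewrite -zp_compat zp_mod. Qed.

Lemma zp_add_compat (x y : padic_int p) n :
  ((x n.+1 + y n.+1) %% q n = (x n + y n) %% q n)%Z.
Proof. by rewrite -modzDm !zp_mod_eq modzDm. Qed.
Lemma zp_mul_compat (x y : padic_int p) n :
  ((x n.+1 * y n.+1) %% q n = (x n * y n) %% q n)%Z.
Proof. by rewrite -modzMm !zp_mod_eq modzMm. Qed.
Lemma zp_opp_compat (x : padic_int p) n : ((- x n.+1) %% q n = (- x n) %% q n)%Z.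
Proof. by rewrite -modzNm zp_mod_eq modzNm. Qed.

Definition zp_add x y := zp_mk (zp_add_compat x y).
Definition zp_mul x y := zp_mk (zp_mul_compat x y).
Definition zp_opp x := zp_mk (zp_opp_compat x).
Definition zp_cst (a : int) : padic_int p :=
  @zp_mk (fun=> a) (fun n => erefl).

Lemma zp_addA : associative zp_add.
Proof. by move=> x y z; apply: zp_eq => n /=; rewrite modzDml modzDmr addrA. Qed.
Lemma zp_addC : commutative zp_add.
Proof. by move=> x y; apply: zp_eq => n /=; rewrite addrC. Qed.
Lemma zp_add0 : left_id (zp_cst 0) zp_add.
Proof. by move=> x; apply: zp_eq => n /=; rewrite modzDml add0r zp_mod. Qed.
Lemma zp_addN : left_inverse (zp_cst 0) zp_opp zp_add.
Proof. by move=> x; apply: zp_eq => n /=; rewrite modzDml addNr. Qed.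
HB.instance Definition _ :=
  GRing.isZmodule.Build (padic_int p) zp_addA zp_addC zp_add0 zp_addN.

Lemma zp_mulA : associative zp_mul.
Proof. by move=> x y z; apply: zp_eq => n /=; rewrite modzMml modzMmr mulrA. Qed.
Lemma zp_mulC : commutative zp_mul.
Proof. by move=> x y; apply: zp_eq => n /=; rewrite mulrC. Qed.
Lemma zp_mul1 : left_id (zp_cst 1) zp_mul.
Proof. by move=> x; apply: zp_eq => n /=; rewrite modzMml mul1r zp_mod. Qed.
Lemma zp_mulD : left_distributive zp_mul +%R.
Proof.
by move=> x y z; apply: zp_eq => n /=; rewrite modzMml modzDm mulrDl.
Qed.
HB.instance Definition _ :=
  GRing.Zmodule_isComPzRing.Build (padic_int p) zp_mulA zp_mulC zp_mul1 zp_mulD.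

Definition zp_open : set (set (padic_int p)) :=
  [set U : set (padic_int p) | forall x, U x ->
    exists n, forall y : padic_int p, y n = x n -> U y].

Lemma zp_openT : zp_open setT. Proof. by move=> x _; exists 0%N. Qed.

Lemma zp_val_le (x y : padic_int p) m n : (m <= n)%N -> x n = y n -> x m = y m.
Proof.
elim: n => [|n IH]; first by rewrite leqn0 => /eqP ->.
rewrite leq_eqVlt ltnS => /predU1P[-> //|lemn] e.
by apply: (IH lemn); rewrite (zp_compat x n) (zp_compat y n) e.
Qed.

Lemma zp_openI : setI_closed zp_open.
Proof.
move=> U V oU oV x [Ux Vx]; have [m hm] := oU x Ux; have [n hn] := oV x Vx.
exists (maxn m n) => y e; split; [apply: hm | apply: hn].
  by apply: zp_val_le e; rewrite leq_maxl.
by apply: zp_val_le e; rewrite leq_maxr.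
Qed.

Lemma zp_open_bigU (I : Type) (f : I -> set (padic_int p)) :
  (forall i, zp_open (f i)) -> zp_open (\bigcup_i f i).
Proof.
move=> h x [i _ fx]; have [n hn] := h i x fx.
by exists n => y e; exists i => //; exact: hn.
Qed.

HB.instance Definition _ :=
  isOpenTopological.Build (padic_int p) zp_openT zp_openI zp_open_bigU.

End PadicIntegers.

Record submod (R : pzRingType) (M : lmodType R) := Submod {
  submod_set :> set M;
  submod0 : submod_set 0;
  submodD : forall x y, submod_set x -> submod_set y -> submod_set (x + y);
  submodZ : forall a x, submod_set x -> submod_set (a *: x) }.

Definition submod_fun (R : pzRingType) (M : lmodType R) (N : submod M) :
  M -> Prop := submod_set N.
Coercion submod_fun : submod >-> Funclass.

Section Submodules.
Variables (R : pzRingType) (M : lmodType R).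

Lemma submodN (N : submod M) x : N x -> N (- x).
Proof. by rewrite -scaleN1r; exact: submodZ. Qed.

Lemma submodB (N : submod M) x y : N x -> N y -> N (x - y).
Proof. by move=> Nx Ny; apply: submodD => //; exact: submodN. Qed.

Definition submod_span_set (S : set M) : set M :=
  [set x | forall N : submod M, S `<=` N -> N x].

Lemma span0 S : submod_span_set S 0.
Proof. by move=> N _; exact: submod0. Qed.
Lemma spanD S x y : submod_span_set S x -> submod_span_set S y -> submod_span_set S (x + y).
Proof. by move=> hx hy N SN; apply: submodD; [exact: hx | exact: hy]. Qed.
Lemma spanZ S a x : submod_span_set S x -> submod_span_set S (a *: x).
Proof. by move=> hx N SN; apply: submodZ; exact: hx. Qed.

Definition submod_span (S : set M) : submod M :=
  Submod (@span0 S) (@spanD S) (@spanZ S).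

Definition finitely_generated : Prop :=
  exists n (v : 'I_n -> M), forall x,
    exists c : 'I_n -> R, x = \sum_(i < n) c i *: v i.

End Submodules.
Arguments finitely_generated {R} M.

Section SubmoduleAsModule.
Variables (R : pzRingType) (M : lmodType R) (N : submod M).

Record sub_mod := SubMod { sub_val :> M; sub_valP : N sub_val }.

Lemma sub_val_inj (x y : sub_mod) : sub_val x = sub_val y -> x = y.
Proof.
case: x => x hx; case: y => y hy /= e; subst y.
by congr SubMod; exact: Prop_irrelevance.
Qed.

HB.instance Definition _ := gen_eqMixin sub_mod.
HB.instance Definition _ := gen_choiceMixin sub_mod.

Definition sub_zero := SubMod (submod0 N).
Definition sub_add (x y : sub_mod) := SubMod (submodD (sub_valP x) (sub_valP y)).
Definition sub_opp (x : sub_mod) := SubMod (submodN (sub_valP x)).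
Definition sub_scale a (x : sub_mod) := SubMod (submodZ a (sub_valP x)).

Lemma sub_addA : associative sub_add.
Proof. by move=> x y z; apply: sub_val_inj; exact: addrA. Qed.
Lemma sub_addC : commutative sub_add.
Proof. by move=> x y; apply: sub_val_inj; exact: addrC. Qed.
Lemma sub_add0 : left_id sub_zero sub_add.
Proof. by move=> x; apply: sub_val_inj; exact: add0r. Qed.
Lemma sub_addN : left_inverse sub_zero sub_opp sub_add.
Proof. by move=> x; apply: sub_val_inj; exact: addNr. Qed.
HB.instance Definition _ :=
  GRing.isZmodule.Build sub_mod sub_addA sub_addC sub_add0 sub_addN.

Lemma sub_scaleA a b v : sub_scale a (sub_scale b v) = sub_scale (a * b) v.
Proof. by apply: sub_val_inj; exact: scalerA. Qed.
Lemma sub_scale1 : left_id 1 sub_scale.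
Proof. by move=> v; apply: sub_val_inj; exact: scale1r. Qed.
Lemma sub_scaleDr : right_distributive sub_scale +%R.
Proof. by move=> a u v; apply: sub_val_inj; exact: scalerDr. Qed.
Lemma sub_scaleDl v : {morph sub_scale^~ v : a b / a + b >-> a + b}.
Proof. by move=> a b; apply: sub_val_inj; exact: scalerDl. Qed.
HB.instance Definition _ := GRing.Zmodule_isLmodule.Build R sub_mod
  sub_scaleA sub_scale1 sub_scaleDr sub_scaleDl.

End SubmoduleAsModule.

Section QuotientModule.
Variables (R : pzRingType) (M : lmodType R) (N : submod M).
Local Open Scope quotient_scope.

Definition quo_rel (x y : M) := `[< N (x - y) >].

Lemma quo_refl : reflexive quo_rel.
Proof. by move=> x; apply/asboolP; rewrite subrr; exact: submod0. Qed.
Lemma quo_sym : symmetric quo_rel.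
Proof.
by move=> x y; apply/idP/idP => /asboolP h; apply/asboolP;
  rewrite -opprB; exact: submodN.
Qed.
Lemma quo_trans : transitive quo_rel.
Proof.
move=> y x z /asboolP h1 /asboolP h2; apply/asboolP.
by rewrite -(subrK y x) -addrA; exact: submodD.
Qed.
Canonical quo_equiv := EquivRel quo_rel quo_refl quo_sym quo_trans.

Definition quo_mod := {eq_quot quo_rel}.
HB.instance Definition _ := Choice.on quo_mod.
Definition quo_pi (x : M) : quo_mod := \pi_({eq_quot quo_rel}) x.
Definition quo_repr (x : quo_mod) : M := repr (x : {eq_quot quo_rel}).

Lemma quo_piP x y : quo_pi x = quo_pi y <-> N (x - y).
Proof.
split=> [/eqP|] h; first by move: h; rewrite /quo_pi eqmodE => /asboolP.
by apply/eqP; rewrite /quo_pi eqmodE; exact/asboolP.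
Qed.
Lemma quo_reprK x : quo_pi (quo_repr x) = x.
Proof. exact: reprK. Qed.
Lemma quo_repr_pi x : N (quo_repr (quo_pi x) - x).
Proof. by apply/quo_piP; rewrite quo_reprK. Qed.
Lemma quo_ind (P : quo_mod -> Prop) : (forall x, P (quo_pi x)) -> forall x, P x.
Proof. by move=> h x; rewrite -(quo_reprK x). Qed.

Definition quo_add x y := quo_pi (quo_repr x + quo_repr y).
Definition quo_opp x := quo_pi (- quo_repr x).
Definition quo_scale a x := quo_pi (a *: quo_repr x).

Lemma quo_piD x y : quo_add (quo_pi x) (quo_pi y) = quo_pi (x + y).
Proof.
apply/quo_piP; rewrite opprD addrACA.
by apply: submodD; exact: quo_repr_pi.
Qed.
Lemma quo_piN x : quo_opp (quo_pi x) = quo_pi (- x).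
Proof. by apply/quo_piP; rewrite -opprD; apply: submodN; exact: quo_repr_pi. Qed.
Lemma quo_piZ a x : quo_scale a (quo_pi x) = quo_pi (a *: x).
Proof. by apply/quo_piP; rewrite -scalerBr; apply: submodZ; exact: quo_repr_pi. Qed.

Lemma quo_addA : associative quo_add.
Proof.
elim/quo_ind=> x; elim/quo_ind=> y; elim/quo_ind=> z.
by rewrite !quo_piD addrA.
Qed.
Lemma quo_addC : commutative quo_add.
Proof. by elim/quo_ind=> x; elim/quo_ind=> y; rewrite !quo_piD addrC. Qed.
Lemma quo_add0 : left_id (quo_pi 0) quo_add.
Proof. by elim/quo_ind=> x; rewrite quo_piD add0r. Qed.
Lemma quo_addN : left_inverse (quo_pi 0) quo_opp quo_add.
Proof. by elim/quo_ind=> x; rewrite quo_piN quo_piD addNr. Qed.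
HB.instance Definition _ :=
  GRing.isZmodule.Build quo_mod quo_addA quo_addC quo_add0 quo_addN.

Lemma quo_scaleA a b v : quo_scale a (quo_scale b v) = quo_scale (a * b) v.
Proof. by elim/quo_ind: v => v; rewrite !quo_piZ scalerA. Qed.
Lemma quo_scale1 : left_id 1 quo_scale.
Proof. by elim/quo_ind=> v; rewrite quo_piZ scale1r. Qed.
Lemma quo_scaleDr : right_distributive quo_scale +%R.
Proof.
move=> a; elim/quo_ind=> u; elim/quo_ind=> v.
by rewrite /GRing.add /= quo_piD !quo_piZ quo_piD scalerDr.
Qed.
Lemma quo_scaleDl v : {morph quo_scale^~ v : a b / a + b >-> a + b}.
Proof.
elim/quo_ind: v => v a b.
by rewrite !quo_piZ [RHS]/GRing.add /= quo_piD scalerDl.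
Qed.
HB.instance Definition _ := GRing.Zmodule_isLmodule.Build R quo_mod
  quo_scaleA quo_scale1 quo_scaleDr quo_scaleDl.

Lemma quo_pi_is_linear : linear quo_pi.
Proof. by move=> a x y; rewrite -quo_piD -quo_piZ. Qed.
HB.instance Definition _ :=
  GRing.isLinear.Build R M quo_mod *:%R quo_pi quo_pi_is_linear.

End QuotientModule.

Section DirectSum.
Variables (R : pzRingType) (t : nat) (M : 'I_t -> lmodType R).

(* The direct sum is finite, so it is the product with pointwise operations. *)
Definition dsum := forall l, M l.
HB.instance Definition _ := gen_eqMixin dsum.
HB.instance Definition _ := gen_choiceMixin dsum.
Definition dsum_zero : dsum := fun=> 0.
Definition dsum_add (x y : dsum) : dsum := fun l => x l + y l.
Definition dsum_opp (x : dsum) : dsum := fun l => - x l.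
Definition dsum_scale a (x : dsum) : dsum := fun l => a *: x l.

Lemma dsum_addA : associative dsum_add.
Proof. by move=> x y z; apply: functional_extensionality_dep => l; exact: addrA. Qed.
Lemma dsum_addC : commutative dsum_add.
Proof. by move=> x y; apply: functional_extensionality_dep => l; exact: addrC. Qed.
Lemma dsum_add0 : left_id dsum_zero dsum_add.
Proof. by move=> x; apply: functional_extensionality_dep => l; exact: add0r. Qed.
Lemma dsum_addN : left_inverse dsum_zero dsum_opp dsum_add.
Proof. by move=> x; apply: functional_extensionality_dep => l; exact: addNr. Qed.
HB.instance Definition _ :=
  GRing.isZmodule.Build dsum dsum_addA dsum_addC dsum_add0 dsum_addN.

Lemma dsum_scaleA a b v : dsum_scale a (dsum_scale b v) = dsum_scale (a * b) v.
Proof. by apply: functional_extensionality_dep => l; exact: scalerA. Qed.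
Lemma dsum_scale1 : left_id 1 dsum_scale.
Proof. by move=> v; apply: functional_extensionality_dep => l; exact: scale1r. Qed.
Lemma dsum_scaleDr : right_distributive dsum_scale +%R.
Proof. by move=> a u v; apply: functional_extensionality_dep => l; exact: scalerDr. Qed.
Lemma dsum_scaleDl v : {morph dsum_scale^~ v : a b / a + b >-> a + b}.
Proof. by move=> a b; apply: functional_extensionality_dep => l; exact: scalerDl. Qed.
HB.instance Definition _ := GRing.Zmodule_isLmodule.Build R dsum
  dsum_scaleA dsum_scale1 dsum_scaleDr dsum_scaleDl.

End DirectSum.

Section KernelCokernel.
Variables (R : pzRingType) (M N : lmodType R) (f : {linear M -> N}).

Lemma ker_D x y : f x = 0 -> f y = 0 -> f (x + y) = 0.
Proof. by move=> hx hy; rewrite linearD hx hy addr0. Qed.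
Lemma ker_Z a x : f x = 0 -> f (a *: x) = 0.
Proof. by move=> hx; rewrite linearZ_LR hx scaler0. Qed.
Definition lin_kernel : submod M := @Submod _ _ [set x | f x = 0]
  (linear0 f) ker_D ker_Z.

Lemma img_0 : range f 0. Proof. by exists 0 => //; exact: linear0. Qed.
Lemma img_D x y : range f x -> range f y -> range f (x + y).
Proof. by move=> [u _ <-] [v _ <-]; exists (u + v) => //; exact: linearD. Qed.
Lemma img_Z a x : range f x -> range f (a *: x).
Proof. by move=> [u _ <-]; exists (a *: u) => //; exact: linearZ_LR. Qed.
Definition image_mod : submod N := Submod img_0 img_D img_Z.

Definition lin_cokernel := quo_mod image_mod.
HB.instance Definition _ := GRing.Lmodule.on lin_cokernel.
End KernelCokernel.

Section PseudoIsomorphism.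
Variable R : comPzRingType.

Record prime_ideal (P : set R) : Prop := PrimeIdeal {
  pri0 : P 0;
  priD : forall x y, P x -> P y -> P (x + y);
  priM : forall a x, P x -> P (a * x);
  pri1 : ~ P 1;
  pri_prime : forall x y, P (x * y) -> P x \/ P y }.

Definition prime_height_ge n (P : set R) : Prop :=
  exists c : nat -> set R,
    [/\ forall j, (j <= n)%N -> prime_ideal (c j),
        forall j, (j < n)%N -> c j `<` c j.+1 & c n = P].

(* The height of an ideal is the infimum of the heights of the primes
   containing it, so that the unit ideal has infinite height. *)
Definition height_ge n (I : set R) : Prop :=
  forall P, prime_ideal P -> I `<=` P -> prime_height_ge n P.

Definition annihilator (M : lmodType R) : set R :=
  [set a | forall x : M, a *: x = 0].

Definition pseudo_null (M : lmodType R) : Prop :=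
  finitely_generated M /\ height_ge 2 (annihilator M).

Definition pseudo_iso (M N : lmodType R) : Prop :=
  exists f : {linear M -> N},
    pseudo_null (sub_mod (lin_kernel f)) /\ pseudo_null (lin_cokernel f).

Definition torsion (M : lmodType R) : Prop :=
  forall x : M, exists2 a : R, a != 0 & a *: x = 0.

Definition principal_quo (a : R) : lmodType R :=
  quo_mod (submod_span [set (a : R^o)]).

End PseudoIsomorphism.

Record algebra_over (R : comPzRingType) := AlgebraOver {
  alg_ring :> comPzRingType;
  alg_map : {rmorphism R -> alg_ring} }.
Arguments alg_map {R} a.

Section Localization.
Variables (R : comPzRingType) (S : set R).
Local Open Scope quotient_scope.

Inductive mult_closure : R -> Prop :=
| mult_closure1 : mult_closure 1
| mult_closureM s x : S s -> mult_closure x -> mult_closure (s * x).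

Lemma mult_closure_mul x y :
  mult_closure x -> mult_closure y -> mult_closure (x * y).
Proof.
elim=> [|s z Ss _ IH] hy; first by rewrite mul1r.
by rewrite -mulrA; apply: mult_closureM => //; exact: IH.
Qed.

Record fraction_pair :=
  FractionPair { num : R; den : R; den_closure : mult_closure den }.

Lemma fraction_pair_eq (a b : fraction_pair) :
  num a = num b -> den a = den b -> a = b.
Proof.
case: a => n d hd; case: b => n' d' hd' /= e e'; subst n' d'.
by congr FractionPair; exact: Prop_irrelevance.
Qed.

HB.instance Definition _ := gen_eqMixin fraction_pair.
HB.instance Definition _ := gen_choiceMixin fraction_pair.

Definition loc_rel (a b : fraction_pair) :=
  `[< exists2 u, mult_closure u & u * (num a * den b) = u * (num b * den a) >].

Lemma loc_refl : reflexive loc_rel.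
Proof. by move=> a; apply/asboolP; exists 1; [exact: mult_closure1|]. Qed.
Lemma loc_sym : symmetric loc_rel.
Proof. by move=> a b; apply/idP/idP => /asboolP[u hu e]; apply/asboolP; exists u. Qed.
Lemma loc_trans : transitive loc_rel.
Proof.
move=> b a c /asboolP[u hu eu] /asboolP[v hv ev]; apply/asboolP.
exists (u * v * den b).
  by apply: mult_closure_mul; [exact: mult_closure_mul | exact: den_closure].
transitivity (v * den c * (u * (num a * den b))); first by ring.
rewrite eu; transitivity (u * den a * (v * (num b * den c))); first by ring.
by rewrite ev; ring.
Qed.
Canonical loc_equiv := EquivRel loc_rel loc_refl loc_sym loc_trans.

Definition localization := {eq_quot loc_rel}.
HB.instance Definition _ := Choice.on localization.
Definition loc_pi (x : fraction_pair) : localization :=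
  \pi_({eq_quot loc_rel}) x.
Definition loc_repr (x : localization) : fraction_pair :=
  repr (x : {eq_quot loc_rel}).

Lemma loc_piP x y : loc_pi x = loc_pi y <-> loc_rel x y.
Proof.
split=> [/eqP|] h; first by move: h; rewrite /loc_pi eqmodE.
by apply/eqP; rewrite /loc_pi eqmodE.
Qed.
Lemma loc_repr_pi x : loc_rel (loc_repr (loc_pi x)) x.
Proof. by apply/loc_piP; exact: reprK. Qed.
Lemma loc_ind (P : localization -> Prop) :
  (forall x, P (loc_pi x)) -> forall x, P x.
Proof. by move=> h x; rewrite -[x]reprK; exact: h. Qed.

Definition frac_cst (a : R) := FractionPair a mult_closure1.
Definition frac_add (a b : fraction_pair) := FractionPair
  (num a * den b + num b * den a)
  (mult_closure_mul (den_closure a) (den_closure b)).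
Definition frac_mul (a b : fraction_pair) := FractionPair (num a * num b)
  (mult_closure_mul (den_closure a) (den_closure b)).
Definition frac_opp (a : fraction_pair) :=
  FractionPair (- num a) (den_closure a).

Definition loc_cst a := loc_pi (frac_cst a).
Definition loc_add x y := loc_pi (frac_add (loc_repr x) (loc_repr y)).
Definition loc_mul x y := loc_pi (frac_mul (loc_repr x) (loc_repr y)).
Definition loc_opp x := loc_pi (frac_opp (loc_repr x)).

Lemma loc_piD a b : loc_add (loc_pi a) (loc_pi b) = loc_pi (frac_add a b).
Proof.
apply/loc_piP/asboolP => /=.
have /asboolP[u hu eu] := loc_repr_pi a; have /asboolP[v hv ev] := loc_repr_pi b.
move: (loc_repr (loc_pi a)) (loc_repr (loc_pi b)) eu ev => a' b' eu ev.
exists (u * v); first exact: mult_closure_mul.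
transitivity (v * den b' * den b * (u * (num a' * den a)) +
              u * den a' * den a * (v * (num b' * den b))); first by ring.
by rewrite eu ev; ring.
Qed.
Lemma loc_piM a b : loc_mul (loc_pi a) (loc_pi b) = loc_pi (frac_mul a b).
Proof.
apply/loc_piP/asboolP => /=.
have /asboolP[u hu eu] := loc_repr_pi a; have /asboolP[v hv ev] := loc_repr_pi b.
move: (loc_repr (loc_pi a)) (loc_repr (loc_pi b)) eu ev => a' b' eu ev.
exists (u * v); first exact: mult_closure_mul.
transitivity ((u * (num a' * den a)) * (v * (num b' * den b))); first by ring.
by rewrite eu ev; ring.
Qed.
Lemma loc_piN a : loc_opp (loc_pi a) = loc_pi (frac_opp a).
Proof.
apply/loc_piP/asboolP => /=; have /asboolP[u hu eu] := loc_repr_pi a.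
by exists u => //; rewrite !mulNr !mulrN eu.
Qed.

Lemma loc_addA : associative loc_add.
Proof.
elim/loc_ind=> a; elim/loc_ind=> b; elim/loc_ind=> c; rewrite !loc_piD.
by congr loc_pi; apply: fraction_pair_eq => /=; ring.
Qed.
Lemma loc_addC : commutative loc_add.
Proof.
elim/loc_ind=> a; elim/loc_ind=> b; rewrite !loc_piD.
by congr loc_pi; apply: fraction_pair_eq => /=; ring.
Qed.
Lemma loc_add0 : left_id (loc_cst 0) loc_add.
Proof.
elim/loc_ind=> a; rewrite loc_piD.
by congr loc_pi; apply: fraction_pair_eq => /=; ring.
Qed.
Lemma loc_addN : left_inverse (loc_cst 0) loc_opp loc_add.
Proof.
elim/loc_ind=> a; rewrite loc_piN loc_piD; apply/loc_piP/asboolP => /=.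
by exists 1; [exact: mult_closure1 | ring].
Qed.
HB.instance Definition _ :=
  GRing.isZmodule.Build localization loc_addA loc_addC loc_add0 loc_addN.

Lemma loc_mulA : associative loc_mul.
Proof.
elim/loc_ind=> a; elim/loc_ind=> b; elim/loc_ind=> c; rewrite !loc_piM.
by congr loc_pi; apply: fraction_pair_eq => /=; ring.
Qed.
Lemma loc_mulC : commutative loc_mul.
Proof.
elim/loc_ind=> a; elim/loc_ind=> b; rewrite !loc_piM.
by congr loc_pi; apply: fraction_pair_eq => /=; ring.
Qed.
Lemma loc_mul1 : left_id (loc_cst 1) loc_mul.
Proof.
elim/loc_ind=> a; rewrite loc_piM.
by congr loc_pi; apply: fraction_pair_eq => /=; ring.
Qed.
Lemma loc_mulD : left_distributive loc_mul +%R.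
Proof.
elim/loc_ind=> a; elim/loc_ind=> b; elim/loc_ind=> c.
have D x y : loc_pi x + loc_pi y = loc_pi (frac_add x y) by exact: loc_piD.
rewrite D !loc_piM D; apply/loc_piP/asboolP => /=.
by exists 1; [exact: mult_closure1 | ring].
Qed.
HB.instance Definition _ := GRing.Zmodule_isComPzRing.Build localization
  loc_mulA loc_mulC loc_mul1 loc_mulD.

Lemma loc_cst_is_zmod_morphism : zmod_morphism loc_cst.
Proof.
move=> a b; have -> : - loc_cst b = loc_pi (frac_opp (frac_cst b)).
  exact: loc_piN.
transitivity (loc_add (loc_cst a) (loc_pi (frac_opp (frac_cst b)))) => //.
by rewrite loc_piD; congr loc_pi; apply: fraction_pair_eq => /=; ring.
Qed.
Lemma loc_cst_is_monoid_morphism : monoid_morphism loc_cst.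
Proof.
split=> // a b; transitivity (loc_mul (loc_cst a) (loc_cst b)) => //.
by rewrite loc_piM; congr loc_pi; apply: fraction_pair_eq => /=; ring.
Qed.
HB.instance Definition _ := GRing.isZmodMorphism.Build R localization
  loc_cst loc_cst_is_zmod_morphism.
HB.instance Definition _ := GRing.isMonoidMorphism.Build R localization
  loc_cst loc_cst_is_monoid_morphism.

Definition localization_alg : algebra_over R :=
  @AlgebraOver R localization loc_cst.

End Localization.

Definition trivial_alg (R : comPzRingType) : algebra_over R :=
  @AlgebraOver R R idfun.

Section BaseChange.
Variables (R : comPzRingType) (A : algebra_over R) (M : lmodType R).
Local Open Scope quotient_scope.

(* The tensor product of A and M over R, by generators and relations: a formal
   sum of pure tensors is a list of pairs, modulo the congruence below. *)
Inductive tensor_eq : seq (A * M) -> seq (A * M) -> Prop :=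
| tensor_refl s : tensor_eq s s
| tensor_sym s1 s2 : tensor_eq s1 s2 -> tensor_eq s2 s1
| tensor_trans s1 s2 s3 :
    tensor_eq s1 s2 -> tensor_eq s2 s3 -> tensor_eq s1 s3
| tensor_cat s1 s2 t1 t2 :
    tensor_eq s1 t1 -> tensor_eq s2 t2 -> tensor_eq (s1 ++ s2) (t1 ++ t2)
| tensor_swap s1 s2 : tensor_eq (s1 ++ s2) (s2 ++ s1)
| tensor_zero x : tensor_eq [:: (0, x)] [::]
| tensor_addl a b x : tensor_eq [:: (a + b, x)] [:: (a, x); (b, x)]
| tensor_addr a x y : tensor_eq [:: (a, x + y)] [:: (a, x); (a, y)]
| tensor_bal a r x : tensor_eq [:: (a * alg_map A r, x)] [:: (a, r *: x)].

Definition tens_rel s1 s2 := `[< tensor_eq s1 s2 >].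
Lemma tens_refl : reflexive tens_rel.
Proof. by move=> s; apply/asboolP; exact: tensor_refl. Qed.
Lemma tens_sym : symmetric tens_rel.
Proof.
by move=> s t; apply/idP/idP => /asboolP h; apply/asboolP; exact: tensor_sym.
Qed.
Lemma tens_trans : transitive tens_rel.
Proof.
by move=> t s u /asboolP h1 /asboolP h2; apply/asboolP; exact: tensor_trans h2.
Qed.
Canonical tens_equiv := EquivRel tens_rel tens_refl tens_sym tens_trans.

Definition base_change := {eq_quot tens_rel}.
HB.instance Definition _ := Choice.on base_change.
Definition tens_pi s : base_change := \pi_({eq_quot tens_rel}) s.
Definition tens_repr (x : base_change) : seq (A * M) :=
  repr (x : {eq_quot tens_rel}).
Definition pure_tensor a x : base_change := tens_pi [:: (a, x)].

Lemma tens_piP s t : tens_pi s = tens_pi t <-> tensor_eq s t.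
Proof.
split=> [/eqP|] h; first by move: h; rewrite /tens_pi eqmodE => /asboolP.
by apply/eqP; rewrite /tens_pi eqmodE; exact/asboolP.
Qed.
Lemma tens_repr_pi s : tensor_eq (tens_repr (tens_pi s)) s.
Proof. by apply/tens_piP; exact: reprK. Qed.
Lemma tens_ind (P : base_change -> Prop) :
  (forall s, P (tens_pi s)) -> forall x, P x.
Proof. by move=> h x; rewrite -[x]reprK; exact: h. Qed.

Definition formal_scale (a : A) (s : seq (A * M)) :=
  [seq (a * u.1, u.2) | u <- s].

Lemma formal_scale_eq a s t :
  tensor_eq s t -> tensor_eq (formal_scale a s) (formal_scale a t).
Proof.
elim=> {s t} /=.
- by move=> s; exact: tensor_refl.
- by move=> s t _; exact: tensor_sym.
- by move=> s t u _ h _; exact: tensor_trans.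
- by move=> *; rewrite /formal_scale !map_cat; exact: tensor_cat.
- by move=> *; rewrite /formal_scale !map_cat; exact: tensor_swap.
- by move=> x; rewrite mulr0; exact: tensor_zero.
- by move=> b c x; rewrite mulrDr; exact: tensor_addl.
- by move=> b x y; exact: tensor_addr.
- by move=> b r x; rewrite mulrA; exact: tensor_bal.
Qed.

Definition tens_add x y := tens_pi (tens_repr x ++ tens_repr y).
Definition tens_scale a x := tens_pi (formal_scale a (tens_repr x)).
Definition tens_opp x := tens_scale (-1) x.

Lemma tens_piD s t : tens_add (tens_pi s) (tens_pi t) = tens_pi (s ++ t).
Proof. by apply/tens_piP; apply: tensor_cat; exact: tens_repr_pi. Qed.
Lemma tens_piZ a s : tens_scale a (tens_pi s) = tens_pi (formal_scale a s).
Proof. by apply/tens_piP; apply: formal_scale_eq; exact: tens_repr_pi. Qed.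

Lemma tens_addA : associative tens_add.
Proof.
elim/tens_ind=> s; elim/tens_ind=> t; elim/tens_ind=> u.
by rewrite !tens_piD catA.
Qed.
Lemma tens_addC : commutative tens_add.
Proof.
elim/tens_ind=> s; elim/tens_ind=> t; rewrite !tens_piD.
by apply/tens_piP; exact: tensor_swap.
Qed.
Lemma tens_add0 : left_id (tens_pi [::]) tens_add.
Proof. by elim/tens_ind=> s; rewrite tens_piD. Qed.

Lemma formal_scaleDl a b s :
  tensor_eq (formal_scale (a + b) s) (formal_scale a s ++ formal_scale b s).
Proof.
elim: s => [|[c x] s IH] /=; first exact: tensor_refl.
rewrite mulrDl.
apply: tensor_trans
  (_ : tensor_eq _ ([:: (a * c, x); (b * c, x)] ++
                    formal_scale a s ++ formal_scale b s)) _.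
  exact: (tensor_cat (s1 := [:: _])) (tensor_addl _ _ _) IH.
apply: (tensor_cat (s1 := [:: _]) (t1 := [:: _])); first exact: tensor_refl.
rewrite -/(cat [:: (b * c, x)] _).
rewrite -[X in tensor_eq _ (_ ++ X)]/([:: (b * c, x)] ++ _) !catA.
by apply: tensor_cat; [exact: tensor_swap | exact: tensor_refl].
Qed.

Lemma formal_scale0 s : tensor_eq (formal_scale 0 s) [::].
Proof.
elim: s => [|[c x] s IH] /=; first exact: tensor_refl.
by rewrite mul0r; exact: (tensor_cat (s1 := [:: _]) (tensor_zero x) IH).
Qed.

Lemma formal_scale1 s : formal_scale 1 s = s.
Proof. by elim: s => [|[c x] s IH] //=; rewrite mul1r IH. Qed.

Lemma tens_addN : left_inverse (tens_pi [::]) tens_opp tens_add.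
Proof.
elim/tens_ind=> s; rewrite /tens_opp tens_piZ tens_piD; apply/tens_piP.
rewrite -{2}(formal_scale1 s); apply: tensor_trans (formal_scale0 s).
by rewrite -(addNr 1); apply: tensor_sym; exact: formal_scaleDl.
Qed.
HB.instance Definition _ :=
  GRing.isZmodule.Build base_change tens_addA tens_addC tens_add0 tens_addN.

Lemma tens_scaleA a b v : tens_scale a (tens_scale b v) = tens_scale (a * b) v.
Proof.
elim/tens_ind: v => s; rewrite !tens_piZ /formal_scale -map_comp.
by congr tens_pi; apply: eq_map => -[c x] /=; rewrite mulrA.
Qed.
Lemma tens_scale1 : left_id 1 tens_scale.
Proof. by elim/tens_ind=> s; rewrite tens_piZ formal_scale1. Qed.
Lemma tens_scaleDr : right_distributive tens_scale +%R.
Proof.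
move=> a; elim/tens_ind=> s; elim/tens_ind=> t.
by rewrite /GRing.add /= tens_piD !tens_piZ tens_piD /formal_scale map_cat.
Qed.
Lemma tens_scaleDl v : {morph tens_scale^~ v : a b / a + b >-> a + b}.
Proof.
elim/tens_ind: v => s a b.
rewrite !tens_piZ [RHS]/GRing.add /= tens_piD.
by apply/tens_piP; exact: formal_scaleDl.
Qed.
HB.instance Definition _ := GRing.Zmodule_isLmodule.Build A base_change
  tens_scaleA tens_scale1 tens_scaleDr tens_scaleDl.

End BaseChange.

(* Completed group rings of abelian topological groups. Groups are written
   additively, to use the library's topological abelian groups; [cgr_elt g]
   is the group element g seen in the group ring. *)
Notation topAbGroup := PreTopologicalZmodule.type.

Record open_subgroup (G : topAbGroup) := OpenSubgroup {
  osub_set :> set G;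
  osub0 : osub_set 0;
  osubB : forall x y, osub_set x -> osub_set y -> osub_set (x - y);
  osub_open : open osub_set;
  osub_finite_index :
    exists s : seq G, forall g, exists2 h, h \in s & osub_set (g - h) }.

Definition osub_fun (G : topAbGroup) (U : open_subgroup G) : G -> Prop :=
  osub_set U.
Coercion osub_fun : open_subgroup >-> Funclass.

Section CosetSums.
Variables (G : topAbGroup) (U : open_subgroup G).

Lemma osubN x : U x -> U (- x).
Proof. by rewrite -(sub0r x); apply: osubB; exact: osub0. Qed.
Lemma osubD x y : U x -> U y -> U (x + y).
Proof. by move=> Ux Uy; rewrite -(opprK y); apply: osubB => //; exact: osubN. Qed.
Lemma osub_sym x y : U (x - y) -> U (y - x).
Proof. by move=> /osubN; rewrite opprB. Qed.
Lemma osub_trans y x z : U (x - y) -> U (y - z) -> U (x - z).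
Proof. by move=> h1 h2; rewrite -(subrK y x) -addrA; exact: osubD. Qed.

Definition is_transversal (s : seq G) :=
  [/\ uniq s, forall g, exists2 h, h \in s & U (g - h) &
      forall g h, g \in s -> h \in s -> U (g - h) -> g = h].

Lemma transversal_exists : exists s, is_transversal s.
Proof.
have [s cs] := osub_finite_index U.
pose rep g : G := xget 0 [set h | U (g - h)].
have repP g : U (g - rep g).
  apply: (@xgetPex _ 0 [set h | U (g - h)]).
  by exists g; rewrite /= subrr; exact: osub0.
have repE g h : U (g - h) -> rep g = rep h.
  move=> gh; rewrite /rep; congr xget; apply/seteqP; split => x /= hx.
    by apply: osub_trans hx; exact: osub_sym.
  exact: osub_trans gh hx.
exists (undup (map rep s)); split; first exact: undup_uniq.
- move=> g; have [h hs gh] := cs g; exists (rep h).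
    by rewrite mem_undup; exact: map_f.
  by rewrite -(repE _ _ gh).
- move=> g h; rewrite !mem_undup => /mapP[g' _ ->] /mapP[h' _ ->] e.
  apply: repE; apply: osub_trans (repP g') _.
  by apply: osub_trans e _; apply: osub_sym.
Qed.

Definition cosets : seq G := projT1 (cid transversal_exists).
Lemma cosetsP : is_transversal cosets.
Proof. exact: projT2 (cid transversal_exists). Qed.

Variable R : comPzRingType.
Definition coset_invariant (F : G -> R) :=
  forall x y, U (x - y) -> F x = F y.

Lemma eq_transversal_sum s t F : is_transversal s -> is_transversal t ->
  coset_invariant F -> \sum_(h <- s) F h = \sum_(h <- t) F h.
Proof.
move=> [us cs ss] [ut ct st] iF.
pose rho h : G := xget 0 [set y | y \in t /\ U (h - y)].
have rhoP h : rho h \in t /\ U (h - rho h).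
  apply: (@xgetPex _ 0 [set y | y \in t /\ U (h - y)]).
  by have [y] := ct h; exists y.
rewrite (eq_bigr (F \o rho)); last by move=> h _; apply: iF; case: (rhoP h).
rewrite -(big_map rho xpredT F); apply: perm_big; apply: uniq_perm => //.
  rewrite map_inj_in_uniq // => x y xs ys e; apply: ss => //.
  apply: (osub_trans (y := rho x)); first by case: (rhoP x).
  by rewrite e; apply: osub_sym; case: (rhoP y).
move=> y; apply/mapP/idP => [[x _ ->]|yt]; first by case: (rhoP x).
have [x xs yx] := cs y; exists x => //.
apply: st => //; first by case: (rhoP x).
by apply: osub_trans yx _; case: (rhoP x).
Qed.

Lemma transversal_shift s a : is_transversal s -> is_transversal [seq h + a | h <- s].
Proof.
move=> [us cs ss]; split.
- by rewrite map_inj_uniq //; exact: addIr.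
- move=> g; have [h hs gh] := cs (g - a); exists (h + a); first exact: map_f.
  by rewrite opprD addrA addrAC.
- move=> g h /mapP[g' g's ->] /mapP[h' h's ->].
  by rewrite opprD addrACA subrr addr0 => e; rewrite (ss g' h').
Qed.

Lemma transversal_refl s a : is_transversal s -> is_transversal [seq a - h | h <- s].
Proof.
move=> [us cs ss]; split.
- by rewrite map_inj_uniq // => x y /addrI/oppr_inj.
- move=> g; have [h hs gh] := cs (a - g); exists (a - h); first exact: map_f.
  have -> : g - (a - h) = - (a - g - h) by rewrite !opprB addrCA.
  exact: osubN.
- move=> g h /mapP[g' g's ->] /mapP[h' h's ->].
  rewrite opprB addrC addrA subrK => e; rewrite (ss g' h') //.
  exact: osub_sym.
Qed.

Lemma coset_sum_shift a F : coset_invariant F ->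
  \sum_(h <- cosets) F (h + a) = \sum_(h <- cosets) F h.
Proof.
move=> iF; rewrite -(big_map (fun h => h + a) xpredT F).
by apply: eq_transversal_sum => //; [apply: transversal_shift|]; exact: cosetsP.
Qed.

Lemma coset_sum_refl a F : coset_invariant F ->
  \sum_(h <- cosets) F (a - h) = \sum_(h <- cosets) F h.
Proof.
move=> iF; rewrite -(big_map (fun h => a - h) xpredT F).
by apply: eq_transversal_sum => //; [apply: transversal_refl|]; exact: cosetsP.
Qed.

Definition indic (P : Prop) : R := (`[< P >])%:R.

Lemma indicE (P Q : Prop) : (P <-> Q) -> indic P = indic Q.
Proof. by move=> e; rewrite /indic (asbool_equiv_eq e). Qed.
Lemma indicT (P : Prop) : P -> indic P = 1.
Proof. by rewrite /indic => /asboolT ->. Qed.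
Lemma indicF (P : Prop) : ~ P -> indic P = 0.
Proof. by rewrite /indic => /asboolF ->. Qed.

Lemma coset_sum_indic a F : coset_invariant F ->
  \sum_(h <- cosets) indic (U (h - a)) * F h = F a.
Proof.
move=> iF; have [us cs ss] := cosetsP; have [b bs ab] := cs a.
rewrite (bigD1_seq b) //= indicT; last exact: osub_sym.
rewrite mul1r (iF _ _ (osub_sym ab)) big1_seq ?addr0 // => h /andP[/eqP hb hs].
rewrite indicF ?mul0r // => ha; apply: hb; apply: ss => //.
exact: osub_trans ha ab.
Qed.

Lemma coset_invariant_indic (P : G -> Prop) F :
  (forall x y, U (x - y) -> P x -> P y) -> coset_invariant F ->
  coset_invariant (fun h => indic (P h) * F h).
Proof.
move=> hP iF x y xy; rewrite (iF _ _ xy); congr (_ * _); apply: indicE.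
by split; apply: hP => //; exact: osub_sym.
Qed.

End CosetSums.
Arguments cosets {G} U.

Section CompletedGroupRing.
Variables (R : comPzRingType) (G : topAbGroup).

(* An element of R[[G]], the inverse limit of the group rings R[G/U] over the
   open subgroups U of finite index: [cgr_coef a U g] is the coefficient of
   the coset g + U in the component of index U. *)
Record cgr := Cgr {
  cgr_coef :> open_subgroup G -> G -> R;
  cgr_inv : forall (U : open_subgroup G) x y,
    U (x - y) -> cgr_coef U x = cgr_coef U y;
  cgr_compat : forall U V : open_subgroup G, U `<=` V -> forall g,
    cgr_coef V g = \sum_(h <- cosets U | `[< V (h - g) >]) cgr_coef U h }.

Lemma cgr_eq (a b : cgr) : (forall U g, a U g = b U g) -> a = b.
Proof.
case: a => a ha ha'; case: b => b hb hb' /= e.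
have {}e : a = b by apply/funext => U; apply/funext => g; exact: e.
by subst b; congr Cgr; exact: Prop_irrelevance.
Qed.

HB.instance Definition _ := gen_eqMixin cgr.
HB.instance Definition _ := gen_choiceMixin cgr.

Lemma sum_indic (I : Type) (s : seq I) (P : I -> Prop) (F : I -> R) :
  \sum_(i <- s | `[< P i >]) F i = \sum_(i <- s) indic R (P i) * F i.
Proof.
rewrite big_mkcond; apply: eq_bigr => i _; rewrite /indic.
by case: asboolP => _; rewrite ?mul1r ?mul0r.
Qed.

Lemma cgr_compat_indic (a : cgr) (U V : open_subgroup G) g : U `<=` V ->
  a V g = \sum_(h <- cosets U) indic R (V (h - g)) * a U h.
Proof. by move=> UV; rewrite (cgr_compat a UV) sum_indic. Qed.

Lemma osub_shift_l (U : open_subgroup G) x y a : U (x - y) -> U (x - a) -> U (y - a).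
Proof. by move=> xy; apply: osub_trans; exact: osub_sym. Qed.

Lemma cgr_inv_sub (a : cgr) (U : open_subgroup G) g x y :
  U (x - y) -> a U (g - x) = a U (g - y).
Proof.
move=> xy; apply: cgr_inv; rewrite opprB addrC addrA subrK.
exact: osub_sym.
Qed.

Section Elt.
Variable k : G.
Definition elt_coef (U : open_subgroup G) g : R := indic R (U (g - k)).
Lemma elt_inv (U : open_subgroup G) x y :
  U (x - y) -> elt_coef U x = elt_coef U y.
Proof.
move=> xy; apply: indicE; split; apply: osub_shift_l => //.
exact: osub_sym.
Qed.
Lemma elt_compat (U V : open_subgroup G) : U `<=` V -> forall g,
  elt_coef V g = \sum_(h <- cosets U | `[< V (h - g) >]) elt_coef U h.
Proof.
move=> UV g; rewrite sum_indic.
under eq_bigr do rewrite mulrC.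
rewrite (coset_sum_indic _ (F := fun h => indic R (V (h - g)))).
  by apply: indicE; split; exact: osub_sym.
move=> x y /UV xy; apply: indicE; split; apply: osub_shift_l => //.
exact: osub_sym.
Qed.
Definition cgr_elt : cgr := Cgr elt_inv elt_compat.
End Elt.

Section Operations.
Variables a b : cgr.

Definition zero_coef (U : open_subgroup G) (g : G) : R := 0.
Lemma zero_compat (U V : open_subgroup G) : U `<=` V -> forall g,
  zero_coef V g = \sum_(h <- cosets U | `[< V (h - g) >]) zero_coef U h.
Proof. by move=> UV g; rewrite big1. Qed.
Definition cgr_zero : cgr :=
  @Cgr zero_coef (fun _ _ _ _ => erefl) zero_compat.

Definition add_coef U g := a U g + b U g.
Lemma add_inv (U : open_subgroup G) x y :
  U (x - y) -> add_coef U x = add_coef U y.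
Proof. by move=> xy; rewrite /add_coef (cgr_inv a xy) (cgr_inv b xy). Qed.
Lemma add_compat (U V : open_subgroup G) : U `<=` V -> forall g,
  add_coef V g = \sum_(h <- cosets U | `[< V (h - g) >]) add_coef U h.
Proof.
by move=> UV g; rewrite big_split /= /add_coef (cgr_compat a UV) (cgr_compat b UV).
Qed.
Definition cgr_add := Cgr add_inv add_compat.

Definition opp_coef U g := - a U g.
Lemma opp_inv (U : open_subgroup G) x y :
  U (x - y) -> opp_coef U x = opp_coef U y.
Proof. by move=> xy; rewrite /opp_coef (cgr_inv a xy). Qed.
Lemma opp_compat (U V : open_subgroup G) : U `<=` V -> forall g,
  opp_coef V g = \sum_(h <- cosets U | `[< V (h - g) >]) opp_coef U h.
Proof. by move=> UV g; rewrite sumrN /opp_coef (cgr_compat a UV). Qed.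
Definition cgr_opp := Cgr opp_inv opp_compat.

Definition mul_coef (U : open_subgroup G) g :=
  \sum_(h <- cosets U) a U h * b U (g - h).
Lemma mul_inv (U : open_subgroup G) x y :
  U (x - y) -> mul_coef U x = mul_coef U y.
Proof.
move=> xy; apply: eq_bigr => h _; congr (_ * _); apply: cgr_inv.
by rewrite opprB addrA subrK.
Qed.
Lemma mul_compat (U V : open_subgroup G) : U `<=` V -> forall g,
  mul_coef V g = \sum_(h <- cosets U | `[< V (h - g) >]) mul_coef U h.
Proof.
move=> UV g; rewrite sum_indic.
transitivity (\sum_(k <- cosets U) a U k * b V (g - k)); last first.
  under [RHS]eq_bigr do rewrite /mul_coef big_distrr /=.
  rewrite exchange_big /=; apply: eq_bigr => k _.
  rewrite (cgr_compat_indic b _ UV) big_distrr /=.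
  rewrite -(coset_sum_shift k (U := U)
    (F := fun h => indic R (V (h - g)) * (a U k * b U (h - k)))); last first.
    apply: coset_invariant_indic.
      by move=> x y /UV; exact: osub_shift_l.
    move=> x y xy; congr (_ * _); apply: cgr_inv.
    by rewrite opprB addrA subrK.
  apply: eq_bigr => h _; rewrite addrK mulrCA; congr (_ * (_ * _)).
  by apply: indicE; rewrite opprB addrA.
rewrite /mul_coef.
transitivity (\sum_(m <- cosets V) \sum_(k <- cosets U)
    indic R (V (k - m)) * a U k * b V (g - k)).
  apply: eq_bigr => m _; rewrite (cgr_compat_indic a _ UV) big_distrl /=.
  apply: eq_bigr => k _; have [km|nkm] := pselect (V (k - m)).
    by rewrite (cgr_inv_sub b g km).
  by rewrite indicF // !mul0r.
rewrite exchange_big /=; apply: eq_bigr => k _.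
rewrite -[RHS](coset_sum_indic (U := V) k (F := fun=> a U k * b V (g - k))) //.
apply: eq_bigr => m _; rewrite -mulrA; congr (_ * _).
by apply: indicE; split; exact: osub_sym.
Qed.
Definition cgr_mul := Cgr mul_inv mul_compat.
End Operations.

Lemma cgr_addA : associative cgr_add.
Proof. by move=> a b c; apply: cgr_eq => U g; exact: addrA. Qed.
Lemma cgr_addC : commutative cgr_add.
Proof. by move=> a b; apply: cgr_eq => U g; exact: addrC. Qed.
Lemma cgr_add0 : left_id cgr_zero cgr_add.
Proof. by move=> a; apply: cgr_eq => U g; exact: add0r. Qed.
Lemma cgr_addN : left_inverse cgr_zero cgr_opp cgr_add.
Proof. by move=> a; apply: cgr_eq => U g; exact: addNr. Qed.
HB.instance Definition _ :=
  GRing.isZmodule.Build cgr cgr_addA cgr_addC cgr_add0 cgr_addN.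

Lemma cgr_mulA : associative cgr_mul.
Proof.
move=> a b c; apply: cgr_eq => U g /=; rewrite /mul_coef /=.
under [RHS]eq_bigr do rewrite /mul_coef big_distrl /=.
rewrite exchange_big /=; apply: eq_bigr => k _; rewrite /mul_coef big_distrr /=.
rewrite -(coset_sum_shift k (U := U)
   (F := fun h => a U k * b U (h - k) * c U (g - h))); last first.
  move=> x y xy; rewrite (cgr_inv_sub c g xy); congr (_ * _ * _).
  by apply: cgr_inv; rewrite opprB addrA subrK.
by apply: eq_bigr => m _; rewrite addrK mulrA opprD addrA addrAC.
Qed.
Lemma cgr_mulC : commutative cgr_mul.
Proof.
move=> a b; apply: cgr_eq => U g /=; rewrite /mul_coef.
rewrite -(coset_sum_refl g (U := U) (F := fun h => a U h * b U (g - h))).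
  by apply: eq_bigr => h _; rewrite mulrC subKr.
by move=> x y xy; rewrite (cgr_inv_sub b g xy) (cgr_inv a xy).
Qed.
Lemma cgr_mul1 : left_id (cgr_elt 0) cgr_mul.
Proof.
move=> a; apply: cgr_eq => U g /=; rewrite /mul_coef /= /elt_coef.
rewrite (coset_sum_indic _ (U := U) (F := fun h => a U (g - h))) ?subr0 //.
by move=> x y; exact: cgr_inv_sub.
Qed.
Lemma cgr_mulD : left_distributive cgr_mul +%R.
Proof.
move=> a b c; apply: cgr_eq => U g /=.
rewrite /add_coef /= /mul_coef -big_split /=.
by apply: eq_bigr => h _; exact: mulrDl.
Qed.
HB.instance Definition _ := GRing.Zmodule_isComPzRing.Build cgr
  cgr_mulA cgr_mulC cgr_mul1 cgr_mulD.

End CompletedGroupRing.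

Record cont_hom (G G' : topAbGroup) := ContHom {
  cont_hom_fun :> G -> G';
  cont_homB : zmod_morphism cont_hom_fun;
  cont_hom_continuous : continuous cont_hom_fun }.

Section Functoriality.
Variables (R : comPzRingType) (G G' : topAbGroup) (r : cont_hom G G').

Lemma cont_hom0 : r 0 = 0.
Proof. by rewrite -(subrr 0) cont_homB subrr. Qed.

Section Preimage.
Variable V : open_subgroup G'.
Lemma preim0 : (r @^-1` V) 0.
Proof. by rewrite /= cont_hom0; exact: osub0. Qed.
Lemma preimB x y : (r @^-1` V) x -> (r @^-1` V) y -> (r @^-1` V) (x - y).
Proof. by rewrite /= cont_homB; exact: osubB. Qed.
Lemma preim_open : open (r @^-1` V).
Proof.
by move: r (@cont_hom_continuous _ _ r) => f /continuousP; apply; exact: osub_open.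
Qed.
Lemma preim_finite_index :
  exists s : seq G, forall g, exists2 h, h \in s & (r @^-1` V) (g - h).
Proof.
have [s cs] := osub_finite_index V.
pose l (y : G') : G := xget 0 [set g | V (r g - y)].
exists (map l s) => g; have [h hs gh] := cs (r g).
exists (l h); first exact: map_f.
rewrite /= cont_homB; apply: (osub_trans gh); apply: osub_sym.
by apply: (@xgetPex _ 0 [set g | V (r g - h)]); exists g.
Qed.
Definition osub_preim : open_subgroup G :=
  OpenSubgroup preim0 preimB preim_open preim_finite_index.
End Preimage.

Section Push.
Variable a : cgr R G.
(* the component of index V is the image of the component of index r^-1(V)
   under the homomorphism of group rings induced by G/r^-1(V) -> G'/V *)
Definition push_coef (V : open_subgroup G') (g : G') : R :=
  \sum_(h <- cosets (osub_preim V) | `[< V (r h - g) >]) a (osub_preim V) h.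
Lemma push_inv (V : open_subgroup G') x y :
  V (x - y) -> push_coef V x = push_coef V y.
Proof.
move=> xy; rewrite /push_coef !sum_indic; apply: eq_bigr => h _.
by congr (_ * _); apply: indicE; split => e; apply: osub_trans e _ => //;
  exact: osub_sym.
Qed.
Lemma push_compat (U V : open_subgroup G') : U `<=` V -> forall g,
  push_coef V g = \sum_(h <- cosets U | `[< V (h - g) >]) push_coef U h.
Proof.
move=> UV g; rewrite /push_coef !sum_indic.
have rUV : osub_preim U `<=` osub_preim V by move=> x; exact: UV.
transitivity (\sum_(m <- cosets (osub_preim U))
    indic R (V (r m - g)) * a (osub_preim U) m).
  under eq_bigr do rewrite (cgr_compat_indic a _ rUV) big_distrr /=.
  rewrite exchange_big /=; apply: eq_bigr => m _.
  rewrite -(coset_sum_indic (U := osub_preim V) m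
    (F := fun h => indic R (V (r h - g)) * a (osub_preim U) m)); last first.
    move=> x y; rewrite /= /osub_fun /= cont_homB => xy.
    congr (_ * _); apply: indicE; split; apply: osub_shift_l => //.
    exact: osub_sym.
  apply: eq_bigr => h _; rewrite mulrCA; congr (_ * _).
  by apply: indicE; split; exact: (osub_sym (U := osub_preim V)).
under [RHS]eq_bigr do rewrite sum_indic big_distrr /=.
rewrite exchange_big /=; apply: eq_bigr => m _.
rewrite -(coset_sum_indic (U := U) (r m)
  (F := fun h => indic R (V (h - g)) * a (osub_preim U) m)); last first.
  move=> x y /UV xy; congr (_ * _); apply: indicE.
  by split; apply: osub_shift_l => //; exact: osub_sym.
apply: eq_bigr => h _; rewrite mulrCA; congr (_ * (_ * _)).
by apply: indicE; split; exact: osub_sym.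
Qed.
Definition cgr_push : cgr R G' := Cgr push_inv push_compat.
End Push.

Lemma cgr_push_is_zmod_morphism : zmod_morphism cgr_push.
Proof.
move=> a b; apply: cgr_eq => V g.
by rewrite /= /push_coef /= /add_coef /= /opp_coef -sumrB.
Qed.

Lemma cgr_push_is_monoid_morphism : monoid_morphism cgr_push.
Proof.
split=> [|a b]; apply: cgr_eq => V g; rewrite /= /push_coef sum_indic.
  rewrite /= /elt_coef; under eq_bigr do rewrite mulrC.
  rewrite (coset_sum_indic (U := osub_preim V) 0
    (F := fun h => indic R (V (r h - g)))).
    by rewrite cont_hom0; apply: indicE; split; exact: osub_sym.
  move=> x y; rewrite /= /osub_fun /= cont_homB => xy.
  by apply: indicE; split; apply: osub_shift_l => //; exact: osub_sym.
rewrite /= /mul_coef /=; set U := osub_preim V.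
transitivity (\sum_(k <- cosets U) a U k * push_coef b V (g - r k)).
  under eq_bigr do rewrite big_distrr /=.
  rewrite exchange_big /=; apply: eq_bigr => k _.
  rewrite /push_coef sum_indic big_distrr /=.
  rewrite -(coset_sum_shift k (U := U)
    (F := fun h => indic R (V (r h - g)) * (a U k * b U (h - k)))); last first.
    apply: coset_invariant_indic.
      move=> x y; rewrite /= /osub_fun /= cont_homB; exact: osub_shift_l.
    move=> x y xy; congr (_ * _); apply: cgr_inv.
    by rewrite opprB addrA subrK.
  apply: eq_bigr => h _; rewrite addrK mulrCA; congr (_ * (_ * _)).
  apply: indicE.
  rewrite -{1}(opprK k) cont_homB -(sub0r k) cont_homB cont_hom0 sub0r.
  by rewrite opprK opprB addrA.
under [RHS]eq_bigr do rewrite {1}/push_coef sum_indic big_distrl /=.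
rewrite exchange_big /=; apply: eq_bigr => k _.
rewrite -(coset_sum_indic (U := V) (r k)
  (F := fun h => a U k * push_coef b V (g - h))); last first.
  move=> x y xy; congr (_ * _); apply: push_inv.
  rewrite opprB addrC addrA subrK; exact: osub_sym.
apply: eq_bigr => h _; rewrite mulrA; congr (_ * _ * _).
by apply: indicE; split; exact: osub_sym.
Qed.

HB.instance Definition _ := GRing.isZmodMorphism.Build (cgr R G) (cgr R G')
  cgr_push cgr_push_is_zmod_morphism.
HB.instance Definition _ := GRing.isMonoidMorphism.Build (cgr R G) (cgr R G')
  cgr_push cgr_push_is_monoid_morphism.

End Functoriality.

Section Automorphisms.
Variables (k K : fieldType) (iota : {rmorphism k -> K}).

Definition is_automorphism (f : K -> K) : Prop :=
  [/\ zmod_morphism f, monoid_morphism f, bijective f &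
      forall a, f (iota a) = iota a].

Record aut := Aut { aut_fun :> K -> K; autP : is_automorphism aut_fun }.

Lemma aut_eq (s t : aut) : (forall x, s x = t x) -> s = t.
Proof.
case: s => s hs; case: t => t ht /= /funext e.
by subst s; congr Aut; exact: Prop_irrelevance.
Qed.

Lemma aut_zmod_morphism (s : aut) : zmod_morphism s.
Proof. by case: (autP s). Qed.
Lemma aut_monoid_morphism (s : aut) : monoid_morphism s.
Proof. by case: (autP s). Qed.
HB.instance Definition _ (s : aut) :=
  GRing.isZmodMorphism.Build K K s (aut_zmod_morphism s).
HB.instance Definition _ (s : aut) :=
  GRing.isMonoidMorphism.Build K K s (aut_monoid_morphism s).

Lemma aut_base (s : aut) a : s (iota a) = iota a.
Proof. by case: (autP s). Qed.
Lemma aut_inj (s : aut) : injective s.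
Proof. exact: fmorph_inj. Qed.

HB.instance Definition _ := gen_eqMixin aut.
HB.instance Definition _ := gen_choiceMixin aut.

Lemma aut1P : is_automorphism id.
Proof. by split=> //; exists id. Qed.
Definition aut1 := Aut aut1P.

Lemma aut_compP (s t : aut) : is_automorphism (s \o t).
Proof.
have [sB [s1 sM] bs sa] := autP s; have [tB [t1 tM] bt ta] := autP t; split.
- by move=> x y /=; rewrite tB sB.
- by split=> [|x y] /=; rewrite ?t1 ?s1 // tM sM.
- exact: bij_comp.
- by move=> a /=; rewrite ta sa.
Qed.
Definition aut_comp (s t : aut) := Aut (aut_compP s t).

Lemma aut_inv_exists (s : aut) : exists g : K -> K, cancel s g /\ cancel g s.
Proof. by have [_ _ [g gK Kg] _] := autP s; exists g. Qed.
Definition aut_inv_fun (s : aut) := projT1 (cid (aut_inv_exists s)).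
Lemma aut_invK (s : aut) : cancel s (aut_inv_fun s).
Proof. by have [] := projT2 (cid (aut_inv_exists s)). Qed.
Lemma aut_Kinv (s : aut) : cancel (aut_inv_fun s) s.
Proof. by have [] := projT2 (cid (aut_inv_exists s)). Qed.
Lemma aut_invP (s : aut) : is_automorphism (aut_inv_fun s).
Proof.
have [sB [s1 sM] bs sa] := autP s; have sI := bij_inj bs.
have sK := aut_Kinv s; split.
- by move=> x y; apply: sI; rewrite sB !sK.
- by split=> [|x y]; apply: sI; rewrite ?s1 ?sM !sK.
- by exists s => //; exact: aut_invK.
- by move=> a; apply: sI; rewrite sK sa.
Qed.
Definition aut_inv (s : aut) := Aut (aut_invP s).

Definition krull_open : set (set aut) :=
  [set U : set aut | forall s, U s ->
    exists l : seq K, forall t : aut, {in l, t =1 s} -> U t].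

Lemma krull_openT : krull_open setT. Proof. by move=> s _; exists [::]. Qed.
Lemma krull_openI : setI_closed krull_open.
Proof.
move=> U V oU oV s [Us Vs]; have [l hl] := oU s Us; have [m hm] := oV s Vs.
exists (l ++ m) => t e; split; [apply: hl | apply: hm] => x xl; apply: e;
  by rewrite mem_cat xl ?orbT.
Qed.
Lemma krull_open_bigU (I : Type) (f : I -> set aut) :
  (forall i, krull_open (f i)) -> krull_open (\bigcup_i f i).
Proof.
move=> h s [i _ fs]; have [l hl] := h i s fs.
by exists l => t e; exists i => //; exact: hl.
Qed.
HB.instance Definition _ :=
  isOpenTopological.Build aut krull_openT krull_openI krull_open_bigU.

(* In characteristic 0, K/k is Galois iff it is algebraic and k is the fixed
   field of Aut(K/k). *)
Definition galois_extension : Prop :=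
  (forall x : K, algebraicOver iota x) /\
  (forall x : K, (forall s : aut, s x = x) -> exists a, x = iota a).

End Automorphisms.

Record zp_ext (p d : nat) (k : fieldType) := ZpExt {
  ext_field :> fieldType;
  ext_in : {rmorphism k -> ext_field};
  ext_galois : galois_extension ext_in;
  ext_iso : exists (e : 'cV[padic_int p]_d -> aut ext_in)
                   (e' : aut ext_in -> 'cV[padic_int p]_d),
    [/\ forall u v, e (u + v) = aut_comp (e u) (e v),
        cancel e e', cancel e' e, continuous e & continuous e'] }.
Arguments ext_in {p d k} z.

Section GaloisGroup.
Variables (p d : nat) (k : fieldType) (K : zp_ext p d k).

Definition gal_group := aut (ext_in K).
HB.instance Definition _ := Topological.on gal_group.

Lemma gal_comm : commutative (@aut_comp _ _ (ext_in K)).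
Proof.
have [e [e' [eD _ Ke _ _]]] := ext_iso K.
by move=> s t; rewrite -(Ke s) -(Ke t) -!eD addrC.
Qed.
Lemma gal_compA : associative (@aut_comp _ _ (ext_in K)).
Proof. by move=> s t u; exact: aut_eq. Qed.
Lemma gal_comp1 : left_id (aut1 (ext_in K)) (@aut_comp _ _ (ext_in K)).
Proof. by move=> s; exact: aut_eq. Qed.
Lemma gal_compV :
  left_inverse (aut1 (ext_in K)) (@aut_inv _ _ (ext_in K)) (@aut_comp _ _ (ext_in K)).
Proof. by move=> s; apply: aut_eq => x /=; exact: aut_invK. Qed.

(* the abelian group law of Gal(K/k), written additively, is composition *)
HB.instance Definition _ :=
  GRing.isZmodule.Build gal_group gal_compA gal_comm gal_comp1 gal_compV.

End GaloisGroup.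

Record zp_subext (p d i : nat) (k : fieldType) (K : zp_ext p d k) := ZpSubext {
  sub_field :> zp_ext p i k;
  sub_emb : {rmorphism sub_field -> K};
  sub_embE : forall a, sub_emb (ext_in sub_field a) = ext_in K a }.
Arguments sub_emb {p d i k K} z.

Section Restriction.
Variables (p d i : nat) (k : fieldType) (K : zp_ext p d k) (L : zp_subext i K).
Local Notation j := (sub_emb L).

Definition relative_gal : set (gal_group K) := [set s | forall x : L, s (j x) = j x].

Lemma poly_roots (F : fieldType) (q : {poly F}) : q != 0 ->
  exists s : seq F, forall x, root q x -> x \in s.
Proof.
have [n] := ubnP (size q); elim: n q => // n IH q ltqn q0.
have [[a ra]|nr] := pselect (exists a, root q a); last first.
  by exists [::] => x rx; case: nr; exists x.
have /factor_theorem[q' e] := ra; have q'0 : q' != 0.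
  by apply: contraNneq q0 => e'; rewrite e e' mul0r.
have [|s hs] := IH q' _ q'0.
  by move: ltqn; rewrite e size_Mmonic ?monicXsubC // size_XsubC addn2.
exists (a :: s) => x; rewrite e rootM root_XsubC inE => /orP[/hs -> //|->//].
by rewrite orbT.
Qed.

Lemma restr_stable (s : gal_group K) (x : L) : exists y : L, s (j x) = j y.
Proof.
have [algL fixL] := ext_galois L.
have [q q0 rq] := algL x.
have [l hl] : exists l : seq L, forall y, root (map_poly (ext_in L) q) y -> y \in l.
  by apply: poly_roots; rewrite map_poly_eq0.
pose orb := undup [seq y <- l | `[< exists t : gal_group L, t x = y >]].
have orbP y : (y \in orb) <-> exists t : gal_group L, t x = y.
  rewrite mem_undup mem_filter; split=> [/andP[/asboolP//]|[t e]].
  apply/andP; split; first by apply/asboolP; exists t.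
  apply: hl; rewrite -e -(eq_map_poly (aut_base t)) map_poly_comp.
  exact: rmorph_root.
have x_orb : x \in orb by apply/orbP; exists (aut1 (ext_in L)).
pose P : {poly L} := \prod_(y <- orb) ('X - y%:P).
have fixP (t : gal_group L) : map_poly t P = P.
  rewrite /P rmorph_prod /=.
  under eq_bigr do rewrite rmorphB /= map_polyX map_polyC.
  rewrite -(big_map (aut_fun t) xpredT (fun y => 'X - y%:P)).
  have ut : uniq (map (aut_fun t) orb).
    by rewrite map_inj_uniq ?undup_uniq //; exact: aut_inj.
  apply: perm_big; apply: uniq_perm => //; first exact: undup_uniq.
  have sub : {subset map (aut_fun t) orb <= orb}.
    move=> y /mapP[z /orbP[u <-] ->]; apply/orbP.
    by exists (aut_comp t u).
  by have [] := uniq_min_size ut sub; rewrite ?size_map.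
have coefP n : exists a, P`_n = ext_in L a.
  by apply: fixL => t; rewrite -{2}(fixP t) coef_map.
have e : map_poly s (map_poly j P) = map_poly j P.
  apply/polyP => n; rewrite !coef_map /=; have [a ->] := coefP n.
  by rewrite sub_embE aut_base.
have : root (map_poly j P) (s (j x)).
  rewrite -e; do 2!apply: rmorph_root.
  by rewrite /P root_prod_XsubC.
rewrite /P rmorph_prod /=.
under eq_bigr do rewrite rmorphB /= map_polyX map_polyC.
rewrite -(big_map j xpredT (fun y => 'X - y%:P)) root_prod_XsubC.
by move=> /mapP[y _ ->]; exists y.
Qed.

Definition restr_fun (s : gal_group K) (x : L) : L := projT1 (cid (restr_stable s x)).
Lemma restr_funE s x : j (restr_fun s x) = s (j x).
Proof. by rewrite /restr_fun; case: cid => y /= ->. Qed.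

Lemma restr_funP s : is_automorphism (ext_in L) (restr_fun s).
Proof.
have jI : injective j by exact: fmorph_inj.
split.
- by move=> x y; apply: jI; rewrite rmorphB !restr_funE !rmorphB.
- split=> [|x y]; apply: jI; first by rewrite restr_funE !rmorph1.
  by rewrite rmorphM !restr_funE !rmorphM.
- exists (restr_fun (aut_inv s)) => x; apply: jI; rewrite !restr_funE.
    exact: aut_invK.
  exact: aut_Kinv.
- by move=> a; apply: jI; rewrite restr_funE !sub_embE aut_base.
Qed.
Definition restr (s : gal_group K) : gal_group L := Aut (restr_funP s).

Lemma restr_zmod_morphism : zmod_morphism restr.
Proof.
have jI : injective j by exact: fmorph_inj.
have hD s t : restr (s + t) = restr s + restr t.
  by apply: aut_eq => x; apply: jI; rewrite /= !restr_funE.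
by move=> s t; rewrite -{2}(subrK t s) [X in _ = X - _]hD addrK.
Qed.

Lemma restr_continuous : continuous restr.
Proof.
apply/continuousP => U oU; suff : krull_open (restr @^-1` U) by [].
move=> s Us; have [l hl] := (oU : krull_open U) _ Us.
exists (map j l) => t e; apply: hl => x xl; apply: (fmorph_inj j).
by rewrite /= !restr_funE; apply: e; exact: map_f.
Qed.

Definition restriction : cont_hom (gal_group K) (gal_group L) :=
  ContHom restr_zmod_morphism restr_continuous.

End Restriction.
Arguments relative_gal {p d i k K} L.

Section Iwasawa.
Variables (p d : nat) (k : fieldType).

Definition Iwasawa (K : zp_ext p d k) : comPzRingType :=
  cgr (padic_int p) (gal_group K).

Definition dagger (K : zp_ext p d k) : algebra_over (Iwasawa K) :=
  if d == 1%N then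
    localization_alg
      [set (cgr_elt (padic_int p) g - 1 : Iwasawa K) |
        g in [set g : gal_group K | g != 0]]
  else trivial_alg (Iwasawa K).

End Iwasawa.
Arguments dagger {p d k} K.

Section Coinvariants.
Variables (p d i : nat) (k : fieldType) (K : zp_ext p d k) (L : zp_subext i K).

Definition Iwasawa_restr : {rmorphism Iwasawa K -> Iwasawa L} :=
  @cgr_push (padic_int p) _ _ (restriction L).

(* q : X -> Y exhibits Y as the coinvariants of X under Gal(K/L), regarded as
   a module over the Iwasawa algebra of L/k, on which an element acts as any
   of its lifts to the Iwasawa algebra of K/k. *)
Record is_coinvariants (X : lmodType (Iwasawa K)) (Y : lmodType (Iwasawa L))
    (q : X -> Y) : Prop := IsCoinvariants {
  coinv_additive : zmod_morphism q;
  coinv_surj : forall y, exists x, q x = y;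
  coinv_ker : forall x, q x = 0 <->
    submod_span [set y | exists g : gal_group K, exists2 x' : X, relative_gal L g &
                  y = ((cgr_elt (padic_int p) g : Iwasawa K) - 1) *: x'] x;
  coinv_scale : forall (a : Iwasawa K) x, q (a *: x) = Iwasawa_restr a *: q x }.

End Coinvariants.
Arguments Iwasawa_restr {p d i k K} L.

Notation Borel T := (g_sigma_algebraType (@open T)).

Section GeneralLinear.
Variables (p d : nat).

Definition GL_set : set 'M[padic_int p]_d :=
  [set g | exists h, g *m h = 1%:M /\ h *m g = 1%:M].
Definition GL : Type := set_type GL_set.
HB.instance Definition _ := Topological.on GL.

Definition GL_mx (g : GL) : 'M[padic_int p]_d := set_val g.

Lemma GL_mxP (g : GL) : exists h, GL_mx g *m h = 1%:M /\ h *m GL_mx g = 1%:M.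
Proof. by have /set_mem := valP g. Qed.

Definition GL_mk g (h : GL_set g) : GL := exist _ g (mem_set h).

Lemma GL_mkK g (h : GL_set g) : GL_mx (GL_mk h) = g.
Proof. by rewrite /GL_mx set_valE. Qed.

Lemma GL1P : GL_set 1%:M. Proof. by exists 1%:M; rewrite mulmx1. Qed.
Definition GL1 := GL_mk GL1P.
HB.instance Definition _ := isPointed.Build GL GL1.

Lemma GL_mulP (g h : GL) : GL_set (GL_mx g *m GL_mx h).
Proof.
have [g' [e1 e2]] := GL_mxP g; have [h' [e3 e4]] := GL_mxP h.
exists (h' *m g'); split.
  by rewrite mulmxA -(mulmxA _ _ h') e3 mulmx1.
by rewrite mulmxA -(mulmxA _ g') e2 mulmx1.
Qed.
Definition GL_mul (g h : GL) : GL := GL_mk (GL_mulP g h).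

Definition is_haar (R : realType) (mu : probability (Borel GL) R) : Prop :=
  forall (g : GL) (A : set (Borel GL)), measurable A ->
    mu [set GL_mul g h | h in A] = mu A.

End GeneralLinear.

Section Grassmannian.
Variables (p i r : nat).
Local Notation M := 'cV[padic_int p]_(i + r).

Record Gr := MkGr {
  Gr_mod :> submod M;
  Gr_free : exists f : {linear quo_mod Gr_mod -> 'cV[padic_int p]_i}, bijective f }.

HB.instance Definition _ := gen_eqMixin Gr.
HB.instance Definition _ := gen_choiceMixin Gr.

(* the base point N_0 of the Grassmannian *)
Definition base_set : set M := [set v | usubmx v = 0].
Lemma base0 : base_set 0. Proof. exact: linear0. Qed.
Lemma baseD x y : base_set x -> base_set y -> base_set (x + y).
Proof.
move=> hx hy; transitivity (usubmx x + usubmx y); first exact: linearD.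
by rewrite hx hy addr0.
Qed.
Lemma baseZ a x : base_set x -> base_set (a *: x).
Proof.
move=> hx; transitivity (a *: usubmx x); first exact: linearZ_LR.
by rewrite hx scaler0.
Qed.
Definition base_mod : submod M := Submod base0 baseD baseZ.

Section Translate.
Variables (g : GL p (i + r)) (N : submod M).
Definition translate_set : set M := [set GL_mx g *m v | v in N].
Lemma translate0 : translate_set 0.
Proof. by exists 0; [exact: submod0 | exact: mulmx0]. Qed.
Lemma translateD x y :
  translate_set x -> translate_set y -> translate_set (x + y).
Proof.
move=> [u Nu <-] [v Nv <-]; exists (u + v); first exact: submodD.
exact: mulmxDr.
Qed.
Lemma translateZ a x : translate_set x -> translate_set (a *: x).
Proof.
move=> [u Nu <-]; exists (a *: u); first exact: submodZ.
by rewrite -scalemxAr.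
Qed.
Definition translate : submod M := Submod translate0 translateD translateZ.
End Translate.

Lemma quo_linear_iso (N : submod M) (f : {linear M -> 'cV[padic_int p]_i}) :
  (forall w, exists v, f v = w) -> (forall v, N v <-> f v = 0) ->
  exists h : {linear quo_mod N -> 'cV[padic_int p]_i}, bijective h.
Proof.
move=> fs fN; pose h0 (x : quo_mod N) := f (quo_repr x).
have h0E v : h0 (quo_pi N v) = f v.
  by apply/eqP; rewrite -subr_eq0 -linearB; apply/eqP/fN; exact: quo_repr_pi.
have lin : linear h0.
  move=> a; elim/quo_ind=> x; elim/quo_ind=> y.
  by rewrite -linearP !h0E linearP.
pose H := GRing.isLinear.Build _ _ _ *:%R h0 lin.
pose h : {linear quo_mod N -> 'cV[padic_int p]_i} := HB.pack h0 H.
exists h; pose s w := projT1 (cid (fs w)).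
have sK w : f (s w) = w by exact: projT2 (cid (fs w)).
exists (fun w => quo_pi N (s w)) => [|w]; last by rewrite /= h0E.
elim/quo_ind=> v; apply/quo_piP/fN.
by rewrite linearB sK /= h0E subrr.
Qed.

Lemma gr_orbit_free (g : GL p (i + r)) :
  exists f : {linear quo_mod (translate g base_mod) -> 'cV[padic_int p]_i}, bijective f.
Proof.
have [g' [gg' g'g]] := GL_mxP g.
pose f0 (v : M) : 'cV[padic_int p]_i := usubmx (g' *m v).
have lin : linear f0 by move=> a u v; rewrite /f0 -linearP /= mulmxDr -scalemxAr.
pose f : {linear M -> 'cV[padic_int p]_i} :=
  HB.pack f0 (GRing.isLinear.Build _ _ _ *:%R f0 lin).
apply: (@quo_linear_iso _ f) => [w|v]; rewrite /= /f0.
  by exists (GL_mx g *m col_mx w 0); rewrite mulmxA g'g mul1mx col_mxKu.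
split=> [[u hu <-]|hv]; first by rewrite mulmxA g'g mul1mx.
by exists (g' *m v) => //; rewrite mulmxA gg' mul1mx.
Qed.

Definition gr_orbit (g : GL p (i + r)) : Gr := MkGr (gr_orbit_free g).

(* the quotient topology of the orbit map, which is onto *)
Definition Gr_open : set (set Gr) := [set U | open (gr_orbit @^-1` U)].
Lemma Gr_openT : Gr_open setT. Proof. exact: openT. Qed.
Lemma Gr_openI : setI_closed Gr_open.
Proof. by move=> U V oU oV; exact: openI. Qed.
Lemma Gr_open_bigU (I : Type) (f : I -> set Gr) :
  (forall i, Gr_open (f i)) -> Gr_open (\bigcup_i f i).
Proof.
by move=> h; rewrite /Gr_open /= preimage_bigcup; apply: bigcup_open => j _; exact: h.
Qed.
HB.instance Definition _ :=
  isOpenTopological.Build Gr Gr_openT Gr_openI Gr_open_bigU.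
HB.instance Definition _ := isPointed.Build Gr (gr_orbit (GL1 p (i + r))).

Definition null_set (R : realType) (mu : probability (Borel (GL p (i + r))) R)
    (Z : set Gr) : Prop :=
  pushforward mu (gr_orbit : Borel (GL p (i + r)) -> Borel Gr) Z = 0%E.

End Grassmannian.

Definition is_top_iso (p d : nat) (G : topAbGroup)
    (e : 'cV[padic_int p]_d -> G) : Prop :=
  exists e' : G -> 'cV[padic_int p]_d,
    [/\ zmod_morphism e, cancel e e', cancel e' e, continuous e & continuous e'].

Section Generic.
Variables (p i r : nat) (k : fieldType) (K : zp_ext p (i + r) k).
Variables (e : 'cV[padic_int p]_(i + r) -> gal_group K) (R : realType).
Variable mu : probability (Borel (GL p (i + r))) R.

(* Gr(i, Gal(K/k)) is identified with Gr(i, Z_p^(i+r)) by e. *)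
Definition generic (P : zp_subext i K -> Prop) : Prop :=
  exists Z : set (Gr p i r),
    [/\ closed Z, null_set mu Z &
        forall L, ~ P L -> exists2 N : Gr p i r, Z N & e @` N = relative_gal L].

End Generic.

(* Main.v *)
(** Let phi : X -> E be the given pseudo-isomorphism, H = Gal(K^(i+1)/K^(i)) with
    topological generator sigma, and gamma = sigma - 1, so that the Iwasawa algebra of
    K^(i) is the quotient of the one, L, of K^(i+1) by gamma. The map X_H -> E/gamma E
    induced by phi has a cokernel killed by J_B = Ann(coker phi) and a kernel killed by
    J_A J_B, where J_A = Ann(ker phi). Hence it suffices that, for generic sigma, every prime Q
    of the dagger algebra whose inverse image in L contains an ideal J of height >= 2 has
    height >= 2.

    The ring L is noetherian, so the inverse image Q0 of Q contains one of finitely many primes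
    P over J. If gamma is not in P, then P < Q0 and a chain of length 3 ending in Q0 can be moved
    by Krull's theorem into one whose last three terms contain gamma: this gives height
    >= 2 modulo gamma. The group elements g with g - 1 in P form a submodule H_P of
    Gal(K^(i+1)/k), a free Z_p-module. If H_P has smaller rank, sigma lies in H_P only when a
    fixed nonzero linear form vanishes on sigma, which defines a closed null set. If H_P has full
    rank, Q contains w - 1 for all w in an open subgroup of Gal(K^(i)/k): for i = 1
    these are units of the dagger algebra, and for i >= 2 two independent ones form a regular
    sequence in Q. *)
Require Import Defs.
From HB Require Import structures.
From mathcomp Require Import all_boot all_order all_algebra fieldext.
From mathcomp Require Import all_classical all_reals all_analysis.
From mathcomp Require Import measurable_realfun.
From mathcomp Require Import ring.

Set Implicit Arguments.
Unset Strict Implicit.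
Unset Printing Implicit Defensive.

Import GRing.Theory.
Local Open Scope classical_set_scope.
Local Open Scope ring_scope.

(** * Ideals, noetherian rings and prime ideals *)

(** For i = 1 the dagger is forced by the primes P with H_P of full rank: Z_p with trivial action is
    pseudo-null over the Iwasawa algebra of a Z_p^2-extension, but its coinvariants under any H are
    Z_p again, whose annihilator has height one over the Iwasawa algebra of K^(1). No choice of
    sigma avoids such a P; only inverting the elements gamma - 1 does. The exceptional forms come
    from finitely many primes attached to the two annihilators, so they are fixed before K^(i) is
    chosen. The Iwasawa algebra is handled through its finite truncations rather than as a power
    series ring. Compactness makes finitely generated ideals closed, which yields noetherianity, and
    regularity of group elements minus 1 is read off from coefficients on cosets. Haar measure
    enters only through invariance: infinitely many translates of one hyperplane condition have the
    same measure, while each matrix satisfies at most d of them. *)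

Section Ideals.
Variable R : comPzRingType.
Implicit Types (I J C N P : set R) (l : seq R).

Record is_ideal I : Prop := IsIdeal {
  id0 : I 0;
  idD : forall x y, I x -> I y -> I (x + y);
  idM : forall a x, I x -> I (a * x) }.

Lemma idN I x : is_ideal I -> I x -> I (- x).
Proof. by move=> iI Ix; rewrite -mulN1r; exact: idM. Qed.

Lemma idB I x y : is_ideal I -> I x -> I y -> I (x - y).
Proof. by move=> iI Ix Iy; apply: idD => //; exact: idN. Qed.

Lemma prime_is_ideal P : prime_ideal P -> is_ideal P.
Proof. by case=> *; split. Qed.

Lemma zero_is_ideal : is_ideal [set 0 : R].
Proof. by split=> [//|x y /= -> ->|a x /= ->]; rewrite ?addr0 ?mulr0. Qed.

Lemma setT_is_ideal : is_ideal [set: R].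
Proof. by []. Qed.

Definition adjoin I t : set R := [set x | exists b, I (x - b * t)].

Lemma adjoin_is_ideal I t : is_ideal I -> is_ideal (adjoin I t).
Proof.
move=> iI; split.
- by exists 0; rewrite mul0r subr0; exact: id0.
- move=> x y [b hb] [c hc]; exists (b + c).
  by rewrite mulrDl opprD addrACA; exact: idD.
- by move=> a x [b hb]; exists (a * b); rewrite -mulrA -mulrBr; exact: idM.
Qed.

Lemma sub_adjoin I t : I `<=` adjoin I t.
Proof. by move=> x Ix; exists 0; rewrite mul0r subr0. Qed.

Lemma mem_adjoin I t : is_ideal I -> adjoin I t t.
Proof. by move=> iI; exists 1; rewrite mul1r subrr; exact: id0. Qed.

Lemma adjoin_sub I J t : is_ideal J -> I `<=` J -> J t -> adjoin I t `<=` J.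
Proof.
move=> iJ IJ Jt x [b /IJ h]; rewrite -(subrK (b * t) x).
by apply: idD => //; exact: idM.
Qed.

(** The ideal N + C t1 + ... + C tn for l = [t1; ...; tn]. Coefficients are restricted to an ideal C
    because Nakayama's lemma needs C = P besides C = setT. *)
Fixpoint lspan C N l : set R :=
  if l is t :: l' then [set x | exists2 b, C b & lspan C N l' (x - b * t)]
  else N.

Definition gen l := lspan setT [set 0] l.

Lemma lspan_is_ideal C N l : is_ideal C -> is_ideal N -> is_ideal (lspan C N l).
Proof.
move=> iC iN; elim: l => [//|t l IH] /=; split.
- by exists 0; [exact: id0 | rewrite mul0r subr0; exact: id0].
- move=> x y [b Cb hb] [c Cc hc]; exists (b + c); first exact: idD.
  by rewrite mulrDl opprD addrACA; exact: idD.
- move=> a x [b Cb hb]; exists (a * b); first exact: idM.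
  by rewrite -mulrA -mulrBr; exact: idM.
Qed.

Lemma gen_is_ideal l : is_ideal (gen l).
Proof. by apply: lspan_is_ideal; [exact: setT_is_ideal|exact: zero_is_ideal]. Qed.

Lemma sub_lspan C N l : is_ideal C -> N `<=` lspan C N l.
Proof.
move=> iC; elim: l => [//|t l IH] x Nx; exists 0; first exact: id0.
by rewrite mul0r subr0; exact: IH.
Qed.

Lemma mem_gen l x : x \in l -> gen l x.
Proof.
elim: l => [//|t l IH]; rewrite inE => /predU1P[->|/IH h] /=.
  by exists 1 => //; rewrite mul1r subrr; exact: (id0 (gen_is_ideal _)).
by exists 0 => //; rewrite mul0r subr0.
Qed.

Lemma lspan_sub C N l I : is_ideal I -> N `<=` I ->
  (forall x, x \in l -> I x) -> lspan C N l `<=` I.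
Proof.
move=> iI NI; elim: l => [//|t l IH] hl x /= [b _ hb].
rewrite -(subrK (b * t) x); apply: idD => //.
  by apply: IH hb => y yl; apply: hl; rewrite inE yl orbT.
by apply: idM => //; apply: hl; rewrite inE eqxx.
Qed.

Lemma gen_sub l I : is_ideal I -> (forall x, x \in l -> I x) -> gen l `<=` I.
Proof. by move=> iI; apply: lspan_sub => // x ->; exact: id0. Qed.

Lemma gen_subset l l' : {subset l <= l'} -> gen l `<=` gen l'.
Proof. by move=> ll'; apply: gen_sub (gen_is_ideal _) _ => x /ll'; exact: mem_gen. Qed.

Definition fg_ideal I := exists l, I = gen l.

Definition noetherian := forall I, is_ideal I -> fg_ideal I.

End Ideals.

Section Noetherian.
Variables (R : comPzRingType).
Implicit Types (I J P Q : set R) (l : seq R).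

Lemma chain_mono (I : nat -> set R) : (forall n, I n `<=` I n.+1) ->
  forall m n, (m <= n)%N -> I m `<=` I n.
Proof.
move=> h m n; elim: n => [|n IH]; first by rewrite leqn0 => /eqP ->.
rewrite leq_eqVlt ltnS => /predU1P[-> //|/IH mn].
by apply: subset_trans mn (h n).
Qed.

Lemma union_is_ideal (I : nat -> set R) : (forall n, is_ideal (I n)) ->
  (forall n, I n `<=` I n.+1) -> is_ideal (\bigcup_n I n).
Proof.
move=> iI h; split; first by exists 0%N => //; exact: id0.
- move=> x y [m _ mx] [n _ ny]; exists (maxn m n) => //.
  apply: idD => //; first by apply: (chain_mono h (leq_maxl m n)).
  by apply: (chain_mono h (leq_maxr m n)).
- by move=> a x [m _ mx]; exists m => //; exact: idM.
Qed.

Lemma acc_of_fg (I : nat -> set R) : (forall n, is_ideal (I n)) ->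
  (forall n, I n `<=` I n.+1) -> fg_ideal (\bigcup_n I n) ->
  exists N, forall n, I n `<=` I N.
Proof.
move=> iI h [l e].
have [N hN] : exists N, forall x, x \in l -> I N x.
  have : forall x, x \in l -> (\bigcup_n I n) x by move=> x xl; rewrite e; exact: mem_gen.
  elim: l {e} => [_|t l IH hl]; first by exists 0%N.
  have [|N hN] := IH; first by move=> x xl; apply: hl; rewrite inE xl orbT.
  have [|m _ mt] := hl t; first by rewrite inE eqxx.
  exists (maxn m N) => x; rewrite inE => /predU1P[->|/hN].
    exact: (chain_mono h (leq_maxl m N)).
  exact: (chain_mono h (leq_maxr m N)).
exists N => n x nx; apply: (gen_sub (iI N) hN); rewrite -e; by exists n.
Qed.

Hypothesis noeR : noetherian R.

Lemma noetherian_max (F : set (set R)) : F !=set0 -> (forall I, F I -> is_ideal I) ->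
  exists2 M, F M & forall I, F I -> M `<=` I -> I `<=` M.
Proof.
move=> [I0 FI0] iF; apply: contrapT => nomax.
have /choice[f hf] : forall I, exists J, F I -> [/\ F J, I `<=` J & ~ J `<=` I].
  move=> I; have [FI|nFI] := pselect (F I); last by exists I.
  apply: contrapT => hn; apply: nomax; exists I => // J FJ IJ.
  by apply: contrapT => JI; apply: hn; exists J.
pose C n := iter n f I0.
have FC n : F (C n) by elim: n => [//|n IH] /=; have [] := hf _ IH.
have CS n : C n `<=` C n.+1 by have [] := hf _ (FC n).
have [|N hN] := acc_of_fg (fun n => iF _ (FC n)) CS.
  by apply: noeR; apply: union_is_ideal => // n; exact: iF.
by have [_ _ []] := hf _ (FC N); exact: (hN N.+1).
Qed.

(** An ideal maximal among those containing I and missing the multiplicative set S is prime; the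
    noetherian condition supplies it in place of Zorn's lemma. *)
Lemma prime_disjoint I (S : set R) : is_ideal I -> S 1 ->
  (forall x y, S x -> S y -> S (x * y)) -> (forall x, I x -> ~ S x) ->
  exists P, [/\ prime_ideal P, I `<=` P & forall x, P x -> ~ S x].
Proof.
move=> iI S1 SM IS.
pose F : set (set R) := [set J | [/\ is_ideal J, I `<=` J & forall x, J x -> ~ S x]].
have [||P [iP IP PS] maxP] := @noetherian_max F; first by exists I; split.
  by move=> J [].
exists P; split=> //; have [P0 PD PM] := iP; split=> //; first by move=> /PS.
move=> x y Pxy; apply: contrapT => /not_orP[nx ny].
have meets z : ~ P z -> exists2 b, S b & adjoin P z b.
  move=> nz; apply: contrapT => hn; apply: nz; apply: (maxP (adjoin P z)).
  - split; [exact: adjoin_is_ideal | | by move=> b hb Sb; apply: hn; exists b].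
    by apply: subset_trans IP _; exact: sub_adjoin.
  - exact: sub_adjoin.
  - exact: mem_adjoin.
have [s Ss [a ha]] := meets x nx; have [s' Ss' [b hb]] := meets y ny.
apply: (PS (s * s')); last exact: SM.
have -> : s * s' = s' * (s - a * x) + (a * x) * (s' - b * y) + (a * b) * (x * y) by ring.
by apply: (PD); [apply: PD|]; apply: PM.
Qed.

(** Noetherian induction: a maximal counterexample M is proper and not prime, so it contains some x
    * y with x, y outside M, and the lists for M + Rx and M + Ry together serve M. *)
Lemma prime_cover J : is_ideal J -> exists n (P : nat -> set R),
  (forall j, (j < n)%N -> prime_ideal (P j) /\ J `<=` P j) /\
  forall Q, prime_ideal Q -> J `<=` Q -> exists2 j, (j < n)%N & P j `<=` Q.
Proof.
pose good J := exists n (P : nat -> set R),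
  (forall j, (j < n)%N -> prime_ideal (P j) /\ J `<=` P j) /\
  forall Q, prime_ideal Q -> J `<=` Q -> exists2 j, (j < n)%N & P j `<=` Q.
rewrite -/(good J) => iJ; apply: contrapT => bJ.
have [||M [iM bM] maxM] := @noetherian_max [set I | is_ideal I /\ ~ good I].
  by exists J; split.
  by move=> I [].
have goodS I : is_ideal I -> M `<=` I -> ~ I `<=` M -> good I.
  by move=> iI MI nI; apply: contrapT => bI; apply: nI; apply: maxM.
have M1 : ~ M 1.
  move=> M1; apply: bM; exists 0%N, (fun=> setT); split=> // Q pQ MQ.
  by case: (pri1 pQ); exact: MQ.
have npM : ~ prime_ideal M.
  move=> pM; apply: bM; exists 1%N, (fun=> M); split=> [j _|Q pQ MQ].
    by split.
  by exists 0%N.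
have [x [y [Mxy nx ny]]] : exists x y, [/\ M (x * y), ~ M x & ~ M y].
  apply: contrapT => hn; apply: npM; have [M0 MD MM] := iM; split=> // x y Mxy.
  by apply: contrapT => /not_orP[nx ny]; apply: hn; exists x, y.
have gz z : ~ M z -> good (adjoin M z).
  move=> nz; apply: goodS; [exact: adjoin_is_ideal|exact: sub_adjoin|].
  by move=> h; apply: nz; apply: h; exact: mem_adjoin.
have [m [P [hP cP]]] := gz x nx; have [n [P' [hP' cP']]] := gz y ny.
apply: bM; exists (m + n)%N, (fun j => if (j < m)%N then P j else P' (j - m)%N).
split=> [j jmn|Q pQ MQ].
  case: ltnP => jm.
    have [p1 p2] := hP j jm; split=> //; apply: subset_trans p2; exact: sub_adjoin.
  have [|p1 p2] := hP' (j - m)%N; first by rewrite ltn_subLR.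
  by split=> //; apply: subset_trans p2; exact: sub_adjoin.
have [Qx|Qy] := pri_prime pQ (MQ _ Mxy).
  have [|j jm PQ] := cP Q pQ; first exact: adjoin_sub (prime_is_ideal pQ) MQ Qx.
  by exists j; rewrite ?jm // ltn_addr.
have [|j jm PQ] := cP' Q pQ; first exact: adjoin_sub (prime_is_ideal pQ) MQ Qy.
by exists (m + j)%N; rewrite ?ltn_add2l // ltnNge leq_addr /= addKn.
Qed.

(** As y is regular modulo I, no s * y^n with s outside Q lies in I. A prime over I missing all
    these products lies in Q and avoids y. *)
Lemma prime_below_regular Q I y : prime_ideal Q -> is_ideal I -> I `<=` Q ->
  (forall b, I (b * y) -> I b) ->
  exists P, [/\ prime_ideal P, I `<=` P, P `<=` Q & ~ P y].
Proof.
move=> pQ iI IQ reg.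
pose S : set R := [set x | exists s n, ~ Q s /\ x = s * y ^+ n].
have [||x Ix [s [n [nQ e]]]|P [pP IP PS]] := @prime_disjoint I S iI.
- by exists 1, 0%N; split; [exact: pri1 pQ | rewrite expr0 mulr1].
- move=> a b [s [m [ns ->]]] [s' [n [ns' ->]]]; exists (s * s'), (m + n)%N; split.
    by move=> /(pri_prime pQ)[].
  by rewrite exprD; ring.
- apply: nQ; apply: IQ; move: Ix; rewrite e; elim: n {e} => [|n IH].
    by rewrite expr0 mulr1.
  by rewrite exprSr mulrA => /reg.
exists P; split=> // [x Px|Py].
  by apply: contrapT => nx; apply: (PS x) => //; exists x, 0%N; rewrite expr0 mulr1.
by apply: (PS y) => //; exists 1, 1%N; split; [exact: pri1 pQ| rewrite expr1 mul1r].
Qed.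

(** Each term of the regular sequence gives one strict step: [prime_below_regular] modulo (x) for y,
    then modulo 0 for x. *)
Lemma height2_regular Q x y : prime_ideal Q -> Q x -> Q y ->
  (forall b, b * x = 0 -> b = 0) ->
  (forall b, (exists c, b * y = c * x) -> exists c, b = c * x) ->
  prime_height_ge 2 Q.
Proof.
move=> pQ Qx Qy rx ry.
have iQ := prime_is_ideal pQ.
have [|||P [pP xP PQ nPy]] := @prime_below_regular Q (adjoin [set 0] x) y pQ.
- exact: adjoin_is_ideal (@zero_is_ideal _).
- by apply: adjoin_sub => // z ->; exact: id0.
- move=> b [c /eqP]; rewrite subr_eq0 => /eqP e; have [|c' ->] := ry b; first by exists c.
  by exists c'; rewrite subrr.
have Px : P x by apply: xP; apply: mem_adjoin; exact: zero_is_ideal.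
have [||P0 [pP0 _ P0P nP0x]] := @prime_below_regular P [set 0] x pP (@zero_is_ideal _).
- by move=> z ->; exact: pri0.
- by move=> b; exact: rx.
exists (fun j => if j is j'.+1 then if j' is 0%N then P else Q else P0); split.
- by case=> [|[|j]].
- case=> [|[|j]] // _; split=> // h; first by apply: nP0x; exact: h.
  by apply: nPy; exact: h.
- by [].
Qed.

End Noetherian.

(** * Krull's principal ideal theorem *)

Section KrullPrincipalIdeal.
Variable R : comPzRingType.
Implicit Types (I J K P Q : set R) (l : seq R).

(** Ideals of the local ring R_P are represented by the P-saturated ideals of R, so R_P is never
    built; [saturation P I] is the contraction of I R_P. *)
Definition saturated P I := forall s x, ~ P s -> I (s * x) -> I x.

Definition saturation P I : set R := [set x | exists2 s, ~ P s & I (s * x)].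

Lemma sub_saturation P I : prime_ideal P -> I `<=` saturation P I.
Proof. by move=> pP x Ix; exists 1; [exact: pri1 pP | rewrite mul1r]. Qed.

Lemma prime_notM P s t : prime_ideal P -> ~ P s -> ~ P t -> ~ P (s * t).
Proof. by move=> pP ns nt /(pri_prime pP)[]. Qed.

Lemma saturation_is_ideal P I : prime_ideal P -> is_ideal I ->
  is_ideal (saturation P I).
Proof.
move=> pP iI; split.
- by apply: sub_saturation => //; exact: id0.
- move=> x y [s ns hs] [t nt ht]; exists (s * t); first exact: prime_notM.
  have -> : s * t * (x + y) = t * (s * x) + s * (t * y) by ring.
  by apply: idD => //; exact: idM.
- by move=> a x [s ns hs]; exists s => //; rewrite mulrCA; exact: idM.
Qed.

Lemma saturation_saturated P I : prime_ideal P -> saturated P (saturation P I).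
Proof.
move=> pP s x ns [t nt h]; exists (t * s); first exact: prime_notM.
by rewrite -mulrA.
Qed.

Lemma saturationS P I J : I `<=` J -> saturation P I `<=` saturation P J.
Proof. by move=> IJ x [s ns /IJ h]; exists s. Qed.

Lemma prime_saturated P Q : prime_ideal P -> P `<=` Q -> saturated Q P.
Proof. by move=> pP PQ s x ns /(pri_prime pP)[/PQ|]. Qed.

Lemma adjoinS I J t : I `<=` J -> adjoin I t `<=` adjoin J t.
Proof. by move=> IJ x [b /IJ h]; exists b. Qed.

Hypothesis noeR : noetherian R.

(* The localization of R/J at a prime P minimal over J has finite length: the
   largest K such that the chain stabilizes inside K is the whole ring, because
   one can always add to K an element x with (K : x) = P. *)
Lemma dcc_minimal_prime P J (c : nat -> set R) : prime_ideal P ->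
  is_ideal J -> saturated P J ->
  (forall P', prime_ideal P' -> J `<=` P' -> P' `<=` P -> P `<=` P') ->
  (forall n, is_ideal (c n)) -> (forall n, saturated P (c n)) ->
  (forall n, J `<=` c n) -> (forall n, c n.+1 `<=` c n) ->
  exists n, c n `<=` c n.+1.
Proof.
move=> pP iJ sJ minP ic sc Jc cS.
have cmono m n : (m <= n)%N -> c n `<=` c m.
  elim: n => [|n IH]; first by rewrite leqn0 => /eqP ->.
  by rewrite leq_eqVlt ltnS => /predU1P[-> //|/IH]; exact: subset_trans.
(* [art K]: from some index on, the chain is constant inside K. *)
pose art K := exists n0, forall n x, (n0 <= n)%N -> c n x -> K x -> c n.+1 x.
pose F := [set K | [/\ is_ideal K, saturated P K, J `<=` K & art K]].
have [||K [iK sK JK [n0 aK]] maxK] := @noetherian_max R noeR F.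
- exists J; split=> //; exists 0%N => n x _ _; exact: Jc.
- by move=> K [].
have [K1|nK1] := pselect (K 1).
  exists n0 => x cx; apply: aK => //.
  by rewrite -[x]mulr1; exact: idM.
(* A maximal colon ideal (K : x), x outside K, is prime; saturation of K puts it inside P, and
   minimality of P makes it equal to P. *)
have [||A [x [nKx eA]] maxA] := @noetherian_max R noeR
    [set A | exists x, ~ K x /\ A = [set a | K (a * x)]].
- by exists [set a | K (a * 1)], 1.
- move=> A [x [_ ->]]; split=> /=; first by rewrite mul0r; exact: id0.
    by move=> a b ha hb; rewrite mulrDl; exact: idD.
  by move=> a b hb; rewrite -mulrA; exact: idM.
have pA : prime_ideal A.
  rewrite eA; split=> /=.
  - by rewrite mul0r; exact: id0.
  - by move=> a b ha hb; rewrite mulrDl; exact: idD.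
  - by move=> a b hb; rewrite -mulrA; exact: idM.
  - by rewrite mul1r.
  - move=> a b hab; have [|na] := pselect (K (a * x)); [by left|right].
    have h : [set r | K (r * (a * x))] `<=` A.
      apply: maxA; first by exists (a * x).
      by rewrite eA => r /= hr; rewrite mulrCA; exact: idM.
    by move: (h b); rewrite eA /=; apply; rewrite mulrA (mulrC b).
have AP : A = P.
  apply/seteqP; split; last first.
    apply: minP => //; last first.
      rewrite eA => y /= Ky; apply: contrapT => nPy; apply: nKx; exact: sK Ky.
    by rewrite eA => y /JK Ky /=; rewrite mulrC; exact: idM.
  by rewrite eA => y /= Ky; apply: contrapT => nPy; apply: nKx; exact: sK Ky.
have PK a : P a -> K (a * x) by rewrite -AP eA.
pose K' := saturation P (adjoin K x).
have KK' : K `<=` K'.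
  by apply: subset_trans (sub_saturation (I := adjoin K x) pP); exact: sub_adjoin.
have K'x : K' x by apply: sub_saturation => //; exact: mem_adjoin.
have iK' : is_ideal K' by apply: saturation_is_ideal => //; exact: adjoin_is_ideal.
suff : art K'.
  move=> aK'; exfalso; apply: nKx; apply: (maxK K') => //; split=> //.
    exact: saturation_saturated.
  exact: subset_trans JK KK'.
(* Over R_P the quotient K'/K has length one. Either some term meets K' only inside K, or each later
   term contains a w in K' outside K; then a' is a unit at P, and a multiple of w corrects y into
   K. *)
have [[n1 [n01 h1]]|h1] := pselect (exists n, (n0 <= n)%N /\ forall y, c n y -> K' y -> K y).
  exists n1 => n y n1n cy K'y; apply: aK => //; first exact: leq_trans n1n.
  by apply: h1 => //; exact: cmono cy.
exists n0 => n y n0n cy [s ns [a ha]].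
have [w [cw [s' ns' [a' ha']] nKw]] : exists w, [/\ c n.+1 w, K' w & ~ K w].
  apply: contrapT => hn; apply: h1; exists n.+1; split; first exact: leqW.
  by move=> w cw K'w; apply: contrapT => nKw; apply: hn; exists w.
have nPa' : ~ P a'.
  move=> /PK Ka'; apply: nKw; apply: (sK s') => //.
  by rewrite -(subrK (a' * x) (s' * w)); exact: idD.
apply: (sc n.+1 (a' * s)); first exact: prime_notM.
have e : a' * s * y = (a' * (s * y - a * x) - a * (s' * w - a' * x)) + (a * s') * w by ring.
rewrite e; apply: (idD (ic _)); last by apply: (idM (ic _)).
apply: aK => //; last by apply: idB => //; exact: idM.
have -> : a' * (s * y - a * x) - a * (s' * w - a' * x) = (a' * s) * y - (a * s') * w by ring.
by apply: (idB (ic _)); apply: (idM (ic _)) => //; exact: cS.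
Qed.

Lemma lspan_nakayama P N l : prime_ideal P -> is_ideal N -> saturated P N ->
  (forall v, v \in l -> exists2 s, ~ P s & lspan P N l (s * v)) ->
  forall v, v \in l -> N v.
Proof.
move=> pP iN sN; have iP := prime_is_ideal pP.
elim: l => [//|t l IH] hl.
have [|s ns [b Pb hb]] := hl t; first by rewrite inE eqxx.
have nu : ~ P (s - b).
  by move=> h; apply: ns; rewrite -(subrK b s); exact: idD.
have iS : is_ideal (lspan P N l) by exact: lspan_is_ideal.
have hl' v : v \in l -> exists2 s, ~ P s & lspan P N l (s * v).
  move=> vl; have [|s' ns' [b' Pb' hb']] := hl v; first by rewrite inE vl orbT.
  exists ((s - b) * s'); first exact: prime_notM.
  have -> : (s - b) * s' * v = (s - b) * (s' * v - b' * t) + b' * (s * t - b * t) by ring.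
  by apply: idD => //; exact: idM.
have lN := IH hl'.
move=> v; rewrite inE => /predU1P[->|/lN//].
apply: (sN (s - b)) => //; rewrite mulrBl.
by apply: lspan_sub hb => //; exact: subset_refl.
Qed.

Lemma lspan_scale (C N : set R) l a b : is_ideal C -> N 0 -> C a -> gen l b ->
  lspan C N l (a * b).
Proof.
move=> iC N0 Ca; elim: l b => [|t l IH] b /=; first by move=> ->; rewrite mulr0.
move=> [d _ hd]; exists (d * a); first exact: idM.
by rewrite (_ : _ - _ = a * (b - d * t)); [exact: IH | ring].
Qed.

(** The power I^n. I^(n+1) is the intersection of the ideals containing the products, so a
    membership is used by choosing K. *)
Fixpoint idpow I n : set R :=
  if n is n'.+1 then
    [set x | forall K, is_ideal K -> (forall a b, I a -> idpow I n' b -> K (a * b)) -> K x]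
  else setT.

Lemma idpow_is_ideal I n : is_ideal (idpow I n).
Proof.
elim: n => [|n IH] /=; first exact: setT_is_ideal.
split=> [K iK _|x y hx hy K iK h|a x hx K iK h]; first exact: id0.
  by apply: idD => //; [exact: hx | exact: hy].
by apply: idM => //; exact: hx.
Qed.

Lemma idpow_exp I n a : I a -> idpow I n (a ^+ n).
Proof.
by move=> Ia; elim: n => [//|n IH] K iK h; rewrite exprS; exact: h.
Qed.

Lemma idpowS I n : is_ideal I -> idpow I n.+1 `<=` idpow I n.
Proof.
move=> iI x hx; apply: hx; first exact: idpow_is_ideal.
by move=> a b _ hb; apply: idM => //; exact: idpow_is_ideal.
Qed.

Definition idsum I J : set R := [set x | exists2 y, I y & J (x - y)].

Lemma idsum_is_ideal I J : is_ideal I -> is_ideal J -> is_ideal (idsum I J).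
Proof.
move=> iI iJ; split.
- by exists 0; [exact: id0 | rewrite subr0; exact: id0].
- move=> x y [u Iu hu] [v Iv hv]; exists (u + v); first exact: idD.
  by rewrite opprD addrACA; exact: idD.
- move=> a x [u Iu hu]; exists (a * u); first exact: idM.
  by rewrite -mulrBr; exact: idM.
Qed.

(* Krull's principal ideal theorem, in the form in which it moves an element
   of the top of a chain of primes down to its middle term. *)
Lemma krull_chain P0 P1 P2 a : prime_ideal P0 -> prime_ideal P1 -> prime_ideal P2 ->
  P0 `<` P1 -> P1 `<` P2 -> P2 a ->
  exists P, [/\ prime_ideal P, P0 `<` P, P `<` P2 & P a].
Proof.
move=> p0 p1 p2 [P01 nP10] [P12 nP21] P2a; have [P0a|nP0a] := pselect (P0 a).
  by exists P1; split=> //; exact: P01.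
apply: contrapT => nex.
have i0 := prime_is_ideal p0; have i1 := prime_is_ideal p1.
have minP P : prime_ideal P -> P0 `<=` P -> P a -> P `<=` P2 -> P2 `<=` P.
  move=> pP P0P Pa PP2; apply: contrapT => nP; apply: nex; exists P; split=> //.
  by split=> // h; apply: nP0a; exact: h.
have nP1a : ~ P1 a by move=> P1a; apply: nP21; exact: minP.
(* The n-th symbolic power of P1 modulo P0. *)
pose S n := saturation P1 (idsum (idpow P1 n) P0).
have iS n : is_ideal (S n).
  by apply: saturation_is_ideal => //; apply: idsum_is_ideal => //; exact: idpow_is_ideal.
have sS n : saturated P1 (S n) by exact: saturation_saturated.
have SS n : S n.+1 `<=` S n.
  by apply: saturationS => x [y hy h]; exists y => //; exact: idpowS.
have P0S n : P0 `<=` S n.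
  apply: subset_trans (sub_saturation (I := idsum (idpow P1 n) P0) p1).
  by move=> x hx; exists 0; [exact: id0 (idpow_is_ideal _ _) | rewrite subr0].
have powS n : idpow P1 n `<=` S n.
  apply: subset_trans (sub_saturation (I := idsum (idpow P1 n) P0) p1).
  by move=> x hx; exists x => //; rewrite subrr; exact: id0.
(* P2 is minimal over P0 + (a), so two consecutive ideals S n + (a) agree locally at P2. *)
have [||||||||n hn] := @dcc_minimal_prime P2 (saturation P2 (adjoin P0 a))
    (fun n => saturation P2 (adjoin (S n) a)).
- exact: p2.
- by apply: saturation_is_ideal => //; exact: adjoin_is_ideal.
- exact: saturation_saturated.
- move=> P pP JP PP2.
  have aP : adjoin P0 a `<=` P.
    by apply: subset_trans JP; exact: sub_saturation.
  apply: minP => //; last by apply: aP; exact: mem_adjoin.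
  by apply: subset_trans aP; exact: sub_adjoin.
- by move=> n; apply: saturation_is_ideal => //; exact: adjoin_is_ideal.
- by move=> n; exact: saturation_saturated.
- by move=> n; apply: saturationS; apply: adjoinS; exact: P0S.
- by move=> n; apply: saturationS; apply: adjoinS; exact: SS.
(* Up to a factor outside P2, v in S n is b * a modulo S n.+1. As a is outside P1, b lies in S n,
   and Nakayama at P2 removes the term b * a. *)
have SnS : S n `<=` S n.+1.
  have [l el] := noeR (iS n).
  suff h : forall v, v \in l -> S n.+1 v by rewrite el; exact: gen_sub.
  apply: (@lspan_nakayama P2) => //.
    by move=> s x ns; apply: sS => h; apply: ns; exact: P12.
  move=> v vl; have Sv : S n v by rewrite el; exact: mem_gen.
  have [s ns [b hb]] : saturation P2 (adjoin (S n.+1) a) v.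
    by apply: hn; apply: sub_saturation => //; exact: sub_adjoin.
  exists s => //; have i2 := prime_is_ideal p2.
  rewrite -(subrK (b * a) (s * v)); apply: (idD (lspan_is_ideal _ i2 (iS _))).
    exact: sub_lspan.
  rewrite mulrC; apply: lspan_scale => //; first exact: id0.
  rewrite -el; apply: (sS n a) => //.
  have -> : a * b = s * v - (s * v - b * a) by ring.
  by apply: (idB (iS n)); [exact: idM | exact: SS].
(* Locally at P1, P1^n now lies in P1^(n+1) + P0; Nakayama puts P1^n inside P0, against P0 < P1. *)
have powP0 : idpow P1 n `<=` P0.
  have [l el] := noeR (idpow_is_ideal P1 n).
  suff h : forall v, v \in l -> P0 v by rewrite el; exact: gen_sub.
  apply: (@lspan_nakayama P1) => //; first exact: prime_saturated.
  move=> v vl; have [s ns [y hy h]] : S n.+1 v.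
    by apply: SnS; apply: powS; rewrite el; exact: mem_gen.
  have iL := lspan_is_ideal l i1 i0.
  exists s => //; rewrite -(subrK y (s * v)); apply: (idD iL).
    exact: sub_lspan.
  apply: hy => // c b P1c hb; apply: lspan_scale => //; first exact: id0.
  by rewrite -el.
apply: nP10 => x P1x.
have : P0 (x ^+ n) by apply: powP0; exact: idpow_exp.
elim: n {hn SnS powP0} => [|n IH]; first by rewrite expr0 => /(pri1 p0).
by rewrite exprS => /(pri_prime p0)[].
Qed.

Lemma krull_height Q J a : prime_ideal Q -> Q a -> height_ge 2 J ->
  forall P, prime_ideal P -> J `<=` P -> P `<=` Q -> ~ P a ->
  exists P0 P1, [/\ prime_ideal P0, prime_ideal P1, P0 a & P0 `<` P1 /\ P1 `<` Q].
Proof.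
move=> pQ Qa hJ P pP JP PQ nPa.
have [c [pc cS c2]] := hJ P pP JP.
have PQ' : c 2%N `<` Q.
  by rewrite c2; split=> // h; apply: nPa; exact: h.
(* The element a descends one place at each use: from Q into P1, then from P1 into P0. *)
have [P1 [p1 l1 l1' P1a]] := krull_chain (pc 1%N isT) (pc 2%N isT) pQ (cS 1%N isT) PQ' Qa.
have [P0 [p0 _ l0' P0a]] := krull_chain (pc 0%N isT) (pc 1%N isT) p1 (cS 0%N isT) l1 P1a.
by exists P0, P1.
Qed.

End KrullPrincipalIdeal.

(** * Finitely generated modules and localization *)

Section FinitelyGeneratedModules.
Variables (R : comPzRingType) (M : lmodType R).
Implicit Types (N : submod M) (l : seq M).

Fixpoint mspan l : set M :=
  if l is v :: l' then [set x | exists a : R, mspan l' (x - a *: v)] else [set 0].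

Lemma mspan0 l : mspan l 0.
Proof. by elim: l => [//|v l IH]; exists 0; rewrite scale0r subr0. Qed.

Lemma mspanD l x y : mspan l x -> mspan l y -> mspan l (x + y).
Proof.
elim: l x y => [|v l IH] x y /=; first by move=> -> ->; rewrite addr0.
move=> [a ha] [b hb]; exists (a + b).
by rewrite scalerDl opprD addrACA; exact: IH.
Qed.

Lemma mspanZ l a x : mspan l x -> mspan l (a *: x).
Proof.
elim: l x => [|v l IH] x /=; first by move=> ->; rewrite scaler0.
by move=> [b hb]; exists (a * b); rewrite -scalerA -scalerBr; exact: IH.
Qed.

Lemma mspan_sum l x : mspan l x ->
  exists c : 'I_(size l) -> R, x = \sum_(j < size l) c j *: l`_j.
Proof.
elim: l x => [|v l IH] x /=; first by move=> ->; exists (fun=> 0); rewrite big_ord0.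
move=> [a /IH[c e]]; exists (fun j => if unlift ord0 j is Some j' then c j' else a).
rewrite big_ord_recl unlift_none /= -(subrK (a *: v) x) addrC e; congr (_ + _).
by apply: eq_bigr => j _; rewrite liftK.
Qed.

Lemma sum_mspan n (v : 'I_n -> M) (c : 'I_n -> R) :
  mspan (codom v) (\sum_(j < n) c j *: v j).
Proof.
have h x : x \in codom v -> mspan (codom v) x.
  elim: (codom v) => [//|w l IH]; rewrite inE => /predU1P[->|/IH h] /=.
    by exists 1; rewrite scale1r subrr; exact: mspan0.
  by exists 0; rewrite scale0r subr0.
elim/big_ind: _ => [||j _]; [exact: mspan0|exact: mspanD|apply: mspanZ].
by apply: h; exact: codom_f.
Qed.

Hypothesis noeR : noetherian R.

(** The coefficients of v on N form an ideal A. Lifts of generators of A, with generators of the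
    intersection of N and [mspan l], generate N. *)
Lemma mspan_submod l N : (forall x, N x -> mspan l x) ->
  exists l', (forall x, x \in l' -> N x) /\ forall x, N x -> mspan l' x.
Proof.
elim: l N => [|v l IH] N hN; first by exists [::].
pose A : set R := [set a | exists x, N x /\ mspan l (x - a *: v)].
have iA : is_ideal A.
  split; first by exists 0; rewrite scale0r subr0; split; [exact: submod0|exact: mspan0].
  - move=> a b [x [Nx hx]] [y [Ny hy]]; exists (x + y); split; first exact: submodD.
    by rewrite scalerDl opprD addrACA; exact: mspanD.
  - move=> a b [x [Nx hx]]; exists (a *: x); split; first exact: submodZ.
    by rewrite -scalerA -scalerBr; exact: mspanZ.
have [s es] := noeR iA.
have n0 : N 0 /\ mspan l 0 by split; [exact: submod0|exact: mspan0].
have nD x y : N x /\ mspan l x -> N y /\ mspan l y -> N (x + y) /\ mspan l (x + y).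
  by move=> [? ?] [? ?]; split; [exact: submodD|exact: mspanD].
have nZ a x : N x /\ mspan l x -> N (a *: x) /\ mspan l (a *: x).
  by move=> [? ?]; split; [exact: submodZ|exact: mspanZ].
pose N' : submod M := @Submod _ _ [set x | N x /\ mspan l x] n0 nD nZ.
have [|l' [hl' cl']] := IH N'; first by move=> x [].
have /choice[w hw] : forall a, exists x, A a -> N x /\ mspan l (x - a *: v).
  move=> a; have [[x hx]|na] := pselect (A a); first by exists x.
  by exists 0.
exists (map w s ++ l'); split.
  move=> x; rewrite mem_cat => /orP[/mapP[a sa ->]|/hl'[]//].
  by have [] : N (w a) /\ mspan l (w a - a *: v) by apply: hw; rewrite es; exact: mem_gen.
have hs a : a \in s -> A a by rewrite es; exact: mem_gen.
suff h a x : gen s a -> N x -> mspan l (x - a *: v) -> mspan (map w s ++ l') x.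
  move=> x Nx; have [a ha] := hN x Nx.
  by apply: (h a) => //; rewrite -es; exists x.
elim: s hs a x {es} => [|b s IHs] hs a x /=.
  by move=> -> Nx hx; apply: cl'; split=> //; move: hx; rewrite scale0r subr0.
move=> [c _ hc] Nx hx; exists c.
have [Nw hwb] : N (w b) /\ mspan l (w b - b *: v) by apply: hw; apply: hs; rewrite inE eqxx.
apply: (IHs _ (a - c * b)) => //.
- by move=> d ds; apply: hs; rewrite inE ds orbT.
- by apply: submodB => //; exact: submodZ.
have -> : x - c *: w b - (a - c * b) *: v = (x - a *: v) + (- c) *: (w b - b *: v).
  rewrite scalerBl -scalerA scalerBr !scaleNr opprK opprB addrA [LHS]addrAC [RHS]addrA.
  by rewrite -!addrA; congr (_ + _); rewrite addrC -!addrA; congr (_ + _); rewrite addrC.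
by apply: mspanD => //; exact: mspanZ.
Qed.

Lemma fg_sub_mod N : finitely_generated M -> finitely_generated (sub_mod N).
Proof.
move=> [n [v hv]]; have [|l [hl cl]] := @mspan_submod (codom v) N.
  by move=> x _; have [c ->] := hv x; exact: sum_mspan.
have hN (j : 'I_(size l)) : N l`_j by apply: hl; exact: mem_nth.
exists (size l), (fun j => SubMod (hN j)) => x.
have [c e] := mspan_sum (cl _ (sub_valP x)); exists c; apply: sub_val_inj.
rewrite e; elim/big_ind2: _ => [//|u a w b -> -> //|j _]; exact: erefl.
Qed.

End FinitelyGeneratedModules.

(** * Chains of primes under surjections *)

Section Transfer.
Variables (R R' : comPzRingType) (f : {rmorphism R -> R'}).
Hypothesis f_surj : forall y, exists x, f x = y.

Lemma preimage_is_ideal (I : set R') : is_ideal I -> is_ideal (f @^-1` I).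
Proof.
move=> iI; split=> /=; first by rewrite rmorph0; exact: id0.
- by move=> x y hx hy; rewrite rmorphD; exact: idD.
- by move=> a x hx; rewrite rmorphM; exact: idM.
Qed.

Lemma preimage_prime (Q : set R') : prime_ideal Q -> prime_ideal (f @^-1` Q).
Proof.
move=> pQ; have [h0 hD hM] := preimage_is_ideal (prime_is_ideal pQ); split=> //.
  by rewrite /= rmorph1; exact: pri1 pQ.
by move=> x y /=; rewrite rmorphM => /(pri_prime pQ).
Qed.

(** A prime above P0 contains the kernel, hence is the full inverse image of its image; so images
    stay prime and inclusions stay strict. *)
Lemma height2_surj (Q : set R') (P0 P1 : set R) : prime_ideal Q ->
  prime_ideal P0 -> prime_ideal P1 -> (forall x, f x = 0 -> P0 x) ->
  P0 `<` P1 -> P1 `<` f @^-1` Q -> prime_height_ge 2 Q.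
Proof.
move=> pQ p0 p1 kP [P01 nP10] [P1Q nQP1].
have mem (P : set R) x : prime_ideal P -> P0 `<=` P -> (f @` P) (f x) -> P x.
  move=> pP P0P [y Py /eqP]; rewrite -subr_eq0 -rmorphB => /eqP/kP/P0P h.
  by rewrite -(subKr y x); apply: idB => //; exact: prime_is_ideal.
have pim (P : set R) : prime_ideal P -> P0 `<=` P -> prime_ideal (f @` P).
  move=> pP P0P; split.
  - by exists 0; [exact: pri0 | rewrite rmorph0].
  - by move=> _ _ [x Px <-] [y Py <-]; exists (x + y); [exact: priD|rewrite rmorphD].
  - move=> a _ [x Px <-]; have [b <-] := f_surj a.
    by exists (b * x); [exact: priM|rewrite rmorphM].
  - by rewrite -(rmorph1 f) => /(mem _ _ pP P0P); exact: pri1 pP.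
  - move=> x y; have [a <-] := f_surj x; have [b <-] := f_surj y.
    rewrite -rmorphM => /(mem _ _ pP P0P)/(pri_prime pP)[] h; [left|right].
      by exists a.
    by exists b.
exists (fun j => if j is j'.+1 then if j' is 0%N then f @` P1 else Q else f @` P0); split.
- by case=> [|[|j]] // _; apply: pim.
- case=> [|[|j]] // _; split.
  + by move=> _ [x Px <-]; exists x => //; exact: P01.
  + by move=> h; apply: nP10 => x Px; apply: mem => //; apply: h; exists x.
  + by move=> _ [x /P1Q Px <-].
  + move=> h; apply: nQP1 => x Qx; apply: mem => //; exact: h.
- by [].
Qed.

End Transfer.

(** * Chains of primes under localization *)

Section Localizations.
Variables (R : comPzRingType) (A : algebra_over R) (S : set R).

(** Characterizes A as S^-1 R, so that the identity algebra, with S = {1}, and the algebra of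
    fractions are treated alike. *)
Record is_localization : Prop := IsLocalization {
  isloc1 : S 1;
  islocM : forall x y, S x -> S y -> S (x * y);
  isloc_unit : forall s, S s -> exists z, alg_map A s * z = 1;
  isloc_frac : forall z, exists s, S s /\ exists u, alg_map A s * z = alg_map A u;
  isloc_eq : forall u, alg_map A u = 0 -> exists2 s, S s & s * u = 0 }.

Hypothesis locA : is_localization.
Local Notation io := (alg_map A).

Lemma isloc_prime Q s : prime_ideal Q -> S s -> ~ Q (io s).
Proof.
move=> pQ /(isloc_unit locA)[t et] Qs; apply: (pri1 pQ).
by rewrite -et mulrC; exact: priM.
Qed.

Lemma noetherian_loc : noetherian R -> noetherian A.
Proof.
move=> noeR I iI; have [l el] := noeR _ (preimage_is_ideal (alg_map A) iI).
exists (map io l); apply/seteqP; split=> [z Iz|]; last first.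
  apply: gen_sub => // y /mapP[x xl ->].
  by have : (io @^-1` I) x by rewrite el; exact: mem_gen.
have [s [Ss [u eu]]] := isloc_frac locA z; have [t et] := isloc_unit locA Ss.
have -> : z = t * io u by rewrite -eu mulrA [t * _]mulrC et mul1r.
apply: (idM (gen_is_ideal _)).
have : gen l u by rewrite -el /= -eu; exact: idM.
elim: l u {el eu} => [|v l IH] u /=; first by move=> ->; rewrite rmorph0.
by move=> [b _ /IH]; exists (io b) => //; rewrite -rmorphM -rmorphB.
Qed.

Definition extension (P : set R) : set A :=
  [set z | exists s, S s /\ exists2 u, P u & io s * z = io u].

Lemma extensionE P : prime_ideal P -> (forall s, S s -> ~ P s) ->
  forall u, extension P (io u) -> P u.
Proof.
move=> pP PS u [s [Ss [v Pv /eqP]]]; rewrite -rmorphM -subr_eq0 -rmorphB.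
move=> /eqP/(isloc_eq locA)[t St e].
have : P (t * s * u).
  have -> : t * s * u = t * (s * u - v) + t * v by ring.
  by rewrite e add0r; exact: priM.
by move=> /(pri_prime pP)[/(PS _ (islocM locA St Ss))|].
Qed.

Lemma extension_prime P : prime_ideal P -> (forall s, S s -> ~ P s) ->
  prime_ideal (extension P).
Proof.
move=> pP PS; split.
- exists 1; split; first exact: isloc1.
  by exists 0; [exact: pri0 | rewrite mulr0 rmorph0].
- move=> x y [s [Ss [u Pu eu]]] [t [St [v Pv ev]]].
  exists (s * t); split; first exact: islocM.
  exists (t * u + s * v); first by apply: (priD pP); exact: priM.
  by rewrite rmorphD !rmorphM -eu -ev; ring.
- move=> a x [s [Ss [u Pu eu]]]; have [t [St [v ev]]] := isloc_frac locA a.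
  exists (t * s); split; first exact: islocM.
  by exists (v * u); [exact: priM | rewrite !rmorphM -eu -ev; ring].
- rewrite -(rmorph1 io) => /(extensionE pP PS); exact: pri1 pP.
- move=> x y [s [Ss [u Pu eu]]].
  have [t [St [v ev]]] := isloc_frac locA x; have [t' [St' [v' ev']]] := isloc_frac locA y.
  have /(extensionE pP PS) : extension P (io (s * v * v')).
    exists 1; split; first exact: isloc1.
    exists (t * t' * u); first exact: priM.
    by rewrite rmorph1 mul1r !rmorphM -eu -ev -ev'; ring.
  move=> /(pri_prime pP)[/(pri_prime pP)[/(PS _ Ss)//|Pv]|Pv']; [left|right].
    by exists t; split=> //; exists v.
  by exists t'; split=> //; exists v'.
Qed.

(** Q contains no image of S, so every prime below its inverse image misses S and extends to A
    without collapsing. *)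
Lemma height2_loc Q : prime_ideal Q -> prime_height_ge 2 (io @^-1` Q) ->
  prime_height_ge 2 Q.
Proof.
move=> pQ [c [pc cS c2]].
have c1Q : c 1%N `<=` io @^-1` Q by rewrite -c2; exact: (proj1 (cS 1%N isT)).
have c0Q : c 0%N `<=` io @^-1` Q.
  by apply: subset_trans c1Q; exact: (proj1 (cS 0%N isT)).
have dis (P : set R) : P `<=` io @^-1` Q -> forall s, S s -> ~ P s.
  by move=> PQ s Ss /PQ; exact: isloc_prime.
exists (fun j => if j is j'.+1 then if j' is 0%N then extension (c 1%N) else Q
                 else extension (c 0%N)); split.
- case=> [|[|j]] // _; apply: extension_prime; try exact: dis.
    exact: (pc 0%N).
  exact: (pc 1%N).
- have [s0 n0] := cS 0%N isT; have [s1 n1] := cS 1%N isT.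
  case=> [|[|j]] // _; split.
  + by move=> z [s [Ss [u /s0 hu e]]]; exists s; split=> //; exists u.
  + move=> h; apply: n0 => x hx; apply: (extensionE (pc 0%N isT) (dis _ c0Q)).
    apply: h; exists 1; split; first exact: isloc1.
    by exists x => //; rewrite rmorph1 mul1r.
  + move=> z [s [Ss [u /c1Q Qu e]]].
    have := Qu; rewrite /= -e => /(pri_prime pQ)[/(isloc_prime pQ Ss)//|//].
  + move=> h; apply: n1; rewrite c2 => x Qx.
    by apply: (extensionE (pc 1%N isT) (dis _ c1Q)); exact: h.
- by [].
Qed.

End Localizations.

Lemma trivial_alg_localization (R : comPzRingType) :
  is_localization (trivial_alg R) [set 1].
Proof.
split=> //=; first by move=> x y -> ->; rewrite mulr1.
- by move=> s ->; exists 1; rewrite mulr1.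
- by move=> z; exists 1; split=> //; exists z; rewrite mul1r.
- by move=> u ->; exists 1; rewrite ?mulr0.
Qed.

Lemma localization_alg_localization (R : comPzRingType) (S : set R) :
  is_localization (localization_alg S) (mult_closure S).
Proof.
split; [exact: mult_closure1|exact: mult_closure_mul| | |].
- move=> s Ss; exists (loc_pi (FractionPair 1 Ss)).
  rewrite /= [LHS](loc_piM (frac_cst S s)); apply/loc_piP/asboolP => /=.
  by exists 1; [exact: mult_closure1 | ring].
- elim/loc_ind=> z; exists (Defs.den z); split; first exact: den_closure.
  exists (Defs.num z); rewrite [LHS](loc_piM (frac_cst S (Defs.den z))).
  by apply/loc_piP/asboolP => /=; exists 1; [exact: mult_closure1 | ring].
- move=> u /loc_piP/asboolP[s Ss] /=; rewrite mulr1 mul0r mulr0 => e.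
  by exists s.
Qed.

(** * Profinite rings *)

Section Profinite.
Variables (V : zmodType) (F : nat -> set V).

Record profinite : Prop := Profinite {
  pf0 : forall n, F n 0;
  pfB : forall n x y, F n x -> F n y -> F n (x - y);
  pfS : forall n, F n.+1 `<=` F n;
  pf_finite : forall n, exists s : seq V, forall x, exists2 y, y \in s & F n (x - y);
  pf_complete : forall u : nat -> V, (forall n, F n (u n.+1 - u n)) ->
    exists x, forall n, F n (x - u n) }.

Hypothesis pfF : profinite.

Lemma pfN n x : F n x -> F n (- x).
Proof. by rewrite -sub0r; apply: (pfB pfF); exact: pf0. Qed.

Lemma pfD n x y : F n x -> F n y -> F n (x + y).
Proof. by move=> hx hy; rewrite -(opprK y); apply: (pfB pfF) => //; exact: pfN. Qed.

Lemma pfC n x y : F n (x - y) -> F n (y - x).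
Proof. by move=> /pfN; rewrite opprB. Qed.

Lemma pf_trans n y x z : F n (x - y) -> F n (y - z) -> F n (x - z).
Proof. by move=> h1 h2; rewrite -(subrK y x) -addrA; exact: pfD. Qed.

Lemma pigeonhole (T : eqType) (s : seq T) (Q : T -> nat -> Prop) :
  (forall z m, Q z m.+1 -> Q z m) ->
  (forall m, exists2 z, z \in s & Q z m) -> exists2 z, z \in s & forall m, Q z m.
Proof.
move=> QS; have Qmono z m n : (m <= n)%N -> Q z n -> Q z m.
  elim: n => [|n IH]; first by rewrite leqn0 => /eqP ->.
  by rewrite leq_eqVlt ltnS => /predU1P[-> //|/IH h /QS].
elim: s => [h|t s IH h]; first by have [] := h 0%N.
have [ht|/existsNP[m0 hm0]] := pselect (forall m, Q t m).
  by exists t => //; rewrite inE eqxx.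
have [|z zs hz] := IH; last by exists z => //; rewrite inE zs orbT.
move=> m; have [z] := h (maxn m0 m); rewrite inE => /predU1P[-> hQ|zs hQ].
  by case: hm0; apply: Qmono hQ; rewrite leq_maxl.
by exists z => //; apply: Qmono hQ; rewrite leq_maxr.
Qed.

(* Compactness, by Koenig's lemma on the finite quotients. *)
Lemma profinite_compact (C : nat -> set V) : (forall n, C n !=set0) ->
  (forall n, C n.+1 `<=` C n) ->
  (forall n x y, C n x -> F n (x - y) -> C n y) ->
  exists x, forall n, C n x.
Proof.
move=> C0 CS Csat.
have refine n (D : set V) : (forall m, C m `&` D !=set0) ->
    exists z, forall m, exists y, [/\ C m y, D y & F n (z - y)].
  move=> hD; have [s hs] := pf_finite pfF n.
  have [z m [y [Cy Dy zy]]|m|z _ hz] := @pigeonhole V s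
    (fun z m => exists y, [/\ C m y, D y & F n (z - y)]).
  - by exists y; split=> //; exact: CS.
  - have [y [Cy Dy]] := hD m; have [z zs yz] := hs y.
    by exists z => //; exists y; split=> //; exact: pfC.
  - by exists z.
(* [good n x]: the coset x + F n meets every C m. Such an x can be refined inside its coset to a
   point good at level n.+1. *)
pose good n x := forall m, exists y, C m y /\ F n (x - y).
have [x0 g0] : exists x0, good 0%N x0.
  have [|x hx] := refine 0%N setT; first by move=> m; rewrite setIT.
  by exists x => m; have [y [Cy _ xy]] := hx m; exists y.
have /choice[f hf] : forall nx : nat * V, exists x', good nx.1 nx.2 ->
    good nx.1.+1 x' /\ F nx.1 (x' - nx.2).
  move=> [n x] /=; have [g|ng] := pselect (good n x); last by exists x.
  have [|z hz] := refine n.+1 [set y | F n (x - y)].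
    by move=> m; have [y [Cy xy]] := g m; exists y.
  exists z => _; split; first by move=> m; have [y [Cy _ zy]] := hz m; exists y.
  have [y [_ xy zy]] := hz 0%N; apply: (pf_trans (y := y)); first exact: (pfS pfF).
  exact: pfC.
pose u := fix u n := if n is n'.+1 then f (n', u n') else x0.
have gu n : good n (u n).
  by elim: n => [//|n IH]; have [] := hf (n, u n) IH.
have [|x hx] := pf_complete pfF (u := u).
  by move=> n; have [] := hf (n, u n) (gu n).
exists x => n; have [y [Cy uy]] := gu n n; apply: Csat Cy _.
by apply: pfC; apply: pf_trans uy.
Qed.

End Profinite.

Section ProfiniteRing.
Variables (R : comPzRingType) (F : nat -> set R).
Hypotheses (pfF : profinite F) (iF : forall n, is_ideal (F n)).
Hypothesis sepF : forall x, (forall n, F n x) -> x = 0.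

Definition closed_ideal (I : set R) :=
  forall x, (forall n, exists2 y, I y & F n (x - y)) -> I x.

(** The coefficients b admissible modulo F n form decreasing non-empty sets stable under F n;
    compactness gives one b for all levels. *)
Lemma closed_adjoin I t : is_ideal I -> closed_ideal I -> closed_ideal (adjoin I t).
Proof.
move=> iI cI x hx.
have [n|n b [y Iy h]|n b c [y Iy h] bc|b hb] := @profinite_compact _ _ pfF
  (fun n => [set b | exists2 y, I y & F n (x - b * t - y)]).
- have [y [b Iy] xy] := hx n; exists b, (y - b * t) => //.
  by rewrite opprB addrA subrK.
- by exists y => //; exact: (pfS pfF).
- exists y => //.
  have -> : x - c * t - y = (x - b * t - y) + (b - c) * t by ring.
  by apply: (idD (iF n)) => //; rewrite mulrC; exact: (idM (iF n)).
- by exists b; apply: cI => n; have [y Iy h] := hb n; exists y.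
Qed.

Lemma gen_closed l : closed_ideal (gen l).
Proof.
elim: l => [|t l IH] x hx.
  by apply: sepF => n; have [y ->] := hx n; rewrite subr0.
have [|b hb] := @closed_adjoin (gen l) t (gen_is_ideal l) IH x; last by exists b.
by move=> n; have [y [b _ hb] xy] := hx n; exists y => //; exists b.
Qed.

Lemma gen_lift (I : set R) l t (w : R -> R) : is_ideal I ->
  (forall a, a \in l -> exists b, w a = a - b * t) ->
  forall x, gen l x -> exists b, gen (map w l) (x - b * t).
Proof.
move=> iI; elim: l => [_ x ->|v l IH hw x /= [a _ ha]].
  by exists 0; rewrite mul0r subr0.
have [|b hb] := IH _ _ ha; first by move=> c cl; apply: hw; rewrite inE cl orbT.
have [|d ed] := hw v; first by rewrite inE eqxx.
exists (b + a * d), a => //; move: hb; congr (gen _ _).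
by rewrite ed; ring.
Qed.

(* Hilbert's basis argument for the t-adic filtration, where closedness of
   finitely generated ideals replaces the summation of power series. *)
Lemma fg_above_step s t : (forall n, exists k, F n (t ^+ k)) ->
  (forall I, is_ideal I -> gen (t :: s) `<=` I -> fg_ideal I) ->
  forall I, is_ideal I -> gen s `<=` I -> fg_ideal I.
Proof.
move=> tnil fgt I iI sI.
(* The leading coefficients at t^n of elements of I: those a with t^n (a - b t) in I for some b. *)
pose Q n : set R := adjoin [set a | I (t ^+ n * a)] t.
have iI' n : is_ideal [set a | I (t ^+ n * a)].
  split=> /=; first by rewrite mulr0; exact: id0.
  - by move=> x y hx hy; rewrite mulrDr; exact: idD.
  - by move=> a x hx; rewrite mulrCA; exact: idM.
have iQ n : is_ideal (Q n) by exact: adjoin_is_ideal.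
have QS n : Q n `<=` Q n.+1.
  by apply: adjoinS => x /= h; rewrite exprS -mulrA; exact: idM.
have tsQ n : gen (t :: s) `<=` Q n.
  move=> x [b _ hb]; exists b => /=; apply: (idM iI); exact: sI.
have [|N hN] := acc_of_fg iQ QS.
  apply: fgt; first exact: union_is_ideal.
  by move=> x hx; exists 0%N => //; exact: tsQ.
have /choice[l hl] : forall n, exists l, Q n = gen l.
  by move=> n; apply: fgt => //; exact: tsQ.
have /choice[w hw] : forall na : nat * R, exists a',
    Q na.1 na.2 -> I (t ^+ na.1 * a') /\ exists b, a' = na.2 - b * t.
  move=> [n a] /=; have [[b hb]|nQ] := pselect (Q n a); last by exists 0.
  by exists (a - b * t) => _; split=> //; exists b.
pose L n := [seq w (n, a) | a <- l n].
have LI n a : a \in L n -> I (t ^+ n * a).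
  move=> /mapP[b bl ->]; have [|//] := hw (n, b).
  by rewrite /= hl; exact: mem_gen.
pose G := flatten [seq [seq t ^+ n * a | a <- L n] | n <- iota 0 N.+1].
have memG n a : (n <= N)%N -> a \in L n -> t ^+ n * a \in G.
  move=> nN aL; apply/flatten_mapP; exists n; first by rewrite mem_iota.
  exact: map_f.
exists G; apply/seteqP; split; last first.
  apply: gen_sub => // x /flatten_mapP[n _ /mapP[a aL ->]]; exact: LI.
move=> x Ix; apply: gen_closed => n; have [k hk] := tnil n.
(* Invariant of the division: x is t^k y modulo [gen G], with t^k y still in I. The final k has t^k
   in F n. *)
suff [y hy _] : exists2 y, gen G (x - t ^+ k * y) & I (t ^+ k * y).
  exists (x - t ^+ k * y) => //; rewrite opprB addrC subrK mulrC.
  exact: (idM (iF n)).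
elim: k {hk} => [|k [y hy Iy]].
  by exists x; rewrite expr0 mul1r // subrr; exact: (id0 (gen_is_ideal _)).
(* Past N the ideals Q are constant, so the generators of level N multiplied by t^(k - N) serve for
   all k > N. *)
pose m := minn k N.
have Qy : Q m y.
  have : Q k y by exists 0; rewrite mul0r subr0.
  by rewrite /m; case: (leqP k N) => // _; exact: hN.
have [||b hb] := @gen_lift _ (l m) t (fun a => w (m, a)) iI _ y; last 1 first.
- have hbL : gen (L m) (y - b * t) by [].
  exists b.
    rewrite (_ : _ - _ = (x - t ^+ k * y) + t ^+ k * (y - b * t)); last first.
      by rewrite exprS; ring.
    apply: (idD (gen_is_ideal _)) => //.
    rewrite -(subnK (geq_minl k N)) -/m exprD -mulrA; apply: (idM (gen_is_ideal _)).
    have : gen [seq t ^+ m * a | a <- L m] (t ^+ m * (y - b * t)).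
      elim: (L m) (y - b * t) hbL => [|v l' IH] z /=; first by move=> ->; rewrite mulr0.
      move=> [c _ /IH h]; exists c => //; move: h; congr (gen _ _); ring.
    apply: gen_subset => z /mapP[a aL ->]; apply: memG => //; exact: geq_minr.
  rewrite (_ : _ * _ = t ^+ k * y - t ^+ k * (y - b * t)); last by rewrite exprS; ring.
  apply: (idB iI) => //.
  rewrite -(subnK (geq_minl k N)) -/m exprD -mulrA; apply: (idM iI).
  by have := @gen_sub _ (L m) _ (iI' m) (@LI m); exact.
- by move=> a al; have [|] := hw (m, a); rewrite /= ?hl //; exact: mem_gen.
- by have := Qy; rewrite hl.
Qed.

(** Reduces noetherianity to the quotient by topologically nilpotent elements, dropping one
    generator of s at a time. *)
Lemma noetherian_of_nilpotent s : (forall t, t \in s -> forall n, exists k, F n (t ^+ k)) ->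
  (forall I, is_ideal I -> gen s `<=` I -> fg_ideal I) -> noetherian R.
Proof.
elim: s => [_ h I iI|t s IH ht h].
  by apply: h => // x ->; exact: id0.
apply: IH => [u us|]; first by apply: ht; rewrite inE us orbT.
by apply: fg_above_step h; apply: ht; rewrite inE eqxx.
Qed.

End ProfiniteRing.

(** * The p-adic integers *)

Section PadicFacts.
Variable p : nat.
Hypothesis p_pr : prime p.
Local Notation Zp := (padic_int p).
Local Notation q n := ((p ^ n)%N%:Z).
Implicit Types x y : Zp.

Lemma q_neq0 n : q n != 0.
Proof. by rewrite eqz_nat -lt0n expn_gt0 prime_gt0. Qed.

Lemma zp_val0 n : (0 : Zp) n = 0.
Proof. by rewrite /= mod0z. Qed.

Lemma modz_q (a : int) m n : (m <= n)%N -> ((a %% q n)%Z %% q m)%Z = (a %% q m)%Z.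
Proof.
move=> /subnK <-; rewrite [in RHS](divz_eq a (q (n - m + m))).
by rewrite {3}expnD PoszM mulrA modzMDl.
Qed.

Lemma zp_val_mod x m n : (m <= n)%N -> (x n %% q m)%Z = x m.
Proof.
move=> /subnK <-; elim: (n - m)%N => [|k IH]; first by rewrite add0n zp_mod.
by rewrite -IH addSn (zp_compat x (k + m)) modz_q // leq_addl.
Qed.

Lemma zp_val_nat m n : (m%:R : Zp) n = (m%:Z %% q n)%Z.
Proof.
elim: m => [|m IH]; first by rewrite mod0z; exact: zp_val0.
rewrite -natr1; transitivity (((m%:R : Zp) n + (1 : Zp) n) %% q n)%Z => //.
by rewrite IH /= modzDml modzDmr -PoszD addn1.
Qed.

Lemma zp_valB0 x y n : (x - y) n = 0 <-> x n = y n.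
Proof.
have e : (x - y) n = ((x n - y n) %% q n)%Z by rewrite /= modzDmr.
rewrite e; split=> [/eqP h|->]; last by rewrite subrr mod0z.
by apply/eqP; rewrite -(zp_mod x) -(zp_mod y) eqz_mod_dvd; apply/dvdz_mod0P/eqP.
Qed.

Lemma zp_valM0 x y n : y n = 0 -> (x * y) n = 0.
Proof. by move=> e; rewrite /= e mulr0 mod0z. Qed.

Lemma zp_valD0 x y n : x n = 0 -> y n = 0 -> (x + y) n = 0.
Proof. by move=> ex ey; rewrite /= ex ey addr0 mod0z. Qed.

Lemma zp_val_le0 x m n : (m <= n)%N -> x n = 0 -> x m = 0.
Proof. by move=> mn e; rewrite -(zp_val_mod x mn) e mod0z. Qed.

Lemma zp_sep x : (forall n, x n = 0) -> x = 0.
Proof. by move=> h; apply: zp_eq => n; rewrite h zp_val0. Qed.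

Lemma zp_divide x n : x n = 0 -> exists y, x = (p ^ n)%N%:R * y.
Proof.
move=> xn0.
have dv k : (q n %| x (n + k)%N)%Z.
  by apply/dvdz_mod0P; rewrite zp_val_mod // leq_addr.
(* The k-th component of x / p^n is read off from x at level n + k. *)
have comp k : (((x (n + k.+1)%N %/ q n)%Z) %% q k = ((x (n + k)%N %/ q n)%Z) %% q k)%Z.
  apply/eqP; rewrite eqz_mod_dvd -(dvdz_mul2l (q_neq0 n)) mulrBr -PoszM -expnD.
  rewrite ![q n * _]mulrC !divzK //.
  rewrite -eqz_mod_dvd; apply/eqP; rewrite zp_mod.
  by rewrite zp_val_mod // leq_add2l.
exists (zp_mk comp); apply: zp_eq => m /=.
have := zp_val_nat (p ^ n) m; move: (_%:R : Zp) => c ->.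
by rewrite modzMml modzMmr mulrC divzK // zp_val_mod // leq_addl.
Qed.

Lemma zp_val_pM n x : ((p ^ n)%N%:R * x) n = 0.
Proof. by rewrite mulrC zp_valM0 // zp_val_nat modzz. Qed.

Lemma zp_natM_val m n x : ((p ^ m)%N%:R * x) (m + n)%N = 0 -> x n = 0.
Proof.
move=> e; have : ((q m * x (m + n)%N) %% q (m + n))%Z = 0.
  by move: e; rewrite /= zp_val_nat modzMml.
move/dvdz_mod0P; rewrite expnD PoszM dvdz_mul2l ?q_neq0 //.
by move/dvdz_mod0P; rewrite zp_val_mod // leq_addl.
Qed.

Lemma zp_torsion_free n x : (p ^ n)%N%:R * x = 0 -> x = 0.
Proof.
by move=> e; apply: zp_sep => m; apply: (@zp_natM_val n); rewrite e zp_val0.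
Qed.

Lemma zp_profinite : profinite (fun n => [set x : Zp | x n = 0]).
Proof.
split=> /=.
- by move=> n; exact: zp_val0.
- by move=> n x y hx hy; rewrite zp_valB0 hx hy.
- by move=> n x; apply: zp_val_le0.
- move=> n; exists (codom (fun k : 'I_(p ^ n) => (nat_of_ord k)%:R : Zp)) => x.
  have [k ek] : exists k : nat, x n = k%:Z.
    exists `|x n|%N; rewrite gez0_abs // -zp_mod modz_ge0 //; exact: q_neq0.
  have kn : (k < p ^ n)%N.
    by rewrite -ltz_nat -ek -zp_mod ltz_pmod // ltz_nat expn_gt0 prime_gt0.
  exists k%:R; last by apply/zp_valB0; rewrite zp_val_nat ek modz_small // kn.
  exact: (codom_f (fun k : 'I_(p ^ n) => (nat_of_ord k)%:R : Zp) (Ordinal kn)).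
- move=> u hu.
  have hu' n : u n.+1 n = u n n by apply/zp_valB0; exact: hu.
  have comp n : (u n.+1 n.+1 %% q n = u n n %% q n)%Z.
    by rewrite zp_mod zp_val_mod // hu'.
  by exists (zp_mk comp) => n; apply/zp_valB0; rewrite /= zp_mod.
Qed.

Lemma zp_sep_pf x : (forall n, [set x : Zp | x n = 0] x) -> x = 0.
Proof. exact: zp_sep. Qed.

Lemma zp_val_is_ideal n : is_ideal [set x : Zp | x n = 0].
Proof.
split=> [|x y|a x] /=; [exact: zp_val0|exact: zp_valD0|exact: zp_valM0].
Qed.

Lemma zp_val_nat_eq x n : exists k : nat, (x - k%:R) n = 0.
Proof.
exists `|x n|%N; apply/zp_valB0; rewrite zp_val_nat gez0_abs ?zp_mod //.
by rewrite -zp_mod modz_ge0 // q_neq0.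
Qed.

(** [x 1] is the residue modulo p. Modulo p^n, x is an integer k prime to p, so Bezout puts 1 in (x)
    up to p^n, and (x) is closed. *)
Lemma zp_unit x : x 1%N != 0 -> exists y, x * y = 1.
Proof.
move=> x1; have [b hb] : gen [:: x] 1; last first.
  by move=> /eqP; rewrite subr_eq0 => /eqP ->; exists b; rewrite mulrC.
apply: (gen_closed zp_profinite zp_val_is_ideal zp_sep_pf) => n.
(* Level n.+1, so that k keeps the residue of x modulo p even when n = 0. *)
have [k hk] := zp_val_nat_eq x n.+1.
have cop : coprime k (p ^ n).
  apply: coprimeXr; rewrite coprime_sym prime_coprime //.
  apply: contra x1 => /dvdnP[k' ek]; apply/eqP.
  have /zp_valB0 -> : (x - k%:R) 1%N = 0 by apply: zp_val_le0 hk.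
  by rewrite zp_val_nat ek expn1 PoszM modzMl.
have k0 : (0 < k)%N.
  rewrite lt0n; apply: contra x1 => /eqP k0.
  have := hk; rewrite k0 subr0 => h; apply/eqP; exact: zp_val_le0 h.
have [u v e _] := egcdnP (p ^ n) k0.
exists (u%:R * x); first by exists u%:R => //; rewrite /= subrr.
have -> : 1 - u%:R * x = - (u%:R * (x - k%:R)) - (v%:R * (p ^ n)%N%:R).
  rewrite mulrBr -[u%:R * k%:R]natrM e (eqP cop) natrD natrM.
  by rewrite opprB [RHS]addrAC [X in _ = X - _]addrAC subrr add0r.
apply: (idB (zp_val_is_ideal n)).
  apply: (idN (zp_val_is_ideal n)); apply: (idM (zp_val_is_ideal n)).
  exact: zp_val_le0 hk.
by apply: (idM (zp_val_is_ideal n)); rewrite /= zp_val_nat modzz.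
Qed.

Lemma zp_factor x : x != 0 -> exists n u, x = (p ^ n)%N%:R * u /\ u 1%N != 0.
Proof.
move=> x0; have [n xn0] : exists n, x n != 0.
  apply: contrapT => h; move/eqP: x0; apply; apply: zp_sep => n.
  by apply: contrapT => /eqP xn; apply: h; exists n.
elim: n => [|n IH] in x x0 xn0 *.
  by move: xn0; rewrite -zp_mod modz1.
have [x1|x1] := eqVneq (x 1%N) 0; last first.
  by exists 0%N, x; rewrite expn0 mul1r.
have [y ey] := zp_divide x1.
have y0 : y != 0 by apply: contraNneq x0 => y0; rewrite ey y0 mulr0.
have yn : y n != 0.
  apply: contraNneq xn0 => yn; have [z ez] := zp_divide yn.
  by rewrite ey ez mulrA -natrM expn1 -expnS zp_val_pM.
have [m [u [eu u1]]] := IH y y0 yn.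
by exists m.+1, u; rewrite ey eu mulrA -natrM expn1 -expnS.
Qed.

Lemma zp_domain x y : x * y = 0 -> x = 0 \/ y = 0.
Proof.
move=> e; have [->|x0] := eqVneq x 0; [by left|right].
have [n [u [eu u1]]] := zp_factor x0; have [v ev] := zp_unit u1.
apply: (@zp_torsion_free n); have -> : (p ^ n)%N%:R = x * v by rewrite eu -mulrA ev mulr1.
by rewrite mulrAC e mul0r.
Qed.

Lemma zp_unit_val x y : x * y = 1 -> x 1%N != 0.
Proof.
move=> e; apply/eqP => x1; have : (y * x) 1%N = 0 by exact: zp_valM0.
rewrite mulrC e /= expn1; have := prime_gt1 p_pr.
by case: p => [|[|p']] //.
Qed.

End PadicFacts.

(** * Completed group rings *)

Section CompletedGroupRingFacts.
Variables (R : comPzRingType) (G : topAbGroup).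
Implicit Types (a b : cgr R G) (U V : open_subgroup G).

Lemma cgr_eltD g h : cgr_elt R (g + h) = cgr_elt R g * cgr_elt R h :> cgr R G.
Proof.
apply: cgr_eq => U x; rewrite [RHS]/= /mul_coef /= /elt_coef.
rewrite (coset_sum_indic (U := U) g (F := fun y => Defs.indic R (U (x - y - h)))).
  by rewrite opprD addrA.
move=> y z yz; apply: Defs.indicE.
have e w : x - w - h = x - h - w by rewrite addrAC.
split; rewrite !e => hx.
  by rewrite -(subrK y (x - h)) -addrA; apply: osubD.
by rewrite -(subrK z (x - h)) -addrA; apply: osubD => //; exact: osub_sym.
Qed.

Lemma cgr_eltMn g k : cgr_elt R (g *+ k) = cgr_elt R g ^+ k :> cgr R G.
Proof.
by elim: k => [|k IH]; rewrite ?mulr0n ?expr0 // mulrS exprS cgr_eltD IH.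
Qed.

Lemma cgr_coef_sum (I : Type) (s : seq I) (P : pred I) (F : I -> cgr R G) U g :
  (\sum_(j <- s | P j) F j) U g = \sum_(j <- s | P j) F j U g.
Proof. by elim/big_rec2: _ => [//|j x y _ <-]. Qed.

Lemma cgr_coefMn a k U g : (a *+ k) U g = a U g *+ k.
Proof. by elim: k => [//|k IH]; rewrite !mulrS -IH. Qed.

Lemma sum_elt_coef U (k : G -> nat) g :
  (forall x y, U (x - y) -> k x = k y) ->
  (\sum_(h <- cosets U) cgr_elt R h *+ k h : cgr R G) U g = (k g)%:R.
Proof.
move=> hk; rewrite cgr_coef_sum.
rewrite -[RHS](coset_sum_indic (U := U) g (F := fun h => (k h)%:R)).
  apply: eq_bigr => h _; rewrite cgr_coefMn mulr_natr /= /elt_coef; congr (_ *+ _).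
  by apply: Defs.indicE; split; exact: osub_sym.
by move=> x y xy; rewrite (hk _ _ xy).
Qed.

(* If [a] is invariant by [t], each of its coefficients modulo U + Zt is the
   sum over the n cosets of U in a coset of U + Zt of one and the same value. *)
Lemma orbit_coef U V t n a : (0 < n)%N -> (forall k, U (t *+ k) <-> (n %| k)%N) ->
  (forall g, V g <-> exists k, U (g - t *+ k)) ->
  (forall g, a U (g + t) = a U g) -> forall g, a V g = a U g *+ n.
Proof.
move=> n0 hn hV inv.
have UV : U `<=` V by move=> x Ux; apply/hV; exists 0%N; rewrite mulr0n subr0.
have Vt : V t by apply/hV; exists 1%N; rewrite mulr1n subrr; exact: osub0.
have Vtn k : V (t *+ k).
  by elim: k => [|k IH]; [rewrite mulr0n; exact: osub0|rewrite mulrS; exact: osubD].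
have invn g k : a U (g + t *+ k) = a U g.
  by elim: k => [|k IH]; rewrite ?mulr0n ?addr0 // mulrS addrCA addrC inv IH.
have tmod k : U (t *+ k - t *+ (k %% n)).
  by rewrite {1}(divn_eq k n) mulrnDr addrK; apply/hn; exact: dvdn_mull.
pose s := [seq w + t *+ j | w <- cosets V, j <- iota 0 n].
have [uV cV sV] := cosetsP V.
have mem_s w j : w \in cosets V -> (j < n)%N -> w + t *+ j \in s.
  by move=> wV jn; apply/allpairsP; exists (w, j); rewrite mem_iota.
have ts_inj w w' j j' : w \in cosets V -> w' \in cosets V -> (j < n)%N -> (j' < n)%N ->
    U (w + t *+ j - (w' + t *+ j')) -> w = w' /\ j = j'.
  move=> wV w'V jn j'n h.
  have e : w = w'.
    apply: sV => //.
    have -> : w - w' = (w + t *+ j - (w' + t *+ j')) - t *+ j + t *+ j'.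
      rewrite opprD addrACA -[RHS]addrA -[RHS]addrA [t *+ j - t *+ j' + _]addrACA.
      by rewrite subrr addNr addr0 addr0.
    by apply: osubD (Vtn _); apply: osubB (Vtn _); exact: UV.
  split=> //; move: h; rewrite e opprD addrACA subrr add0r => h.
  have wlg x y : (x < n)%N -> (y < n)%N -> (x <= y)%N -> U (t *+ x - t *+ y) -> x = y.
    move=> xn yn xy /osubN; rewrite opprB -mulrnBr // => /hn /dvdnP[[|c] ec].
      by apply/eqP; rewrite eqn_leq xy -subn_eq0 ec.
    have : (n <= y - x)%N by rewrite ec mulSn leq_addr.
    by rewrite leqNgt (leq_ltn_trans (leq_subr _ _) yn).
  case/orP: (leq_total j j') => jj; first exact: wlg.
  by apply/esym; apply: wlg => //; exact: osub_sym.
have ts : Defs.is_transversal U s.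
  split.
  - apply: allpairs_uniq => //; first exact: iota_uniq.
    move=> [w j] [w' j'] /allpairsPdep[x [y [xV yn [-> ->]]]] /allpairsPdep[x' [y' [xV' yn' [-> ->]]]] /= e.
    move: yn yn'; rewrite !mem_iota /= => yn yn'.
    have [|||||-> ->] // := @ts_inj x x' y y' => //.
    by rewrite e subrr; exact: osub0.
  - move=> g; have [w wV /hV[k hk]] := cV g.
    exists (w + t *+ (k %% n)); first by rewrite mem_s // ltn_pmod.
    by rewrite opprD addrA -(subrK (t *+ k) (g - w)) -addrA; exact: osubD.
  - move=> g h /allpairsPdep[w [j [wV jn ->]]] /allpairsPdep[w' [j' [w'V j'n ->]]] hU.
    move: jn j'n; rewrite !mem_iota /= => jn j'n.
    by have [|||||-> ->] // := @ts_inj w w' j j'.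
move=> g; rewrite (cgr_compat_indic a g UV).
rewrite (eq_transversal_sum (cosetsP U) ts); last first.
  apply: coset_invariant_indic; last by move=> x y; exact: cgr_inv.
  by move=> x y /UV; exact: osub_shift_l.
rewrite big_allpairs_dep /=.
rewrite -[RHS](coset_sum_indic (U := V) g (F := fun h => a U h *+ n)); last first.
  move=> x y /hV[k hk]; congr (_ *+ n); rewrite -(invn y k); apply: cgr_inv.
  by rewrite opprD addrA.
apply: eq_bigr => w _; rewrite (eq_bigr (fun=> Defs.indic R (V (w - g)) * a U w)).
  rewrite big_const_seq count_predT size_iota -Monoid.iteropE /=.
  by rewrite mulrnAr.
move=> j _; rewrite invn; congr (_ * _); apply: Defs.indicE.
rewrite addrAC; split=> h; last exact: osubD h (Vtn _).
by rewrite -(addrK (t *+ j) (w - g)); exact: osubB h (Vtn _).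
Qed.

End CompletedGroupRingFacts.

(** Unlike in [is_top_iso], the inverse is data, so coordinates of group elements are available as a
    function. *)
Record zp_chart (p d : nat) (G : topAbGroup) := ZpChart {
  chart :> 'cV[padic_int p]_d -> G;
  unchart : G -> 'cV[padic_int p]_d;
  chartB : zmod_morphism chart;
  chartK : cancel chart unchart;
  unchartK : cancel unchart chart;
  chart_continuous : continuous chart;
  unchart_continuous : continuous unchart }.

Section ZpGroups.
Variables (p d : nat) (G : topAbGroup).
Hypothesis p_pr : prime p.
Local Notation Zp := (padic_int p).
Local Notation V := 'cV[Zp]_d.
Variable c0 : zp_chart p d G.
Local Notation e := (chart c0).
Local Notation e' := (unchart c0).
Local Notation eB := (@chartB _ _ _ c0).
Local Notation eK := (@chartK _ _ _ c0).
Local Notation e'K := (@unchartK _ _ _ c0).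
Local Notation ce := (@chart_continuous _ _ _ c0).
Local Notation ce' := (@unchart_continuous _ _ _ c0).

Lemma iso_mor0 : e 0 = 0.
Proof. by rewrite -(subrr 0) eB subrr. Qed.
Lemma iso_morN v : e (- v) = - e v.
Proof. by rewrite -(sub0r v) eB iso_mor0 sub0r. Qed.
Lemma iso_morD v w : e (v + w) = e v + e w.
Proof. by rewrite -{1}(opprK w) eB iso_morN opprK. Qed.
Lemma iso_morMn v n : e (v *+ n) = e v *+ n.
Proof. by elim: n => [|n IH]; rewrite ?mulr0n ?iso_mor0 // !mulrS iso_morD IH. Qed.

Lemma cv_divide (v : V) n : (forall j, v j 0 n = 0) <-> exists w, v = w *+ (p ^ n).
Proof.
split=> [h|[w -> j]].
  have /choice[f hf] j : exists y, v j 0 = (p ^ n)%N%:R * y by exact: zp_divide.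
  exists (\col_j f j); apply/colP => j; rewrite hf -scaler_nat !mxE //.
by rewrite -scaler_nat mxE zp_val_pM.
Qed.

(** The subgroup p^n G, defined without coordinates so that every homomorphism respects it. These
    form a basis of neighbourhoods of 0. *)
Definition pmult n : set G := [set g | exists h, g = h *+ (p ^ n)].

Lemma pmultP n v : pmult n (e v) <-> forall j, v j 0 n = 0.
Proof.
split=> [[h eh]|/cv_divide[w ->]]; last by exists (e w); exact: iso_morMn.
apply/cv_divide; exists (e' h); apply: (can_inj eK).
by rewrite iso_morMn e'K.
Qed.

Lemma pmult_le m n : (m <= n)%N -> pmult n `<=` pmult m.
Proof.
by move=> mn g [h ->]; exists (h *+ p ^ (n - m)); rewrite -mulrnA -expnD subnK.
Qed.

Lemma nbhs_zp (x : Zp) n : nbhs x [set y : Zp | y n = x n].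
Proof.
apply: open_nbhs_nbhs; split=> //.
suff : zp_open [set y : Zp | y n = x n] by [].
by move=> y /= ey; exists n => z ->.
Qed.

Lemma zp_nbhsP (x : Zp) (A : set Zp) : nbhs x A -> exists n, [set y : Zp | y n = x n] `<=` A.
Proof.
rewrite nbhsE => -[B [oB Bx] BA]; have [n hn] := (oB : zp_open B) _ Bx.
by exists n => y /hn/BA.
Qed.

Lemma nbhs_cv (v : V) n : nbhs v [set w : V | forall j, w j 0 n = v j 0 n].
Proof.
exists (fun i j => [set y : Zp | y n = v i j n]) => [i j|w hw j /=]; last exact: hw.
exact: nbhs_zp.
Qed.

Lemma nbhs_pmult g n : nbhs g [set h | pmult n (h - g)].
Proof.
have ng : nbhs g (e' @^-1` [set w : V | forall j, w j 0 n = e' g j 0 n]).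
  exact: @ce' g _ (nbhs_cv (e' g) n).
apply: filterS ng => h /= hg.
rewrite -(e'K h) -(e'K g) -eB; apply/pmultP => j.
by rewrite !mxE; apply/zp_valB0; exact: hg.
Qed.

Lemma open_contains_pmult (U : open_subgroup G) : exists n, pmult n `<=` U.
Proof.
have U0 : nbhs (e 0) U.
  apply: open_nbhs_nbhs; split; first exact: osub_open.
  by rewrite iso_mor0; exact: osub0.
have [P hP PU] := @ce 0 _ U0.
have /choice[f hf] : forall j : 'I_d, exists n, [set y : Zp | y n = 0] `<=` P j 0.
  move=> j; have [n hn] := zp_nbhsP (hP j 0); exists n => y /= ey; apply: hn.
  by rewrite /= ey mxE zp_val0.
exists (\max_j f j) => g; rewrite -(e'K g) => /pmultP hg; apply: PU => i j.
rewrite (ord1 j); apply: hf; apply: (zp_val_le0 _ (hg i)).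
exact: leq_bigmax.
Qed.

Section LargeSubgroup.
Variables (n : nat) (H : set G) (H0 : H 0) (HB : forall x y, H x -> H y -> H (x - y)).
Hypothesis Hn : pmult n `<=` H.

Lemma large_open : open H.
Proof.
rewrite openE => g Hg; apply: filterS (nbhs_pmult g n) => h /= /Hn hg.
have -> : h = (h - g) - (0 - g) by rewrite sub0r opprK subrK.
by apply: HB => //; exact: HB.
Qed.

Lemma large_finite_index : exists s : seq G, forall g, exists2 h, h \in s & H (g - h).
Proof.
exists (codom (fun f : {ffun 'I_d -> 'I_(p ^ n)} => e (\col_j (nat_of_ord (f j))%:R))).
move=> g.
have /choice[f hf] : forall j : 'I_d, exists k : 'I_(p ^ n),
    (e' g j 0 - (nat_of_ord k)%:R) n = 0.
  move=> j; have [k hk] := zp_val_nat_eq p_pr (e' g j 0) n.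
  have kn : (k %% p ^ n < p ^ n)%N by rewrite ltn_mod expn_gt0 prime_gt0.
  exists (Ordinal kn); apply/zp_valB0; move/zp_valB0: hk => ->.
  by rewrite !zp_val_nat !modz_nat modn_mod.
exists (e (\col_j (nat_of_ord (f j))%:R)).
  apply/codomP; exists [ffun j => f j]; congr e; apply/colP => j.
  by rewrite !mxE ffunE.
apply: Hn; rewrite -{1}(e'K g) -eB; apply/pmultP => j.
by rewrite !mxE; exact: hf.
Qed.

Definition large_subgroup : open_subgroup G :=
  OpenSubgroup H0 HB large_open large_finite_index.

End LargeSubgroup.

Lemma pmult0 n : pmult n 0.
Proof. by exists 0; rewrite mul0rn. Qed.
Lemma pmultB n x y : pmult n x -> pmult n y -> pmult n (x - y).
Proof. by move=> [u ->] [v ->]; exists (u - v); rewrite mulrnBl. Qed.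

Definition pmult_sub n : open_subgroup G :=
  large_subgroup (pmult0 n) (@pmultB n) (@subset_refl _ _).

Lemma pmult_comb n g : exists c : 'I_d -> nat,
  pmult n (g - \sum_j e (delta_mx j 0) *+ c j).
Proof.
have /choice[c hc] : forall j : 'I_d, exists k : nat, (e' g j 0 - k%:R) n = 0.
  by move=> j; exact: zp_val_nat_eq.
exists c.
have -> : \sum_j e (delta_mx j 0) *+ c j = e (\col_j (c j)%:R).
  have -> : \col_j (c j)%:R = \sum_j (delta_mx j 0 : V) *+ c j.
    apply/colP => j; rewrite mxE summxE (bigD1 j) //= big1 ?addr0.
      by rewrite -scaler_nat !mxE !eqxx mulr1.
    by move=> k /negPf jk; rewrite -scaler_nat !mxE eq_sym jk mulr0.
  elim/big_rec2: _ => [|j x y _ ->]; first by rewrite iso_mor0.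
  by rewrite iso_morD iso_morMn.
rewrite -{1}(e'K g) -eB; apply/pmultP => j.
by rewrite !mxE; exact: hc.
Qed.

Local Notation L := (cgr Zp G).
Implicit Types a b : L.

(** The kernel of the map to (Z/p^n)[G/p^n G]: coefficients and group are truncated together, which
    makes the quotients finite. *)
Definition cgr_fil n : set L := [set a : L | forall g, (a (pmult_sub n) g) n = 0].

Lemma cgr_fil_coef n a (U : open_subgroup G) g : pmult n `<=` U ->
  cgr_fil n a -> (a U g) n = 0.
Proof.
move=> nU ha; rewrite (cgr_compat a (U := pmult_sub n) nU).
elim/big_ind: _ => [|x y|h _]; [exact: zp_val0|exact: zp_valD0|exact: ha].
Qed.

Lemma cgr_fil_ideal n : is_ideal (cgr_fil n).
Proof.
split=> [g|a b ha hb g|a b hb g]; first exact: zp_val0.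
  exact: zp_valD0 (ha g) (hb g).
rewrite /= /mul_coef; elim/big_ind: _ => [|x y|h _].
- exact: zp_val0.
- exact: zp_valD0.
- exact: (zp_valM0 _ (hb _)).
Qed.

Lemma cgr_filS n : cgr_fil n.+1 `<=` cgr_fil n.
Proof.
move=> a ha g; apply: (zp_val_le0 (leqnSn n)).
apply: cgr_fil_coef => //; exact: pmult_le.
Qed.

Lemma cgr_fil_le m n : (m <= n)%N -> cgr_fil n `<=` cgr_fil m.
Proof.
elim: n => [|n IH]; first by rewrite leqn0 => /eqP ->.
rewrite leq_eqVlt ltnS => /predU1P[-> //|/IH h].
exact: subset_trans (@cgr_filS n) h.
Qed.

Lemma cgr_fil_sep a : (forall n, cgr_fil n a) -> a = 0.
Proof.
move=> ha; apply: cgr_eq => U g; apply: (zp_sep (p := p)) => n.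
have [m mU] := open_contains_pmult U.
apply: (zp_val_le0 (leq_maxl n m)); apply: cgr_fil_coef (ha _).
by apply: subset_trans mU; apply: pmult_le; exact: leq_maxr.
Qed.

Lemma cgr_fil_elt n g h : pmult n (g - h) -> cgr_fil n (cgr_elt Zp g - cgr_elt Zp h).
Proof.
move=> gh x; apply/zp_valB0.
suff e1 : elt_coef Zp g (pmult_sub n) x = elt_coef Zp h (pmult_sub n) x.
  exact: (congr1 (fun z : Zp => z n) e1).
rewrite /elt_coef; apply: Defs.indicE.
split=> hx; first exact: (osub_trans (U := pmult_sub n) (y := g) hx gh).
exact: (osub_trans (U := pmult_sub n) (y := h) hx (osub_sym (U := pmult_sub n) gh)).
Qed.

Lemma cgr_fil_pMn n a k : (p ^ n %| k)%N -> cgr_fil n (a *+ k).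
Proof.
move=> /dvdnP[c ->] g; rewrite cgr_coefMn mulnC mulrnA -mulrnA -mulr_natl natrM -mulrA.
exact: zp_val_pM.
Qed.

Definition coef_nat n a g : nat := `|a (pmult_sub n) g n|%N.

Lemma coef_natE n a g : (a (pmult_sub n) g - (coef_nat n a g)%:R) n = 0.
Proof.
apply/zp_valB0; rewrite zp_val_nat /coef_nat gez0_abs ?zp_mod //.
by rewrite -zp_mod modz_ge0 // q_neq0.
Qed.

Lemma coef_nat_lt n a g : (coef_nat n a g < p ^ n)%N.
Proof.
rewrite -ltz_nat /coef_nat gez0_abs -zp_mod ?ltz_pmod ?modz_ge0 ?q_neq0 //.
by rewrite ltz_nat expn_gt0 prime_gt0.
Qed.

Lemma cgr_approx n a : cgr_fil n
  (a - \sum_(h <- cosets (pmult_sub n)) cgr_elt Zp h *+ coef_nat n a h).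
Proof.
move=> g.
have : (\sum_(h <- cosets (pmult_sub n)) cgr_elt Zp h *+ coef_nat n a h : L)
    (pmult_sub n) g = (coef_nat n a g)%:R.
  apply: sum_elt_coef => x y xy; rewrite /coef_nat.
  by rewrite (cgr_inv a xy).
move: (\sum_(h <- _) _) => s es.
have -> : (a - s) (pmult_sub n) g = a (pmult_sub n) g - s (pmult_sub n) g by [].
by rewrite es; exact: coef_natE.
Qed.

Lemma cgr_profinite : profinite cgr_fil.
Proof.
split.
- by move=> n; exact: id0 (cgr_fil_ideal n).
- by move=> n x y; exact: idB (cgr_fil_ideal n).
- exact: cgr_filS.
- move=> n; pose l := cosets (pmult_sub n).
  exists (codom (fun f : {ffun 'I_(size l) -> 'I_(p ^ n)} =>
    \sum_(j < size l) cgr_elt Zp l`_j *+ f j : L)) => a.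
  exists (\sum_(h <- l) cgr_elt Zp h *+ coef_nat n a h); last exact: cgr_approx.
  apply/codomP; exists [ffun j : 'I_(size l) => Ordinal (coef_nat_lt n a l`_j)].
  rewrite (big_nth 0) big_mkord; apply: eq_bigr => j _.
  by rewrite ffunE.
- move=> u hu.
  have hchain n k : cgr_fil n (u (n + k)%N - u n).
    elim: k => [|k IH]; first by rewrite addn0 subrr; exact: id0 (cgr_fil_ideal n).
    rewrite -(subrK (u (n + k)%N) (u (n + k.+1)%N)) -addrA.
    apply: (idD (cgr_fil_ideal n)) => //; rewrite addnS.
    by apply: cgr_fil_le (hu _); exact: leq_addr.
  have /choice[m hm] := open_contains_pmult.
  (* As p^(m U) G lies in U, the coefficients at U are controlled by the filtration from level m U
     on; hence the shift. *)
  have hlim U g : exists x : Zp, forall N n, (N + m U <= n)%N -> (x - u n U g) N = 0.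
    have [j|x hx] := pf_complete (zp_profinite p_pr) (u := fun j => u (j + m U)%N U g).
      apply: (zp_val_le0 (leq_addr (m U) j)).
      apply: (@cgr_fil_coef (j + m U) (u (j.+1 + m U)%N - u (j + m U)%N)); last exact: hu.
      by apply: subset_trans (hm U); apply: pmult_le; exact: leq_addl.
    exists x => N n Nn.
    rewrite -(subrK (u (N + m U)%N U g) x) -addrA; apply: zp_valD0; first exact: hx.
    apply/zp_valB0/esym/zp_valB0.
    apply: (zp_val_le0 (leq_addr (m U) N)).
    apply: (@cgr_fil_coef _ (u n - u (N + m U)%N)).
      by apply: subset_trans (hm U); apply: pmult_le; exact: leq_addl.
    by rewrite -(subnKC Nn); exact: hchain.
  have /choice[x hx] : forall Ug : open_subgroup G * G, exists x : Zp,
      forall N n, (N + m Ug.1 <= n)%N -> (x - u n Ug.1 Ug.2) N = 0.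
    by move=> [U g]; exact: hlim.
  have xinv (U : open_subgroup G) g h : U (g - h) -> x (U, g) = x (U, h).
    move=> gh; apply/eqP; rewrite -subr_eq0; apply/eqP/(zp_sep (p := p)) => N.
    have := hx (U, g) N _ (leqnn _); have := hx (U, h) N _ (leqnn _) => /= h1 h2.
    apply/zp_valB0; move/zp_valB0: h1 => ->; move/zp_valB0: h2 => ->.
    by rewrite (cgr_inv _ gh).
  have xcompat (U W : open_subgroup G) : U `<=` W -> forall g,
      x (W, g) = \sum_(h <- cosets U | `[< W (h - g) >]) x (U, h).
    move=> UW g; apply/eqP; rewrite -subr_eq0; apply/eqP/(zp_sep (p := p)) => N.
    set n := (N + m U + m W)%N.
    rewrite -(subrK (u n W g) (x (W, g))) -addrA; apply: zp_valD0.
      by apply: (hx (W, g)); rewrite /n addnAC leq_addr.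
    rewrite (cgr_compat _ UW) -sumrB; elim/big_ind: _ => [|y z|h _].
    - exact: zp_val0.
    - exact: zp_valD0.
    - apply/zp_valB0/esym/zp_valB0.
      by apply: (hx (U, h)); rewrite /n leq_addr.
  exists (Cgr xinv xcompat) => n g.
  set N := (n + m (pmult_sub n))%N.
  have h1 : (x (pmult_sub n, g) - u N (pmult_sub n) g) n = 0 by exact: (hx (_, _)).
  have h2 : (u N (pmult_sub n) g - u n (pmult_sub n) g) n = 0.
    exact: (hchain n (m (pmult_sub n)) g).
  suff : (x (pmult_sub n, g) - u n (pmult_sub n) g) n = 0 by [].
  by apply/zp_valB0; move/zp_valB0: h1 => ->; exact/zp_valB0.
Qed.

Lemma exp_sub_ideal (R : comPzRingType) (I : set R) (x y : R) n :
  is_ideal I -> I (x - y) -> I (x ^+ n - y ^+ n).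
Proof. by move=> iI h; rewrite subrXX mulrC; exact: idM. Qed.

Lemma frobenius_mod_p (R : comPzRingType) (x : R) n :
  exists r, (x - 1) ^+ (p ^ n) = x ^+ (p ^ n) - 1 + p%:R * r.
Proof.
have step (y : R) : exists r, (y - 1) ^+ p = y ^+ p - 1 + p%:R * r.
  (* Proved for z + 1 and applied at z = y - 1, which avoids the sign (-1)^p when p = 2. *)
  suff h (z : R) : exists r, (z + 1) ^+ p = z ^+ p + 1 + p%:R * r.
    have [r] := h (y - 1); rewrite subrK => ->; exists (- r); ring.
  have iJ : is_ideal [set x : R | exists r, x = p%:R * r].
    split=> [|_ _ [u ->] [v ->]|a _ [u ->]]; first by exists 0; rewrite mulr0.
      by exists (u + v); rewrite mulrDr.
    by exists (a * u); rewrite mulrCA.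
  suff [r er] : [set x : R | exists r, x = p%:R * r] ((z + 1) ^+ p - (z ^+ p + 1)).
    by exists r; rewrite -er [RHS]addrC subrK.
  rewrite exprDn -(big_mkord xpredT (fun i => z ^+ (p - i) * 1 ^+ i *+ 'C(p, i))).
  have splitsum (F : nat -> R) q : (0 < q)%N ->
      \sum_(0 <= i < q.+1) F i = F 0%N + (\sum_(0 <= i < q.-1) F i.+1 + F q).
    by case: q => // q _; rewrite big_nat_recl // big_nat_recr.
  rewrite splitsum ?prime_gt0 //.
  rewrite subn0 expr0 mulr1 bin0 mulr1n subnn expr0 mul1r expr1n binn mulr1n.
  rewrite opprD addrACA subrr add0r addrK.
  rewrite big_nat_cond; apply: (big_ind (fun x : R => exists r, x = p%:R * r)).
  - exact: id0 iJ.
  - exact: (idD iJ).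
  move=> i.
  rewrite andbT => /andP[_ im].
  have /dvdnP[c ->] : (p %| 'C(p, i.+1))%N.
    by apply: prime_dvd_bin => //; rewrite /= -ltn_predRL.
  by exists (z ^+ (p - i.+1) * c%:R); rewrite expr1n mulr1 mulrCA -natrM mulnC mulr_natr.
have iJ : is_ideal [set y : R | exists r, y = p%:R * r].
  split=> [|_ _ [u ->] [v ->]|a _ [u ->]]; first by exists 0; rewrite mulr0.
    by exists (u + v); rewrite mulrDr.
  by exists (a * u); rewrite mulrCA.
elim: n => [|n [r IH]]; first by exists 0; rewrite expn0 !expr1 mulr0 addr0.
have [s es] := step (x ^+ (p ^ n)).
have [|s' es'] := exp_sub_ideal (x := (x - 1) ^+ (p ^ n)) (y := x ^+ (p ^ n) - 1) p iJ.
  by exists r; rewrite IH addrC addKr.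
exists (s + s'); rewrite expnSr !exprM mulrDr -es' es; ring.
Qed.

Lemma cgr_elt_nilpotent g n : exists k, cgr_fil n ((cgr_elt Zp g - 1 : L) ^+ k).
Proof.
have iF := cgr_fil_ideal n.
(* Modulo p, (g - 1)^(p^n) is g^(p^n) - 1, which vanishes at level n; the remaining multiple of p
   needs the further power n. *)
exists (p ^ n * n)%N; rewrite exprM.
have [r ->] := frobenius_mod_p (cgr_elt Zp g : L) n.
rewrite -(subrK ((p%:R * r) ^+ n) ((_ + _) ^+ n)); apply: (idD iF).
  apply: (exp_sub_ideal n iF); rewrite addrK -cgr_eltMn.
  by apply: cgr_fil_elt; rewrite subr0; exists g.
rewrite exprMn -natrX mulr_natl; exact: cgr_fil_pMn.
Qed.

Lemma cgr_p_nilpotent n : exists k, cgr_fil n ((p%:R : L) ^+ k).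
Proof. by exists n; rewrite -natrX; exact: cgr_fil_pMn. Qed.


(** Up to level n, g is a natural combination of the basis, which reduces the claim to gh - 1 = h (g
    - 1) + (h - 1). *)
Lemma cgr_elt1_mem (I : set L) n g : is_ideal I ->
  (forall j, I (cgr_elt Zp (e (delta_mx j 0)) - 1)) ->
  idsum I (cgr_fil n) (cgr_elt Zp g - 1).
Proof.
move=> iI hI; have [c hc] := pmult_comb n g.
set h := \sum_j _ in hc; exists (cgr_elt Zp h - 1); last first.
  by rewrite opprB addrA subrK; exact: cgr_fil_elt.
rewrite /h; elim/big_ind: _ => [|x y hx hy|j _].
- by rewrite subrr; exact: id0.
- rewrite cgr_eltD (_ : _ - 1 = cgr_elt Zp y * (cgr_elt Zp x - 1) + (cgr_elt Zp y - 1)).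
    by apply: idD => //; exact: idM.
  by rewrite mulrBr mulr1 addrA subrK mulrC.
- by rewrite cgr_eltMn subrX1 mulrC; exact: idM.
Qed.

Lemma natr_val0 m n : (m%:R : Zp) n = 0 -> (p ^ n %| m)%N.
Proof.
rewrite zp_val_nat modz_nat => /eqP; rewrite eqz_nat; by [].
Qed.

(** The coefficient at this subgroup of index one is the augmentation. *)
Definition full_sub : open_subgroup G :=
  @large_subgroup 0%N setT I (fun _ _ _ _ => I) (fun _ _ => I).

(** The elements p and sigma_j - 1, for a basis sigma_j of G, are topologically nilpotent and
    generate an ideal with quotient F_p; an ideal above it is that ideal or the whole ring. *)
Lemma cgr_noetherian : noetherian L.
Proof.
pose s : seq L := p%:R :: [seq cgr_elt Zp (e (delta_mx j 0)) - 1 | j <- enum 'I_d].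
apply: (noetherian_of_nilpotent cgr_profinite cgr_fil_ideal cgr_fil_sep (s := s)).
  move=> t; rewrite inE => /predU1P[->|/mapP[j _ ->]] n; first exact: cgr_p_nilpotent.
  exact: cgr_elt_nilpotent.
have sp : gen s p%:R by apply: mem_gen; rewrite inE eqxx.
have se j : gen s (cgr_elt Zp (e (delta_mx j 0)) - 1).
  by apply: mem_gen; rewrite inE; apply/orP; right; apply/mapP; exists j; rewrite ?mem_enum.
have is_ := gen_is_ideal s.
have approx a : exists k : nat, gen s (a - k%:R).
  have [k hk] := zp_val_nat_eq p_pr (a full_sub 0) 1; exists k.
  apply: (gen_closed cgr_profinite cgr_fil_ideal cgr_fil_sep) => n.
  (* Level n.+1, because the coefficient sum m must match the augmentation modulo p even when n =
     0. *)
  set l := cosets (pmult_sub n.+1); pose m := (\sum_(h <- l) coef_nat n.+1 a h)%N.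
  have iK := idsum_is_ideal is_ (cgr_fil_ideal n.+1).
  suff [y hy h] : idsum (gen s) (cgr_fil n.+1) (a - k%:R).
    by exists y => //; exact: cgr_filS.
  have hm : ((m%:R : Zp) - k%:R) 1%N = 0.
    apply/zp_valB0; move/zp_valB0: hk => <-; apply/esym/zp_valB0.
    apply: (zp_val_le0 (n := n.+1)) => //.
    rewrite (cgr_compat a (U := pmult_sub n.+1) (V := full_sub)) //.
    rewrite big_mkcond natr_sum -sumrB; elim/big_ind: _ => [|x y|h _].
    - exact: zp_val0.
    - exact: zp_valD0.
    - by rewrite asboolT //; exact: coef_natE.
  have -> : a - k%:R = (a - \sum_(h <- l) cgr_elt Zp h *+ coef_nat n.+1 a h)
      + (\sum_(h <- l) cgr_elt Zp h *+ coef_nat n.+1 a h - m%:R) + (m%:R - k%:R).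
    by rewrite [RHS]addrA -[X in _ = X - _]addrA !subrK.
  apply: (idD iK); first apply: (idD iK).
  - exists 0; first exact: id0.
    by rewrite subr0; exact: cgr_approx.
  - rewrite natr_sum -sumrB.
    apply: (big_ind (idsum (gen s) (cgr_fil n.+1))) => [||h _].
    + exact: id0 iK.
    + exact: (idD iK).
    + by rewrite -mulrnBl -mulr_natl; apply: (idM iK); exact: cgr_elt1_mem.
  - exists (m%:R - k%:R); last by rewrite subrr; exact: id0 (cgr_fil_ideal _).
    have wlg x y : (x <= y)%N -> ((y%:R : Zp) - x%:R) 1%N = 0 -> gen s (y%:R - x%:R).
      move=> xy h0; have /dvdnP[c ec] : (p ^ 1 %| y - x)%N.
        by apply: natr_val0; rewrite natrB.
      by rewrite -natrB // ec expn1 natrM; exact: idM.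
    case/orP: (leq_total k m) => km; first exact: wlg.
    rewrite -opprB; apply: (idN is_); apply: wlg => //.
    by apply/zp_valB0/esym/zp_valB0.
move=> I iI sI.
have [[x [Ix nx]]|hI] := pselect (exists x, I x /\ ~ gen s x); last first.
  exists s; apply/seteqP; split=> // x Ix; apply: contrapT => nx; apply: hI.
  by exists x.
exists [:: 1].
suff I1 : I 1.
  apply/seteqP; split=> y _; last by rewrite -(mulr1 y); exact: idM.
  by exists y => //; rewrite mulr1 subrr.
have [k hk] := approx x.
have Ik : I k%:R.
  by rewrite -(subKr x k%:R); apply: (idB iI) => //; exact: sI.
have cop : coprime k p.
  rewrite coprime_sym prime_coprime //; apply/negP => /dvdnP[c ec]; apply: nx.
  rewrite -(subrK k%:R x); apply: (idD is_) => //.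
  by rewrite ec natrM; exact: idM.
have k0 : (0 < k)%N.
  by rewrite lt0n; apply: contraTneq cop => ->; rewrite /coprime gcd0n gtn_eqF ?prime_gt1.
have [u v euv _] := egcdnP p k0.
have -> : (1 : L) = u%:R * k%:R - v%:R * p%:R.
  by rewrite -!natrM euv (eqP cop) natrD addrC addKr.
by apply: (idB iI); apply: (idM iI) => //; exact: sI.
Qed.

Section CyclicExtension.
Variables (U : open_subgroup G) (t : G) (q : nat).
Hypotheses (q_gt0 : (0 < q)%N) (Utq : U (t *+ q)).

Definition cyc_set : set G := [set g | exists k, U (g - t *+ k)].

Lemma sub_cyc : U `<=` cyc_set.
Proof. by move=> g Ug; exists 0%N; rewrite mulr0n subr0. Qed.

Lemma cyc0 : cyc_set 0. Proof. by apply: sub_cyc; exact: osub0. Qed.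

Lemma osubMn k (g : G) : U g -> U (g *+ k).
Proof.
by move=> Ug; elim: k => [|k IH]; [rewrite mulr0n; exact: osub0|rewrite mulrS; exact: osubD].
Qed.

Lemma cycB x y : cyc_set x -> cyc_set y -> cyc_set (x - y).
Proof.
(* Only natural multiples of t are allowed: since q t lies in U, -t is replaced by (q - 1) t. *)
move=> [k hk] [j hj]; exists (k + j * q.-1)%N.
have -> : x - y - t *+ (k + j * q.-1) = (x - t *+ k) - (y - t *+ j) - t *+ (q * j).
  rewrite mulrnDr opprD addrACA opprB -[RHS]addrA; congr (_ + _).
  have -> : (q * j = j + j * q.-1)%N by rewrite mulnC -{1}(prednK q_gt0) mulnS.
  by rewrite mulrnDr opprD addrA [t *+ j - y]addrC addrK.
apply: osubB; first exact: osubB.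
by rewrite mulrnA; exact: osubMn.
Qed.


End CyclicExtension.

Lemma pmult_cyc n t : pmult n (t *+ (p ^ n)).
Proof. by exists t. Qed.

Lemma expp_gt0 n : (0 < p ^ n)%N.
Proof. by rewrite expn_gt0 prime_gt0. Qed.

Lemma large_cyc (U : open_subgroup G) t n : pmult n `<=` U -> pmult n `<=` cyc_set U t.
Proof. by move=> nU; apply: subset_trans nU _; exact: sub_cyc. Qed.

(** The subgroup p^n G + Zt. Coefficients at these subgroups describe the image in the group ring of
    G modulo the closure of Zt, without forming that quotient. *)
Definition pcyc n t : open_subgroup G :=
  large_subgroup (cyc0 (pmult_sub n) t)
    (cycB (expp_gt0 n) (pmult_cyc n t : pmult_sub n (t *+ p ^ n)))
    (large_cyc (U := pmult_sub n) t (@subset_refl _ _)).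

Lemma pmult_pcyc n t : pmult n `<=` pcyc n t.
Proof. exact: (@sub_cyc (pmult_sub n)). Qed.

Lemma pcyc_le m n t : (m <= n)%N -> pcyc n t `<=` pcyc m t.
Proof. by move=> mn g [k hk]; exists k; exact: (pmult_le mn). Qed.

Lemma pcyc_mem n t : pcyc n t t.
Proof. by exists 1%N; rewrite mulr1n subrr; exact: pmult0. Qed.

Lemma elt_mul_coef t a (U : open_subgroup G) g : (cgr_elt Zp t * a) U g = a U (g - t).
Proof.
rewrite [LHS]/= /mul_coef /= /elt_coef.
rewrite (coset_sum_indic (U := U) t (F := fun y => a U (g - y))) //.
by move=> x y; exact: cgr_inv_sub.
Qed.

Lemma sum_coset_pick (W : open_subgroup G) h : exists2 w0, W (h - w0) &
  forall (M : zmodType) (F : G -> M), \sum_(w <- cosets W | `[< W (h - w) >]) F w = F w0.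
Proof.
have [us cs ss] := cosetsP W; have [w0 w0s hw0] := cs h; exists w0 => // M F.
rewrite big_mkcond (bigD1_seq w0) //= asboolT // big1_seq ?addr0 // => w /andP[/eqP ne ws].
case: asboolP => // hw; case: ne; apply: ss => //; apply: (osub_trans (y := h)) => //.
exact: osub_sym.
Qed.

(* The coefficients of [a] in G/<t> vanish, so modulo [t] - 1 every group element can
   be replaced by a representative of its <t>-coset. *)
Lemma cgr_ker_elt t a : (forall n g, (a (pcyc n t) g) n = 0) ->
  exists b, a = b * (cgr_elt Zp t - 1).
Proof.
move=> ha; suff [b _ /eqP] : gen [:: (cgr_elt Zp t - 1 : L)] a.
  by rewrite subr_eq0 => /eqP ->; exists b.
apply: (gen_closed cgr_profinite cgr_fil_ideal cgr_fil_sep) => n.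
set s := [:: _]; have is_ := gen_is_ideal s; have iF := cgr_fil_ideal n.
have iK := idsum_is_ideal is_ iF.
suff [y hy h] : idsum (gen s) (cgr_fil n) a by exists y.
have memK x : gen s x -> idsum (gen s) (cgr_fil n) x.
  by move=> hx; exists x => //; rewrite subrr; exact: id0.
have memF x : cgr_fil n x -> idsum (gen s) (cgr_fil n) x.
  by move=> hx; exists 0; [exact: id0 | rewrite subr0].
set l := cosets (pmult_sub n); set W := pcyc n t.
pose S1 : L := \sum_(h <- l) cgr_elt Zp h *+ coef_nat n a h.
pose S2 : L := \sum_(h <- l) (\sum_(w <- cosets W | `[< W (h - w) >]) cgr_elt Zp w)
  *+ coef_nat n a h.
have -> : a = (a - S1) + (S1 - S2) + S2 by rewrite addrA !subrK.
apply: (idD iK); first apply: (idD iK).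
- by apply: memF; exact: cgr_approx.
- rewrite /S1 /S2 -sumrB.
  apply: (big_ind (idsum (gen s) (cgr_fil n))) => [||h _]; [exact: id0|exact: idD|].
  rewrite -mulrnBl -mulr_natl; apply: (idM iK).
  have [w [k hk] ->] := sum_coset_pick W h.
  rewrite -(subrK (cgr_elt Zp (w + t *+ k)) (cgr_elt Zp h)) -addrA; apply: (idD iK).
    by apply: memF; apply: cgr_fil_elt; rewrite opprD addrA.
  apply: memK; rewrite cgr_eltD cgr_eltMn -[X in _ - X]mulr1 -mulrBr; apply: (idM is_).
  by rewrite subrX1 mulrC; apply: (idM is_); apply: mem_gen; rewrite inE.
- apply: memF; rewrite /S2.
  under eq_bigr do rewrite -sumrMnl big_mkcond.
  rewrite exchange_big /=.
  apply: (big_ind (cgr_fil n)) => [||w _]; [exact: id0|exact: idD|].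
  rewrite -big_mkcond /= sumrMnr; apply: cgr_fil_pMn; apply: natr_val0.
  rewrite natr_sum; have := ha n w; rewrite (cgr_compat a (U := pmult_sub n) (@pmult_pcyc n t)) => hw.
  have hd : (\sum_(h <- l | `[< W (h - w) >]) a (pmult_sub n) h -
      \sum_(h <- l | `[< W (h - w) >]) (coef_nat n a h)%:R) n = 0.
    rewrite -sumrB; elim/big_ind: _ => [|x y|h _]; first exact: zp_val0.
      exact: zp_valD0.
    exact: coef_natE.
  by move/zp_valB0: hd => <-.
Qed.

(** By hypothesis the order of t2 modulo [pcyc n t1] is p^n up to the bounded loss p^N. Invariance
    under t2 makes coefficients constant along ever longer orbits, so their sums are divisible by
    every power of p. *)
Lemma pcyc_orbit t1 t2 N b : (forall n k, pcyc n t1 (t2 *+ k) -> (p ^ n %| k * p ^ N)%N) ->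
  (forall n g, b (pcyc n t1) (g + t2) = b (pcyc n t1) g) ->
  forall n g, b (pcyc n t1) g = 0.
Proof.
move=> ht inv n g; apply: (zp_sep (p := p)) => m.
(* The factor p^n keeps t in [pcyc n t1]; the hypothesis at level M then makes the order q of t
   modulo [pcyc M t1] divisible by p^m. *)
pose M := (n + N + m)%N; pose t := t2 *+ p ^ n.
have nM : (n <= M)%N by rewrite /M -addnA leq_addr.
have ex : exists q, (0 < q)%N && `[< pcyc M t1 (t *+ q) >].
  exists (p ^ M)%N; rewrite expp_gt0 /=; apply/asboolP/pmult_pcyc; exact: pmult_cyc.
have [q /andP[q0 /asboolP hq] minq] := ex_minnP ex.
have qP k : pcyc M t1 (t *+ k) <-> (q %| k)%N.
  split=> [hk|/dvdnP[c ->]]; last by rewrite mulnC mulrnA; exact: osubMn.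
  rewrite /dvdn; apply: contrapT => /negP; rewrite -lt0n => r0.
  have : (k %% q < q)%N by rewrite ltn_mod.
  rewrite ltnNge => /negP; apply; apply: minq; rewrite r0 /=; apply/asboolP.
  have -> : t *+ (k %% q) = t *+ k - t *+ q *+ (k %/ q).
    by rewrite -[t *+ q *+ _]mulrnA {2}(divn_eq k q) [(q * _)%N]mulnC mulrnDr addrC addKr.
  by apply: (@osubB _ (pcyc M t1)) => //; exact: (@osubMn (pcyc M t1)).
have dvq : (p ^ m %| q)%N.
  have : (p ^ M %| q * p ^ n * p ^ N)%N.
    by apply: ht; rewrite mulnC mulrnA.
  by rewrite -mulnA -expnD {1}/M addnC expnD dvdn_pmul2r // expp_gt0.
pose W := large_subgroup (cyc0 (pcyc M t1) t) (cycB q0 hq)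
  (large_cyc (U := pcyc M t1) t (@pmult_pcyc M t1)).
have Wn : W `<=` pcyc n t1.
  move=> x [k hk]; rewrite -(subrK (t *+ k) x); apply: (osubD (U := pcyc n t1)).
    exact: (@pcyc_le n M t1 nM _ hk).
  by apply: osubMn; apply: pmult_pcyc; exact: pmult_cyc.
have invt x k : b (pcyc M t1) (x + t2 *+ k) = b (pcyc M t1) x.
  by elim: k => [|k IH]; rewrite ?mulr0n ?addr0 // mulrS addrCA addrC inv IH.
have hW : forall x, b W x = b (pcyc M t1) x *+ q.
  by apply: (orbit_coef q0 qP) => // x; exact: invt.
rewrite (cgr_compat b Wn); elim/big_ind: _ => [|x y|x _].
- exact: zp_val0.
- exact: zp_valD0.
- have /dvdnP[c ec] := dvq.
  by rewrite hW ec mulrnA -[_ *+ (p ^ m)]mulr_natl zp_val_pM.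
Qed.

(** Coefficients at [pcyc m t1] do not see multiples of [t1] - 1, so those of b are invariant under
    t2 and vanish by [pcyc_orbit]. *)
Lemma cgr_regular t1 t2 N b : (forall n k, pcyc n t1 (t2 *+ k) -> (p ^ n %| k * p ^ N)%N) ->
  (exists c, b * (cgr_elt Zp t2 - 1) = c * (cgr_elt Zp t1 - 1)) ->
  exists c, b = c * (cgr_elt Zp t1 - 1).
Proof.
move=> ht [c hc]; apply: cgr_ker_elt => n g.
suff -> : b (pcyc n t1) g = 0 by exact: zp_val0.
apply: (pcyc_orbit ht) => m x.
have e0 y : b (pcyc m t1) (y - t2) - b (pcyc m t1) y = 0.
  have := congr1 (fun z : L => z (pcyc m t1) y) hc.
  rewrite mulrC [in RHS]mulrC !mulrBl !mul1r.
  have subE (u v : L) : (u - v) (pcyc m t1) y = u (pcyc m t1) y - v (pcyc m t1) y by [].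
  rewrite !subE !elt_mul_coef => ->; apply/eqP; rewrite subr_eq0; apply/eqP.
  by apply: cgr_inv; rewrite addrAC subrr add0r; apply: osubN; exact: pcyc_mem.
by have /eqP := e0 (x + t2); rewrite addrK subr_eq0 => /eqP.
Qed.

Lemma cgr_regular0 t N b : (forall n k, pmult n (t *+ k) -> (p ^ n %| k * p ^ N)%N) ->
  b * (cgr_elt Zp t - 1) = 0 -> b = 0.
Proof.
move=> ht hb; have [n k [j]||c ->] := @cgr_regular 0 t N b.
- by rewrite mul0rn subr0; exact: ht.
- by exists 0; rewrite mul0r.
- by rewrite subrr mulr0.
Qed.

(** g is a limit of multiples of t, and the principal ideal of [t] - 1 is closed. *)
Lemma cgr_elt_mem_ideal (I : set L) t g : is_ideal I -> I (cgr_elt Zp t - 1) ->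
  (forall n, pcyc n t g) -> I (cgr_elt Zp g - 1).
Proof.
move=> iI It hg; apply: (@gen_sub _ [:: cgr_elt Zp t - 1] I iI).
  by move=> x; rewrite inE => /eqP ->.
apply: (gen_closed cgr_profinite cgr_fil_ideal cgr_fil_sep) => n.
have [k hk] := hg n; exists (cgr_elt Zp (t *+ k) - 1); last first.
  by rewrite opprB addrA subrK; exact: cgr_fil_elt.
rewrite cgr_eltMn subrX1 mulrC; apply: (idM (gen_is_ideal _)).
by apply: mem_gen; rewrite inE.
Qed.

End ZpGroups.

(** * Image and kernel of the map induced by a surjection of groups *)

Section Push.
Variables (p d d' : nat) (G G' : topAbGroup).
Hypothesis p_pr : prime p.
Local Notation Zp := (padic_int p).
Variables (c : zp_chart p d G) (c' : zp_chart p d' G').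
Variable r : cont_hom G G'.
Hypothesis r_surj : forall y, exists x, r x = y.

Lemma cont_homMn x n : r (x *+ n) = r x *+ n.
Proof.
elim: n => [|n IH]; first by rewrite !mulr0n cont_hom0.
have rN y : r (- y) = - r y by rewrite -(sub0r y) cont_homB cont_hom0 sub0r.
by rewrite !mulrS -(opprK (x *+ n)) cont_homB rN opprK IH.
Qed.

Lemma push_elt g : cgr_push r (cgr_elt Zp g) = cgr_elt Zp (r g).
Proof.
apply: cgr_eq => V x; rewrite [LHS]/= /push_coef sum_indic /= /elt_coef.
under eq_bigr do rewrite mulrC.
rewrite (coset_sum_indic (U := osub_preim r V) g (F := fun h => Defs.indic Zp (V (r h - x)))).
  by apply: Defs.indicE; split; exact: osub_sym.
move=> y z; rewrite /= /osub_fun /= cont_homB => yz.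
by apply: Defs.indicE; split; apply: osub_shift_l => //; exact: osub_sym.
Qed.

Lemma push_fil n (a : cgr Zp G) : cgr_fil p_pr c n a -> cgr_fil p_pr c' n (cgr_push r a).
Proof.
move=> ha g; rewrite /= /push_coef; elim/big_ind: _ => [|x y|h _].
- exact: zp_val0.
- exact: zp_valD0.
- by apply: cgr_fil_coef ha => x [y ->]; exists (r y); exact: cont_homMn.
Qed.

(** Each truncation of b lifts by lifting group elements; compactness assembles the lifts. *)
Lemma push_surj (b : cgr Zp G') : exists a, cgr_push r a = b.
Proof.
have iF' := cgr_fil_ideal p_pr c'.
have [n|n a|n a a1 ha aa|a ha] := profinite_compact (cgr_profinite p_pr c)
    (C := fun n => [set a | cgr_fil p_pr c' n (b - cgr_push r a)]).
- have /choice[s hs] := r_surj; set l := cosets (pmult_sub p_pr c' n).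
  exists (\sum_(h <- l) cgr_elt Zp (s h) *+ coef_nat p_pr c' n b h).
  rewrite /= rmorph_sum /= (eq_bigr (fun h => cgr_elt Zp h *+ coef_nat p_pr c' n b h)).
    exact: cgr_approx.
  by move=> h _; rewrite rmorphMn /= push_elt hs.
- exact: cgr_filS.
- rewrite /= -(subrK (cgr_push r a) b) -addrA; apply: (idD (iF' n)) => //.
  by rewrite -rmorphB; exact: push_fil.
- by exists a; apply/esym/eqP; rewrite -subr_eq0; apply/eqP/(cgr_fil_sep (p_pr := p_pr) (c0 := c')).
Qed.

Variable sg : G.
Hypothesis r_sg : r sg = 0.
Hypothesis r_ker : forall x, r x = 0 -> forall n, pcyc p_pr c n sg x.

(** For P = r^-1(p^m G'), r identifies cosets of P with cosets of p^m G', so a and its image have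
    the same coefficients there; and P lies in [pcyc m sg], where [cgr_ker_elt] applies. *)
Lemma push_ker (a : cgr Zp G) : cgr_push r a = 0 <-> exists b, a = b * (cgr_elt Zp sg - 1).
Proof.
split=> [ra|[b ->]]; last first.
  by rewrite rmorphM rmorphB /= push_elt r_sg rmorph1 subrr mulr0.
apply: (cgr_ker_elt (p_pr := p_pr) (c0 := c)) => m g.
suff -> : a (pcyc p_pr c m sg) g = 0 by exact: zp_val0.
pose P := osub_preim r (pmult_sub p_pr c' m).
have PW : P `<=` pcyc p_pr c m sg.
  move=> x [y ey]; have [z ez] := r_surj y.
  rewrite -(subrK (z *+ p ^ m) x); apply: (osubD (U := pcyc p_pr c m sg)).
    by apply: r_ker; rewrite cont_homB cont_homMn ez -ey subrr.
  by apply: pmult_pcyc; exact: pmult_cyc.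
rewrite (cgr_compat a PW) big1 // => h _.
transitivity (push_coef r a (pmult_sub p_pr c' m) (r h)); last first.
  exact: (congr1 (fun z : cgr Zp G' => z (pmult_sub p_pr c' m) (r h)) ra).
rewrite /push_coef -/P.
rewrite -[LHS](coset_sum_indic (U := P) h (F := a P)); last by move=> x y; exact: cgr_inv.
rewrite sum_indic; apply: eq_bigr => w _; congr (_ * _); apply: Defs.indicE.
by rewrite -cont_homB.
Qed.

End Push.

(** * Subextensions *)

Section PadicLinearAlgebra.
Variable p : nat.
Hypothesis p_pr : prime p.
Local Notation Zp := (padic_int p).

(** Additivity alone suffices: writing a = k + p^s z with k natural, the defect f (a v) - a f v is
    divisible by p^s, for every s. *)
Lemma zp_additive_scale m n (f : 'cV[Zp]_m -> 'cV[Zp]_n) : zmod_morphism f ->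
  forall a v, f (a *: v) = a *: f v.
Proof.
move=> fB a v.
have f0 : f 0 = 0 by rewrite -(subrr 0) fB subrr.
have fN w : f (- w) = - f w by rewrite -(sub0r w) fB f0 sub0r.
have fMn w k : f (w *+ k) = f w *+ k.
  elim: k => [|k IH]; first by rewrite !mulr0n.
  by rewrite !mulrS -(opprK (w *+ k)) fB fN opprK IH.
apply/colP => j; apply/eqP; rewrite -subr_eq0; apply/eqP/(zp_sep (p := p)) => s.
have [k hk] := zp_val_nat_eq p_pr a s; have [z ez] := zp_divide p_pr hk.
have ea : a = k%:R + (p ^ s)%N%:R * z by rewrite -ez addrC subrK.
have -> : f (a *: v) j 0 - (a *: f v) j 0 = (f (a *: v) - a *: f v) j 0 by rewrite !mxE.
have -> : f (a *: v) = k%:R *: f v + (p ^ s)%N%:R *: f (z *: v).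
  rewrite ea scalerDl -scalerA !scaler_nat -(opprK (z *: v *+ _)) fB fN opprK !fMn.
  by [].
rewrite ea scalerDl opprD addrACA subrr add0r -scalerA -scalerBr mxE.
exact: zp_val_pM.
Qed.

Lemma zp_additive_mx m n (f : 'cV[Zp]_m -> 'cV[Zp]_n) : zmod_morphism f ->
  exists A : 'M[Zp]_(n, m), forall v, f v = A *m v.
Proof.
move=> fB; have fZ := zp_additive_scale fB.
pose F : {linear 'cV[Zp]_m -> 'cV[Zp]_n} := HB.pack f
  (GRing.isZmodMorphism.Build _ _ f fB) (GRing.isScalable.Build _ _ _ *:%R f fZ).
exists (\matrix_(i, j) f (delta_mx j 0) i 0) => v.
have -> : f v = F (\sum_j v j 0 *: delta_mx j 0).
  congr f; apply/colP => j; rewrite summxE (bigD1 j) //= big1 ?addr0.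
    by rewrite !mxE !eqxx mulr1.
  by move=> k /negPf kj; rewrite !mxE eq_sym kj mulr0.
rewrite linear_sum; apply/colP => i; rewrite summxE mxE; apply: eq_bigr => j _.
by rewrite linearZ /= !mxE mulrC.
Qed.

Lemma det_val n (A B : 'M[Zp]_n) k : (forall i j, A i j k = B i j k) ->
  (\det A) k = (\det B) k.
Proof.
move=> h; have hD (x y x' y' : Zp) : x k = x' k -> y k = y' k -> (x + y) k = (x' + y') k.
  by move=> e e'; rewrite /= e e'.
have hM (x y x' y' : Zp) : x k = x' k -> y k = y' k -> (x * y) k = (x' * y') k.
  by move=> e e'; rewrite /= e e'.
rewrite /determinant.
apply: (big_ind2 (fun x y : Zp => x k = y k)) => [//|x x' y y'|s _]; first exact: hD.
apply: (hM) => //.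
apply: (big_ind2 (fun x y : Zp => x k = y k)) => [//|x x' y y'|j _]; first exact: hM.
exact: h.
Qed.

Lemma mx_inverse n (A : 'M[Zp]_n) : (\det A) 1%N != 0 ->
  exists B, A *m B = 1%:M /\ B *m A = 1%:M.
Proof.
move=> /(zp_unit p_pr)[u eu]; exists (u *: \adj A).
rewrite -scalemxAr -scalemxAl mul_mx_adj mul_adj_mx scale_scalar_mx mulrC eu.
by [].
Qed.

Lemma zp1_neq0 : (1 : Zp) 1%N != 0.
Proof. by apply: (zp_unit_val p_pr (y := 1)); rewrite mulr1. Qed.

(** Preimages modulo p of the basis vectors form a V with A V congruent to 1 modulo p, hence of unit
    determinant. *)
Lemma mx_right_inverse m n (A : 'M[Zp]_(n, m)) :
  (forall w : 'cV[Zp]_n, exists v : 'cV[Zp]_m, forall j, (A *m v) j 0 1%N = w j 0 1%N) ->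
  exists B, A *m B = 1%:M.
Proof.
move=> h; have /choice[v hv] : forall j : 'I_n, exists v : 'cV[Zp]_m,
    forall i, (A *m v) i 0 1%N = (delta_mx j 0 : 'cV[Zp]_n) i 0 1%N by move=> j; exact: h.
pose V := \matrix_(i, j) v j i 0.
have [|C [eC _]] := @mx_inverse n (A *m V); last first.
  by exists (V *m C); rewrite mulmxA.
rewrite (@det_val _ _ 1%:M) ?det1 ?zp1_neq0 // => i j.
have -> : (A *m V) i j = (A *m v j) i 0.
  by rewrite !mxE; apply: eq_bigr => k _; rewrite mxE.
by rewrite hv !mxE andbT.
Qed.

(* 1 - BA is idempotent of trace 1, so it has a unit diagonal entry; this makes A,
   completed by the corresponding coordinate, invertible. *)
Lemma mx_kernel_line n (A : 'M[Zp]_(n, n + 1)) B : A *m B = 1%:M ->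
  exists s : 'cV[Zp]_(n + 1), A *m s = 0 /\
    forall v, A *m v = 0 -> exists a, v = a *: s.
Proof.
move=> AB; pose E := 1%:M - B *m A.
have trE : \tr E = 1.
  by rewrite linearB /= mxtrace_mulC AB !mxtrace1 natrD addrC addKr.
have [k hk] : exists k, E k k 1%N != 0.
  apply: contrapT => hn; have /eqP := zp1_neq0; apply; rewrite -trE /mxtrace.
  elim/big_ind: _ => [|x y|k _]; [exact: zp_val0|exact: zp_valD0|].
  by apply: contrapT => /eqP h; apply: hn; exists k.
pose l : 'rV[Zp]_(n + 1) := delta_mx 0 k; pose w : 'cV[Zp]_(n + 1) := delta_mx k 0.
pose C := col_mx A l.
(* Block elimination leaves the Schur complement l E w, the chosen diagonal entry of E. *)
have detC : \det C * \det (row_mx B w) = E k k.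
  rewrite -det_mulmx /C mul_col_row AB.
  have -> : block_mx 1%:M (A *m w) (l *m B) (l *m w) =
      block_mx 1%:M 0 (l *m B) 1%:M *m block_mx 1%:M (A *m w) 0 (l *m E *m w).
    rewrite mulmx_block !mul1mx ?mul0mx ?mulmx1 ?mulmx0 ?addr0 /E.
    congr block_mx.
    by rewrite mulmxBr mulmx1 mulmxBl !mulmxA addrC subrK.
  rewrite det_mulmx det_lblock det_ublock !det1 !mul1r det_mx11.
  rewrite -rowE -colE !mxE; by [].
have [|C' [CC' C'C]] := @mx_inverse _ C.
  have [u eu] := zp_unit p_pr hk.
  by apply: (zp_unit_val p_pr (y := \det (row_mx B w) * u)); rewrite mulrA detC.
exists (C' *m col_mx 0 1%:M).
have Cs : C *m (C' *m col_mx 0 1%:M) = col_mx 0 (1%:M : 'M[Zp]_1).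
  by rewrite mulmxA CC' mul1mx.
split.
  by move: Cs; rewrite {1}/C mul_col_mx => /eq_col_mx[].
move=> v Av; exists ((l *m v) 0 0).
rewrite scalemxAr scale_col_mx scaler0 scale_scalar_mx mulr1.
rewrite -[LHS]mul1mx -C'C -mulmxA; congr (_ *m _).
by rewrite /C mul_col_mx Av -mx11_scalar.
Qed.

End PadicLinearAlgebra.

Section RestrictionSurjective.
Variables (p d i : nat) (k : fieldType) (K : zp_ext p d k) (L : zp_subext i K).

Lemma conjugates_finite (l : seq L) : exists s : seq (seq L),
  forall t : gal_group L, map t l \in s.
Proof.
elim: l => [|x l [s hs]]; first by exists [:: [::]] => t; rewrite inE.
have [algL _] := ext_galois L; have [q q0 rq] := algL x.
have [r hr] : exists r : seq L, forall y, root (map_poly (ext_in L) q) y -> y \in r.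
  by apply: poly_roots; rewrite map_poly_eq0.
exists [seq y :: m | y <- r, m <- s] => t /=.
apply/allpairsP; exists (t x, map t l); split=> //=.
apply: hr; rewrite -(eq_map_poly (aut_base t)) map_poly_comp.
exact: rmorph_root.
Qed.

Lemma restrD (s t : gal_group K) x : restr L (s + t) x = restr L s (restr L t x).
Proof.
apply: (fmorph_inj (sub_emb L)).
by rewrite /= !restr_funE.
Qed.

Lemma restr_fixed (x : L) : (forall s : gal_group K, restr L s x = x) ->
  exists a, x = ext_in L a.
Proof.
move=> h; have [_ fixK] := ext_galois K.
have [s|a ea] := fixK (sub_emb L x); first by rewrite -restr_funE; congr (sub_emb L _); exact: (h s).
by exists a; apply: (fmorph_inj (sub_emb L)); rewrite sub_embE.
Qed.

(* The product of the Y - w(theta), w in the image of the restriction and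
   theta = Poly l, has coefficients in k, so it is fixed by any t, which must then
   permute its roots. *)
Lemma restr_dense (t : gal_group L) (l : seq L) :
  exists s : gal_group K, {in l, restr L s =1 t}.
Proof.
have [c hc] := conjugates_finite l.
pose orb := undup [seq m <- c | `[< exists s : gal_group K, m = map (restr L s) l >]].
have orbP m : (m \in orb) <-> exists s : gal_group K, m = map (restr L s) l.
  rewrite mem_undup mem_filter; split=> [/andP[/asboolP//]|[s ->]].
  by apply/andP; split; [apply/asboolP; exists s | exact: hc].
have l_orb : l \in orb.
  apply/orbP; exists 0; rewrite -[LHS]map_id; apply: eq_map => x.
  by apply: (fmorph_inj (sub_emb L)); rewrite /= restr_funE.
pose act (u : gal_group L) := map_poly (map_poly (aut_fun u)).
(* Encoding a tuple as a polynomial turns simultaneous agreement on l into a single root, in place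
   of a primitive element. *)
pose P : {poly {poly L}} := \prod_(m <- orb) ('X - (Poly m)%:P).
have actP (u : gal_group L) : act u P = \prod_(m <- map (map u) orb) ('X - (Poly m)%:P).
  rewrite /act /P rmorph_prod big_map; apply: eq_bigr => m _.
  rewrite rmorphB /= map_polyX map_polyC /=; congr (_ - _%:P).
  apply/polyP => n; rewrite coef_map !coef_Poly /=.
  have [nm|nm] := ltnP n (size m); first by rewrite (nth_map 0).
  by rewrite !nth_default ?size_map // rmorph0.
have fixP (s : gal_group K) : act (restr L s) P = P.
  rewrite actP; apply: perm_big; apply: uniq_perm; rewrite ?undup_uniq //.
    rewrite map_inj_uniq ?undup_uniq //; apply: inj_map; exact: aut_inj.
  have sub : {subset map (map (restr L s)) orb <= orb}.
    move=> y /mapP[m /orbP[u ->] ->]; apply/orbP; exists (s + u).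
    by rewrite -map_comp; apply: eq_map => x; exact: (esym (restrD s u x)).
  have um : uniq (map (map (restr L s)) orb).
    by rewrite map_inj_uniq ?undup_uniq //; apply: inj_map; exact: aut_inj.
  by have [] := uniq_min_size um sub; rewrite ?size_map.
have tP : act t P = P.
  apply/polyP => a; rewrite coef_map; apply/polyP => b; rewrite coef_map /=.
  have [s|y ->] := restr_fixed (x := P`_a`_b); last exact: aut_base.
  by rewrite -{2}(fixP s) /act coef_map coef_map.
have : root P (Poly (map t l)).
  by rewrite -tP actP -(big_map Poly xpredT (fun q => 'X - q%:P)) root_prod_XsubC !map_f.
rewrite /P -(big_map Poly xpredT (fun q => 'X - q%:P)) root_prod_XsubC.
move=> /mapP[m /orbP[s ->] e]; exists s => x /(nthP 0)[n nl <-].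
have := congr1 (fun q : {poly L} => q`_n) e.
by rewrite !coef_Poly !(nth_map 0).
Qed.

End RestrictionSurjective.

Lemma top_iso_chart (p d : nat) (G : topAbGroup) (e : 'cV[padic_int p]_d -> G) :
  is_top_iso e -> exists c : zp_chart p d G, e = c.
Proof. by move=> [e' [eB eK e'K ce ce']]; exists (ZpChart eB eK e'K ce ce'). Qed.

Lemma gal_chart (p d : nat) (k : fieldType) (K : zp_ext p d k) :
  exists e : 'cV[padic_int p]_d -> gal_group K, is_top_iso e.
Proof.
have [e [e' [eD eK e'K ce ce']]] := ext_iso K; exists e; exists e'; split=> // u v.
have h : (e (u - v) : gal_group K) + (e v : gal_group K) = (e u : gal_group K).
  exact: (esym (etrans (congr1 e (esym (subrK v u))) (eD _ _))).
by rewrite -[in RHS]h addrK.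
Qed.

Section Subextension.
Variables (p i : nat) (k : fieldType) (K : zp_ext p (i + 1) k) (L : zp_subext i K).
Hypothesis p_pr : prime p.
Local Notation Zp := (padic_int p).
Variables (c : zp_chart p (i + 1) (gal_group K)) (cL : zp_chart p i (gal_group L)).

Lemma relative_galP g : relative_gal L g <-> restr L g = 0.
Proof.
split=> [h|h x]; last first.
  by rewrite -(restr_funE g x); congr (sub_emb L _); exact: (congr1 (fun t : gal_group L => t x) h).
apply: aut_eq => x; apply: (fmorph_inj (sub_emb L)).
by rewrite [LHS]restr_funE; exact: h.
Qed.

Lemma chart_scale (a : Zp) v n m : (a - m%:R) n = 0 -> pmult p n (c (a *: v) - c v *+ m).
Proof.
move=> h; rewrite -iso_morMn -chartB -scaler_nat -scalerBl; apply/(pmultP p_pr) => j.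
by rewrite mxE mulrC zp_valM0.
Qed.

(** Density of the restrictions gives surjectivity of A modulo p, which already provides a right
    inverse; the kernel is then a line. *)
Lemma restr_structure : exists (A : 'M[Zp]_(i, i + 1)) (s : 'cV[Zp]_(i + 1)),
  [/\ forall v, restr L (c v) = cL (A *m v),
      forall w : 'cV[Zp]_i, exists v : 'cV[Zp]_(i + 1), A *m v = w, A *m s = 0 &
      forall v : 'cV[Zp]_(i + 1), A *m v = 0 -> exists a, v = a *: s].
Proof.
have [|A hA] := @zp_additive_mx p p_pr _ _ (fun v => unchart cL (restr L (c v))).
  move=> u v; apply: (can_inj (@chartK _ _ _ cL)).
  by rewrite (@chartB _ _ _ cL) !unchartK (@chartB _ _ _ c); exact: restr_zmod_morphism.
have rA v : restr L (c v) = cL (A *m v) by rewrite -hA unchartK.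
have [|B AB] := @mx_right_inverse p p_pr _ _ A.
  move=> w.
  have : nbhs (cL w) [set t | forall j, unchart cL t j 0 1%N = w j 0 1%N].
    have h : nbhs (cL w) (unchart cL @^-1`
        [set v : 'cV[Zp]_i | forall j, v j 0 1%N = unchart cL (cL w) j 0 1%N]).
      exact: (@unchart_continuous _ _ _ cL (cL w) _ (nbhs_cv _ 1)).
    by apply: filterS h => t /= ht j; rewrite ht chartK.
  rewrite nbhsE => -[U [oU Uw] hU].
  have [l hl] := (oU : krull_open U) _ Uw.
  have [s hs] := restr_dense (cL w) l.
  exists (unchart c s) => j; rewrite -hA unchartK.
  by apply: hU; apply: hl => x xl; exact: hs.
have [s [As hs]] := mx_kernel_line p_pr AB.
exists A, s; split=> // w; exists (B *m w); by rewrite mulmxA AB mul1mx.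
Qed.

End Subextension.

(** * Null sets of hyperplanes *)

Section Forms.
Variable p : nat.
Hypothesis p_pr : prime p.
Local Notation Zp := (padic_int p).

(** A rank dichotomy without elementary divisors, by induction on the first coordinate: if h in H
    has first coordinate a != 0, combinations a w - b h reduce H to vectors with first coordinate
    0. *)
Lemma full_or_form d (H : submod 'cV[Zp]_d) :
  (exists N, forall v, H ((p ^ N)%N%:R *: v)) \/
  (exists2 l : 'rV[Zp]_d, l != 0 & forall v, H v -> l *m v = 0).
Proof.
elim: d H => [|d IH] H.
  by left; exists 0%N => v; rewrite [_ *: _]flatmx0; exact: submod0.
rewrite -[d.+1]/(1 + d)%N in H *.
have [allz|/existsNP[h /not_implyP[Hh h0]]] :=
    pselect (forall v : 'cV[Zp]_(1 + d), H v -> usubmx v = 0).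
  right; exists (row_mx 1%:M 0 : 'rV[Zp]_(1 + d)).
    apply/eqP => /(congr1 (fun l : 'rV[Zp]_(1 + d) => lsubmx l 0 0)).
    rewrite row_mxKl linear0 !mxE /= => /(congr1 (fun x : Zp => x 1%N)) e.
    by have := zp1_neq0 p_pr; rewrite [X in X != _]e zp_val0 eqxx.
  move=> v /allz e; rewrite -[v](@vsubmxK _ 1 d 1) mul_row_col e mulmx0 mul0mx addr0.
  by [].
pose a : Zp := usubmx (h : 'cV[Zp]_(1 + d)) 0 0.
have eh : h = col_mx a%:M (dsubmx (h : 'cV[Zp]_(1 + d))).
  by rewrite -mx11_scalar vsubmxK.
have a0 : a != 0.
  by apply/eqP => ea; apply: h0; rewrite [LHS]mx11_scalar -/a ea raddf0.
set h' := dsubmx _ in eh.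
have H0 : H (col_mx (0 : 'cV[Zp]_1) (0 : 'cV[Zp]_d)) by rewrite col_mx0; exact: submod0.
have HD x y : H (col_mx (0 : 'cV[Zp]_1) x) -> H (col_mx 0 y) -> H (col_mx 0 (x + y : 'cV[Zp]_d)).
  by move=> hx hy; rewrite -[X in col_mx X _](addr0 0) -add_col_mx; exact: submodD.
have HZ b x : H (col_mx (0 : 'cV[Zp]_1) x) -> H (col_mx 0 (b *: x : 'cV[Zp]_d)).
  by move=> hx; rewrite -[X in col_mx X _](scaler0 _ b) -scale_col_mx; exact: submodZ.
pose H' : submod 'cV[Zp]_d := @Submod _ _ [set v | H (col_mx 0 v)] H0 HD HZ.
have [[N hN]|[l l0 hl]] := IH H'; [left|right].
  have [m [u [eu u1]]] := zp_factor p_pr a0.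
  have [u' uu'] := zp_unit p_pr u1.
  have H1 : H (col_mx ((p ^ (N + m))%N%:R%:M : 'cV[Zp]_1) (0 : 'cV[Zp]_d)).
    have -> : col_mx ((p ^ (N + m))%N%:R%:M : 'cV[Zp]_1) (0 : 'cV[Zp]_d) =
        u' *: ((p ^ N)%N%:R *: h - col_mx 0 ((p ^ N)%N%:R *: h')).
      rewrite eh scale_col_mx opp_col_mx add_col_mx subrr subr0 !scale_col_mx scaler0.
      rewrite !scale_scalar_mx eu; congr (col_mx _%:M _).
      by rewrite expnD natrM [RHS]mulrC -!mulrA uu' mulr1.
    by apply: submodZ; apply: submodB; [exact: submodZ | exact: hN].
  exists (N + m)%N => v; rewrite -[v](@vsubmxK _ 1 d 1).
  suff -> : (p ^ (N + m))%N%:R *: col_mx (usubmx (v : 'cV[Zp]_(1 + d))) (dsubmx (v : 'cV[Zp]_(1 + d))) =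
      (usubmx (v : 'cV[Zp]_(1 + d)) 0 0) *: col_mx ((p ^ (N + m))%N%:R%:M : 'cV[Zp]_1) (0 : 'cV[Zp]_d) +
      col_mx (0 : 'cV[Zp]_1) ((p ^ N)%N%:R *: ((p ^ m)%N%:R *: dsubmx (v : 'cV[Zp]_(1 + d)))).
    by apply: submodD; [exact: submodZ | exact: hN].
  rewrite !scale_col_mx add_col_mx addr0 scaler0 add0r scalerA -natrM -expnD.
  by rewrite {1}[usubmx v]mx11_scalar !scale_scalar_mx mulrC.
(* At w this form is l (a w' - b h'), the value of l on the reduction of a w - b h. *)
exists (row_mx (- (l *m h')) (a *: l)).
  apply/eqP => e; move/eqP: l0; apply; apply/rowP => j; rewrite [RHS]mxE.
  have := congr1 (fun x : 'rV[Zp]_(1 + d) => rsubmx x 0 j) e.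
  rewrite row_mxKr [RHS]mxE mxE [RHS]mxE => /(zp_domain p_pr)[ea|//].
  by move: a0; rewrite ea eqxx.
move=> w Hw; pose b : Zp := usubmx (w : 'cV[Zp]_(1 + d)) 0 0.
have ew : w = col_mx b%:M (dsubmx (w : 'cV[Zp]_(1 + d))).
  by rewrite -mx11_scalar vsubmxK.
set w' := dsubmx _ in ew.
have : H' (a *: w' - b *: h').
  have e : a *: w - b *: h = col_mx (0 : 'cV[Zp]_1) (a *: w' - b *: h').
    rewrite ew [in LHS]eh !scale_col_mx opp_col_mx add_col_mx !scale_scalar_mx.
    by rewrite mulrC subrr.
  suff : H (a *: w - b *: h) by rewrite e.
  by apply: submodB; exact: submodZ.
move=> /hl; rewrite mulmxBr -!scalemxAr => e.
rewrite ew mul_row_col -scalemxAl mulNmx.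
by rewrite [_ *m b%:M]mul_mx_scalar addrC.
Qed.

End Forms.

Section BoundedMultiplicity.
Import Order.TTheory Num.Theory.
Local Open Scope ereal_scope.
Variables (dd : measure_display) (T : measurableType dd) (R : realType).
Variables (mu : probability T R) (A : nat -> set T) (D : nat) (x : \bar R).
Hypotheses (mA : forall a, measurable (A a)) (muA : forall a, mu (A a) = x).
Hypothesis multA : forall t n, (count (fun a => `[< A a t >]) (iota 0 n) <= D)%N.

(** Integrating the number of sets A a, a < n, through a point gives n x <= D for all n. *)
Lemma measure0_bounded_multiplicity : x = 0.
Proof.
have bound n : n%:R%:E * x <= D%:R%:E.
  have -> : n%:R%:E * x = \int[mu]_(t in setT) (\sum_(a <- iota 0 n) (\1_(A a) t)%:E).
    rewrite ge0_integral_sum //; last 1 first.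
    - move=> a; apply/measurable_EFinP; exact: measurable_indic.
    rewrite (eq_bigr (fun=> x)); last first.
      by move=> a _; rewrite integral_indic // setIT; exact: muA.
    by rewrite big_const_seq count_predT size_iota mule_natl -Monoid.iteropE.
  have -> : D%:R%:E = \int[mu]_(t in setT) (cst (D%:R%:E : \bar R) t).
    rewrite integral_cst // -[LHS]mule1; congr (_ * _); apply/esym; exact: probability_setT.
  apply: ge0_le_integral => //.
  - by move=> t _; apply: sume_ge0 => a _; rewrite lee_fin.
  - apply: emeasurable_sum => a; apply/measurable_EFinP; exact: measurable_indic.
  - move=> t _; rewrite /cst sumEFin lee_fin (_ : (\sum_(a <- _) _)%R =
      (count (fun a => `[< A a t >]) (iota 0 n))%:R) ?ler_nat //.
    rewrite -sum1_count natr_sum [in RHS]big_mkcond /=; apply: eq_bigr => a _.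
    rewrite indicE; case: asboolP => h; first by rewrite mem_set.
    by rewrite memNset.
have x0 : 0 <= x by rewrite -(muA 0).
have x1 : x <= 1 by rewrite -(muA 0); exact: probability_le1.
have [r er] : exists r : R, x = r%:E.
  by exists (fine x); rewrite fineK // ge0_fin_numE // (le_lt_trans x1) // ltry.
move: x0 bound; rewrite er lee_fin => r0 bound; congr EFin; apply/eqP.
rewrite eq_le r0 andbT leNgt; apply/negP => rp.
have := bound (Num.bound (D%:R / r)%R); rewrite -EFinM lee_fin leNgt => /negP; apply.
by rewrite -ltr_pdivrMr // archi_boundP // divr_ge0.
Qed.

End BoundedMultiplicity.

(** * Haar measure of a hyperplane condition *)

Section HyperplaneNull.
Variables (p d : nat).
Hypothesis p_pr : prime p.
Local Notation Zp := (padic_int p).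
Variables (R : realType) (mu : probability (Borel (GL p d)) R).
Hypothesis haar : is_haar mu.
Variable e : 'cV[Zp]_d.

Definition vanishing (l : 'rV[Zp]_d) : set (GL p d) := [set g | l *m (GL_mx g *m e) = 0].

Lemma nbhs_GL (g : GL p d) n : nbhs g [set h | forall i j, GL_mx h i j n = GL_mx g i j n].
Proof.
have : nbhs (set_val g) [set h : 'M[Zp]_d | forall i j, h i j n = GL_mx g i j n].
  exists (fun i j => [set y : Zp | y n = GL_mx g i j n]) => [i j|h hh i j]; last exact: hh.
  exact: nbhs_zp.
exact: (@initial_continuous _ _ (set_val : GL p d -> 'M[Zp]_d) g).
Qed.

Lemma open_not_vanishing l : open (~` vanishing l).
Proof.
rewrite openE => g /= hg.
have [n hn] : exists n, (l *m (GL_mx g *m e)) 0 0 n != 0.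
  apply: contrapT => h; apply: hg; rewrite /vanishing /=; apply/matrixP => i j.
  rewrite !ord1 [RHS]mxE; apply: (zp_sep (p := p)) => n.
  by apply: contrapT => /eqP hn; apply: h; exists n.
apply: filterS (nbhs_GL g n) => h /= hh e0; move: hn.
suff -> : (l *m (GL_mx g *m e)) 0 0 n = (l *m (GL_mx h *m e)) 0 0 n.
  by rewrite e0 mxE zp_val0 eqxx.
have hD (x y x' y' : Zp) : x n = x' n -> y n = y' n -> (x + y) n = (x' + y') n.
  by move=> ex ey; rewrite /= ex ey.
have hM (x y x' y' : Zp) : x n = x' n -> y n = y' n -> (x * y) n = (x' * y') n.
  by move=> ex ey; rewrite /= ex ey.
rewrite !mxE; apply: (big_ind2 (fun x y : Zp => x n = y n)) => [//|x x' y y'|i _].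
  exact: hD.
apply: (hM) => //; rewrite !mxE.
apply: (big_ind2 (fun x y : Zp => x n = y n)) => [//|x x' y y'|j _].
  exact: hD.
by apply: hM => //; rewrite hh.
Qed.

Lemma measurable_vanishing l : measurable (vanishing l : set (Borel (GL p d))).
Proof.
rewrite -[vanishing l]setCK; apply: measurableC.
by apply: sub_sigma_algebra; exact: open_not_vanishing.
Qed.

Lemma translate_vanishing (h : GL p d) l l' : l = l' *m GL_mx h ->
  mu (vanishing l) = mu (vanishing l').
Proof.
move=> el; rewrite -(haar h (measurable_vanishing l)); congr (mu _).
have GLmul (a b : GL p d) : GL_mx (GL_mul a b) = GL_mx a *m GL_mx b by rewrite GL_mkK.
apply/seteqP; split=> [g [g' hg' <-]|g hg].
  by rewrite /vanishing /= GLmul -mulmxA mulmxA -el.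
have [h1 [hh1 h1h]] := GL_mxP h.
have Gh1 : GL_set h1 by exists (GL_mx h).
pose g' := GL_mul (GL_mk Gh1) g.
have eg : GL_mul h g' = g.
  apply: val_inj; rewrite -!set_valE -!/(GL_mx _) !GLmul GL_mkK mulmxA hh1 mul1mx.
  by [].
exists g' => //; rewrite /vanishing /= el.
have -> : GL_mx g' = h1 *m GL_mx g by rewrite GLmul GL_mkK.
rewrite -(mulmxA l') (mulmxA (GL_mx h)) (mulmxA (GL_mx h) h1) hh1 mul1mx.
exact: hg.
Qed.

(** Points of the moment curve: any d of them are independent, and the leading entry 1 makes each
    primitive. *)
Definition vrow (a : nat) : 'rV[Zp]_d := \row_j a%:R ^+ j.

(** The Sherman-Morrison inverse, with u the inverse of 1 + y x. *)
Lemma rank_one_GL (x : 'cV[Zp]_d) (y : 'rV[Zp]_d) u :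
  (1 + (y *m x) 0 0) * u = 1 -> GL_set (1%:M + x *m y).
Proof.
move=> hu; set s := (y *m x) 0 0 in hu.
have xyxy : (x *m y) *m (x *m y) = s *: (x *m y).
  by rewrite mulmxA -(mulmxA x) [y *m x]mx11_scalar -/s mul_mx_scalar -scalemxAl.
have inv1 : (1%:M + x *m y) *m (1%:M - u *: (x *m y)) = 1%:M.
  rewrite mulmxBr mulmx1 -scalemxAr mulmxDl mul1mx xyxy -addrA -[RHS]addr0.
  congr (_ + _); rewrite -{1 2}[x *m y]scale1r -scalerDl scalerA -scalerBl.
  by rewrite mulrC hu subrr scale0r.
exists (1%:M - u *: (x *m y)); split=> //; exact: mulmx1C.
Qed.

(** If vrow a x = 1, the matrix 1 + x (l - vrow a) carries vrow a to l; it is invertible once l x is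
    a unit. *)
Lemma vrow_transitive (l : 'rV[Zp]_d) k a : l 0 k 1%N != 0 ->
  exists h : GL p d, l = vrow a *m GL_mx h.
Proof.
move=> lk; have d0 : (0 < d)%N by exact: leq_ltn_trans (ltn_ord k).
pose o := Ordinal d0.
suff [x [mx lx]] : exists x : 'cV[Zp]_d, (vrow a *m x) 0 0 = 1 /\ (l *m x) 0 0 1%N != 0.
  have [u hu] := zp_unit p_pr lx.
  have [|h2 hh2] := @rank_one_GL x (l - vrow a) u.
    have -> : ((l - vrow a) *m x) 0 0 = (l *m x) 0 0 - (vrow a *m x) 0 0.
      by rewrite mulmxBl mxE [X in _ + X]mxE.
    by rewrite mx addrC subrK.
  have G1 : GL_set (1%:M + x *m (l - vrow a)) by exists h2.
  exists (GL_mk G1); rewrite GL_mkK mulmxDr mulmx1 mulmxA [vrow a *m x]mx11_scalar mx.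
  by rewrite mul1mx addrC subrK.
have deltaE (r : 'rV[Zp]_d) j : (r *m (delta_mx j 0 : 'cV[Zp]_d)) 0 0 = r 0 j by rewrite -colE mxE.
have vo : vrow a 0 o = 1 by rewrite mxE expr0.
have [lo|lo] := eqVneq (l 0 o 1%N) 0; last by exists (delta_mx o 0); rewrite !deltaE vo.
(* The second term corrects the value of vrow a to 1, and l sends it to a multiple of p. *)
exists (delta_mx k 0 + (1 - vrow a 0 k) *: delta_mx o 0).
rewrite !mulmxDr -!scalemxAr ![(_ + _ : 'M[Zp]_1) _ _]mxE ![(_ *: _ : 'M[Zp]_1) _ _]mxE !deltaE vo.
split; first by rewrite mulr1 addrC subrK.
have e1 : ((1 - vrow a 0 k) * l 0 o) 1%N = 0 by exact: zp_valM0.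
apply: contraNneq lk => h; apply/eqP.
have : (l 0 k + (1 - vrow a 0 k) * l 0 o - (1 - vrow a 0 k) * l 0 o) 1%N = 0.
  by apply/zp_valB0; rewrite h e1.
by rewrite addrK.
Qed.

Lemma zp_nat_inj a b : (a%:R : Zp) = b%:R -> a = b.
Proof.
move=> h; have := congr1 (fun x : Zp => x (maxn a b)) h.
rewrite !zp_val_nat !modz_nat => -[].
have lt m : (m <= maxn a b)%N -> (m < p ^ maxn a b)%N.
  by move=> /leq_ltn_trans; apply; apply: ltn_expl; exact: prime_gt1.
by rewrite !modn_small // lt // (leq_maxl, leq_maxr).
Qed.

(** The Vandermonde determinant is nonzero but possibly divisible by p, so the adjugate and the
    absence of zero divisors replace an inverse. *)
Lemma vrow_independent (s : seq nat) (v : 'cV[Zp]_d) : uniq s -> (d <= size s)%N ->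
  (forall a, a \in s -> vrow a *m v = 0) -> v = 0.
Proof.
move=> us ds hs.
pose W := Vandermonde d (\row_(j < d) (nth 0%N s j)%:R : 'rV[Zp]_d).
have Wv : W^T *m v = 0.
  apply/colP => j; rewrite [RHS]mxE.
  have sj : nth 0%N s j \in s by apply: mem_nth; exact: leq_trans (ltn_ord j) ds.
  have := congr1 (fun m : 'M[Zp]_1 => m 0 0) (hs _ sj); rewrite [RHS]mxE => <-.
  by rewrite !mxE; apply: eq_bigr => k _; rewrite !mxE.
have detW : \det W *: v = 0.
  by rewrite -det_tr -mul_scalar_mx -mul_adj_mx -mulmxA Wv mulmx0.
have : \det W <> 0.
  rewrite det_Vandermonde.
  have prod0 (I : finType) (P : pred I) (F : I -> Zp) :
      (forall j, P j -> F j <> 0) -> \prod_(j | P j) F j <> 0.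
    move=> hF; elim/big_ind: _ => [|x y hx hy|j Pj]; last exact: hF.
      by move=> h1; have := zp1_neq0 p_pr; rewrite h1 zp_val0 eqxx.
    by move=> /(zp_domain p_pr)[].
  apply: (prod0) => i _; apply: (prod0) => j ij; rewrite !mxE => /eqP.
  rewrite subr_eq0 => /eqP/zp_nat_inj/eqP; rewrite nth_uniq //.
  - by move=> /eqP ji; move: ij; rewrite ji ltnn.
  - exact: leq_trans (ltn_ord j) ds.
  - exact: leq_trans (ltn_ord i) ds.
move=> d0; apply/colP => j; rewrite mxE.
have := congr1 (fun m : 'cV[Zp]_d => m j 0) detW; rewrite !mxE.
by move=> /(zp_domain p_pr)[].
Qed.

(* The Haar measure of a hyperplane condition is the same for all the rows vrow a, and
   any d of these rows are linearly independent. *)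
Lemma vanishing_null l : e != 0 -> l != 0 -> mu (vanishing l) = 0%E.
Proof.
move=> e0 l0.
(* Removing the common power of p leaves the condition unchanged and produces the unit entry that
   [vrow_transitive] asks for. *)
have [l' [m [k [el lk]]]] : exists l' m k, l = (p ^ m)%N%:R *: l' /\ l' 0 k 1%N != 0.
  have ex : exists m, [exists j, l 0 j m.+1 != 0].
    apply: contrapT => h; move/eqP: l0; apply; apply/rowP => j; rewrite mxE.
    apply: (zp_sep (p := p)) => -[|n]; first by rewrite -zp_mod expn0 modz1.
    apply: contrapT => /eqP hn; apply: h; exists n; apply/existsP; by exists j.
  have [m /existsP[k hk] minm] := ex_minnP ex.
  have lm j : l 0 j m = 0.
    case: m minm {hk} => [|m] minm; first by rewrite -zp_mod expn0 modz1.
    apply: contrapT => /eqP hj; have := minm m; rewrite ltnn => /(_ _)/negP; apply=> //.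
    by apply/existsP; exists j.
  have /choice[f hf] j : exists y, l 0 j = (p ^ m)%N%:R * y by exact: zp_divide.
  exists (\row_j f j), m, k; split.
    by apply/rowP => j; rewrite hf !mxE.
  rewrite mxE; apply: contraNneq hk => fk; have [z ez] := zp_divide p_pr fk.
  by rewrite hf ez mulrA -natrM -expnD addn1 zp_val_pM.
have -> : vanishing l = vanishing l'.
  apply/seteqP; split=> g; rewrite /vanishing /= el -scalemxAl => h; last first.
    by rewrite h scaler0.
  apply/matrixP => i j; rewrite [RHS]mxE; apply: (zp_torsion_free p_pr (n := m)).
  by have := congr1 (fun x : 'M[Zp]_1 => x i j) h; rewrite !mxE.
apply: (@measure0_bounded_multiplicity _ _ _ mu (fun a => vanishing (vrow a)) d).
- by move=> a; exact: measurable_vanishing.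
- by move=> a; have [h eh] := vrow_transitive a lk; rewrite -(translate_vanishing eh).
move=> g n; rewrite -size_filter leqNgt; apply/negP => lt.
have [h1 [_ h1g]] := GL_mxP g.
move/eqP: e0; apply; rewrite -[e]mul1mx -h1g -mulmxA.
rewrite (@vrow_independent [seq a <- iota 0 n | `[< vanishing (vrow a) g >]] (GL_mx g *m e)).
- by rewrite mulmx0.
- by rewrite filter_uniq // iota_uniq.
- exact: ltnW.
- by move=> a; rewrite mem_filter => /andP[/asboolP].
Qed.

End HyperplaneNull.

(** * The induced pseudo-isomorphism *)

Section PrincipalQuotients.
Variable R : comPzRingType.

Lemma span1P (a x : R) : submod_span [set (a : R^o)] x <-> exists c, x = c * a.
Proof.
split=> [h|[c ->] N aN]; last by apply: (submodZ c); apply: aN.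
have s0 : exists c, (0 : R) = c * a by exists 0; rewrite mul0r.
have sD (y z : R) : (exists c, y = c * a) -> (exists c, z = c * a) -> exists c, y + z = c * a.
  by move=> [b ->] [c ->]; exists (b + c); rewrite mulrDl.
have sZ (b y : R) : (exists c, y = c * a) -> exists c, b * y = c * a.
  by move=> [c ->]; exists (b * c); rewrite mulrA.
pose N : submod R^o := @Submod R R^o [set y : R^o | exists c, (y : R) = c * a] s0 sD sZ.
by apply: (h N) => y ->; exists 1; rewrite mul1r.
Qed.

Definition pquo (a : R) (x : R) : principal_quo a := quo_pi (submod_span [set (a : R^o)]) (x : R^o).
Definition pquo_rep (a : R) (x : principal_quo a) : R := quo_repr x.

Lemma pquoK a (x : principal_quo a) : pquo a (pquo_rep x) = x.
Proof. exact: quo_reprK. Qed.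

Lemma pquoP a x y : pquo a x = pquo a y <-> exists c, x - y = c * a.
Proof. by split=> [/quo_piP/span1P|/span1P/quo_piP]. Qed.

Lemma pquo0P a x : pquo a x = 0 <-> exists c, x = c * a.
Proof.
have -> : 0 = pquo a 0 by exact: esym (linear0 (quo_pi _)).
by rewrite -[X in exists c, X = _](subr0 x); exact: pquoP.
Qed.

Lemma pquoD a x y : pquo a (x + y) = pquo a x + pquo a y.
Proof. exact: (linearD (quo_pi _)). Qed.
Lemma pquoZ a b x : pquo a (b * x) = b *: pquo a x.
Proof. exact: (linearZ_LR (quo_pi _)). Qed.

Lemma dsum_sum t (M : 'I_t -> lmodType R) (I : Type) (s : seq I) (F : I -> dsum M) l :
  (\sum_(j <- s) F j) l = \sum_(j <- s) F j l.
Proof. by elim/big_rec2: _ => [//|j x y _ <-]. Qed.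

Lemma fg_dsum_principal t (g : 'I_t -> R) :
  finitely_generated (dsum (fun l => principal_quo (g l))).
Proof.
exists t, (fun l l' => pquo (g l') (l' == l)%:R) => w.
exists (fun l => pquo_rep (w l)); apply: functional_extensionality_dep => l'.
have scE c (v : dsum (fun l => principal_quo (g l))) : (c *: v) l' = c *: v l' by [].
rewrite dsum_sum (bigD1 l') //= big1 => [|l /negPf ll'].
  by rewrite addr0 scE eqxx -pquoZ mulr1 pquoK.
by rewrite scE eq_sym ll' -pquoZ mulr0; apply/pquo0P; exists 0; rewrite mul0r.
Qed.

Lemma fg_quo (M : lmodType R) (N : submod M) : finitely_generated M ->
  finitely_generated (quo_mod N).
Proof.
move=> [n [v hv]]; exists n, (fun j => quo_pi N (v j)); elim/quo_ind => x.
have [c ->] := hv x; exists c; rewrite linear_sum; apply: eq_bigr => j _.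
by rewrite linearZ.
Qed.

End PrincipalQuotients.

(** * Base change to a localization *)

Section TensorProducts.
Variables (R : comPzRingType) (A : algebra_over R) (M : lmodType R).
Local Notation io := (alg_map A).
Local Notation pure := (@pure_tensor R A M).

Lemma tens_pi_cat s t : tens_pi (s ++ t) = tens_pi s + tens_pi t :> base_change A M.
Proof. by rewrite -tens_piD. Qed.

Lemma pure_scale b a y : b *: pure a y = pure (b * a) y.
Proof. exact: tens_piZ. Qed.

Lemma pureDr a x y : pure a (x + y) = pure a x + pure a y.
Proof. by rewrite -tens_pi_cat; apply/tens_piP; exact: tensor_addr. Qed.

Lemma pure_bal a r y : pure (a * io r) y = pure a (r *: y).
Proof. by apply/tens_piP; exact: tensor_bal. Qed.

Lemma pure0r a : pure a 0 = 0.
Proof. by apply: (addrI (pure a 0)); rewrite -pureDr !addr0. Qed.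

Lemma pure_sum a (I : Type) (s : seq I) (F : I -> M) :
  pure a (\sum_(j <- s) F j) = \sum_(j <- s) pure a (F j).
Proof.
elim: s => [|j s IH]; first by rewrite !big_nil pure0r.
by rewrite !big_cons pureDr IH.
Qed.

Lemma tens_span (P : base_change A M -> Prop) : P 0 ->
  (forall z w, P z -> P w -> P (z + w)) -> (forall a y, P (pure a y)) -> forall z, P z.
Proof.
move=> P0 PD Pp; elim/tens_ind; elim=> [//|[a y] s IH].
by rewrite -cat1s tens_pi_cat; exact: PD (Pp a y) IH.
Qed.

Lemma fg_base_change : finitely_generated M -> finitely_generated (base_change A M).
Proof.
move=> [n [v hv]]; exists n, (fun j => pure 1 (v j)); apply: tens_span.
- by exists (fun=> 0); rewrite big1 // => j _; rewrite scale0r.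
- move=> _ _ [b ->] [c ->]; exists (fun j => b j + c j).
  by rewrite -big_split; apply: eq_bigr => j _; rewrite scalerDl.
- move=> a y; have [c ->] := hv y; exists (fun j => a * io (c j)).
  by rewrite pure_sum; apply: eq_bigr => j _; rewrite -pure_bal pure_scale mulr1.
Qed.

Variable S : set R.
Hypothesis locA : is_localization A S.

Lemma base_change_frac z : exists s y, S s /\ io s *: z = pure 1 y.
Proof.
move: z; apply: tens_span.
- by exists 1, 0; split; [exact: isloc1 locA | rewrite scaler0 pure0r].
- move=> z w [s [y [Ss ez]]] [t [x [St ew]]].
  exists (s * t), (t *: y + s *: x); split; first exact: (islocM locA Ss St).
  rewrite scalerDr pureDr -!pure_bal !mul1r {1}[s * t]mulrC !rmorphM -!scalerA ez ew.
  by rewrite !pure_scale !mulr1.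
- move=> a y; have [s [Ss [u eu]]] := isloc_frac locA a.
  by exists s, (u *: y); split=> //; rewrite pure_scale eu -pure_bal mul1r.
Qed.

Section Universal.
Variables (D : lmodType A) (psi : M -> D).
Hypotheses (psiD : forall x y, psi (x + y) = psi x + psi y).
Hypothesis (psiZ : forall r x, psi (r *: x) = io r *: psi x).

Definition tens_eval (s : seq (A * M)) : D := \sum_(u <- s) u.1 *: psi u.2.

Lemma tens_eval_eq s t : tensor_eq s t -> tens_eval s = tens_eval t.
Proof.
rewrite /tens_eval; elim=> {s t} //=.
- by move=> s t u _ -> _ ->.
- by move=> s1 s2 t1 t2 _ e1 _ e2; rewrite !big_cat /= e1 e2.
- by move=> s1 s2; rewrite !big_cat /= addrC.
- by move=> x; rewrite big_nil big_seq1 scale0r.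
- by move=> a b x; rewrite !big_cons !big_nil /= !addr0 scalerDl.
- by move=> a x y; rewrite !big_cons !big_nil /= !addr0 psiD scalerDr.
- by move=> a r x; rewrite !big_seq1 /= psiZ scalerA.
Qed.

Definition tens_lift_fun (z : base_change A M) : D := tens_eval (tens_repr z).

Lemma tens_lift_pi s : tens_lift_fun (tens_pi s) = tens_eval s.
Proof. by apply: tens_eval_eq; exact: tens_repr_pi. Qed.

Lemma tens_lift_linear : linear tens_lift_fun.
Proof.
move=> a; elim/tens_ind => s; elim/tens_ind => t.
have -> : a *: (tens_pi s : base_change A M) = tens_pi (formal_scale a s) by exact: tens_piZ.
rewrite -tens_pi_cat !tens_lift_pi /tens_eval big_cat /= big_map /=; congr (_ + _).
by rewrite scaler_sumr; apply: eq_bigr => u _; rewrite scalerA.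
Qed.

Definition tens_lift : {linear base_change A M -> D} :=
  HB.pack tens_lift_fun (GRing.isLinear.Build _ _ _ *:%R tens_lift_fun tens_lift_linear).

Lemma tens_lift_pure a y : tens_lift (pure a y) = a *: psi y.
Proof. by rewrite [LHS]tens_lift_pi /tens_eval big_seq1. Qed.

End Universal.
End TensorProducts.

(** * Reduction of a pseudo-isomorphism modulo one element *)

Section InducedPseudoIsomorphism.
Variables (R0 R1 : comPzRingType) (res : {rmorphism R0 -> R1}) (ga : R0).
Hypothesis res_surj : forall y, exists x, res x = y.
Hypothesis res_ker : forall a, res a = 0 -> exists b, a = b * ga.
Hypothesis res_ga : res ga = 0.
Variables (A : algebra_over R1) (S : set R1).
Hypothesis locA : is_localization A S.
Hypothesis noeA : noetherian A.
Variables (X : lmodType R0) (Y : lmodType R1) (q : X -> Y).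
Hypotheses (qB : zmod_morphism q) (q_surj : forall y, exists x, q x = y).
Hypothesis qZ : forall a x, q (a *: x) = res a *: q x.
Hypothesis q_ker : forall x, q x = 0 ->
  submod_span [set y | exists a x', res a = 0 /\ y = a *: x'] x.
Variables (t : nat) (f : 'I_t -> R0).
Variable phi : {linear X -> dsum (fun l => principal_quo (f l))}.
Hypothesis fgX : finitely_generated X.

Local Notation io := (alg_map A).
Local Notation D := (dsum (fun l => principal_quo (io (res (f l))))).

Lemma q0 : q 0 = 0.
Proof. by rewrite -(subrr 0) qB subrr. Qed.

Lemma qD x y : q (x + y) = q x + q y.
Proof. by rewrite -{1}(opprK y) qB -(sub0r y) qB q0 sub0r opprK. Qed.

Definition pquo_map (w : dsum (fun l => principal_quo (f l))) : D :=
  fun l => pquo (io (res (f l))) (io (res (pquo_rep (w l)))).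

Lemma pquo_mapE (w : dsum (fun l => principal_quo (f l))) (c : 'I_t -> R0) :
  (forall l, w l = pquo (f l) (c l)) ->
  pquo_map w = (fun l => pquo (io (res (f l))) (io (res (c l)))) :> D.
Proof.
move=> hw; apply: functional_extensionality_dep => l; apply/pquoP.
have /pquoP[b eb] : pquo (f l) (pquo_rep (w l)) = pquo (f l) (c l) by rewrite pquoK.
by exists (io (res b)); rewrite -!rmorphB eb !rmorphM.
Qed.

Lemma pquo_mapD u v : pquo_map (u + v) = pquo_map u + pquo_map v.
Proof.
rewrite (@pquo_mapE _ (fun l => pquo_rep (u l) + pquo_rep (v l))) => [|l]; last first.
  by rewrite pquoD !pquoK.
by apply: functional_extensionality_dep => l; rewrite !rmorphD pquoD.
Qed.

Lemma pquo_mapZ a u : pquo_map (a *: u) = io (res a) *: pquo_map u.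
Proof.
rewrite (@pquo_mapE _ (fun l => a * pquo_rep (u l))) => [|l]; last by rewrite pquoZ pquoK.
by apply: functional_extensionality_dep => l; rewrite !rmorphM pquoZ.
Qed.

Definition psi0 (x : X) : D := pquo_map (phi x).

Lemma psi0D x y : psi0 (x + y) = psi0 x + psi0 y.
Proof. by rewrite /psi0 linearD pquo_mapD. Qed.

Lemma psi0Z a x : psi0 (a *: x) = io (res a) *: psi0 x.
Proof. by rewrite /psi0 linearZ_LR pquo_mapZ. Qed.

Lemma psi0_0 : psi0 0 = 0.
Proof. by rewrite -(scale0r 0) psi0Z !rmorph0 scale0r. Qed.

Lemma psi0_ker x : q x = 0 -> psi0 x = 0.
Proof.
have hD u v : psi0 u = 0 -> psi0 v = 0 -> psi0 (u + v) = 0.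
  by move=> eu ev; rewrite psi0D eu ev addr0.
have hZ a u : psi0 u = 0 -> psi0 (a *: u) = 0 by move=> eu; rewrite psi0Z eu scaler0.
pose N : submod X := @Submod _ _ [set u | psi0 u = 0] psi0_0 hD hZ.
move=> /q_ker h; apply: (h N) => y [a [x' [ea ->]]].
by rewrite /= psi0Z ea rmorph0 scale0r.
Qed.

Definition qlift (y : Y) : X := projT1 (cid (q_surj y)).
Lemma qliftK y : q (qlift y) = y.
Proof. exact: projT2 (cid (q_surj y)). Qed.

Definition psi (y : Y) : D := psi0 (qlift y).

Lemma psiE x : psi (q x) = psi0 x.
Proof.
have e : q (qlift (q x) - x) = 0 by rewrite qB qliftK subrr.
by rewrite /psi -(subrK x (qlift (q x))) psi0D (psi0_ker e) add0r.
Qed.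

Lemma psiD x y : psi (x + y) = psi x + psi y.
Proof. by rewrite -(qliftK x) -(qliftK y) -qD !psiE psi0D. Qed.

Lemma psiZ r x : psi (r *: x) = io r *: psi x.
Proof. by have [a <-] := res_surj r; rewrite -(qliftK x) -qZ !psiE psi0Z. Qed.

Definition induced : {linear base_change A Y -> D} := tens_lift psiD psiZ.

Lemma common_den (c : 'I_t -> A) : exists s, S s /\
  exists u : 'I_t -> R1, forall l, io s * c l = io (u l).
Proof.
have /choice[s hs] l : exists s, S s /\ exists u, io s * c l = io u by exact: isloc_frac.
exists (\prod_l s l); split.
  by elim/big_ind: _ => [|x y Sx Sy|l _]; [exact: isloc1 locA|exact: (islocM locA Sx Sy)|exact: (proj1 (hs l))].
have /choice[u hu] l : exists u, io (s l) * c l = io u by exact: (proj2 (hs l)).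
exists (fun l => (\prod_(j | j != l) s j) * u l) => l.
by rewrite (bigD1 l) //= !rmorphM -hu mulrA [io (s l) * _]mulrC.
Qed.

Lemma common_kill (c : 'I_t -> R1) : (forall l, io (c l) = 0) ->
  exists2 s, S s & forall l, s * c l = 0.
Proof.
move=> hc; have /choice[s hs] l : exists s, S s /\ s * c l = 0.
  by have [s] := isloc_eq locA (hc l); exists s.
exists (\prod_l s l) => [|l].
  by elim/big_ind: _ => [|x y Sx Sy|l _]; [exact: isloc1 locA|exact: (islocM locA Sx Sy)|exact: (proj1 (hs l))].
by rewrite (bigD1 l) //= mulrAC (proj2 (hs l)) mul0r.
Qed.

(* If the image of x dies in the target then, up to a denominator w, phi (w x) is
   divisible by ga; an annihilator b of the cokernel makes the quotient an image phi x'',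
   so b w x - ga x'' lies in the kernel of phi. *)
Lemma induced_ker_ann a b : annihilator (sub_mod (lin_kernel phi)) a ->
  annihilator (lin_cokernel phi) b ->
  annihilator (sub_mod (lin_kernel induced)) (io (res (a * b))).
Proof.
move=> ha hb [z hz]; apply: sub_val_inj => /=.
have {}hz : induced z = 0 by [].
have [s [y [Ss ez]]] := base_change_frac locA z.
have hy : psi y = 0.
  by rewrite -[LHS]scale1r -(tens_lift_pure psiD psiZ) -ez linearZ_LR hz scaler0.
have [x ex] := q_surj y; rewrite -ex psiE in hy.
have /choice[c hc] l : exists c, io (res (pquo_rep (phi x l))) = c * io (res (f l)).
  by apply/pquo0P; exact: (congr1 (fun w : D => w l) hy).
have [s1 [Ss1 [u hu]]] := common_den c.
have [|s2 Ss2 hs2] := @common_kill (fun l => s1 * res (pquo_rep (phi x l)) - u l * res (f l)).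
  by move=> l; rewrite rmorphB !rmorphM hc -hu mulrA subrr.
have [w ew] := res_surj (s2 * s1).
have /choice[v hv] l : exists v, res v = s2 * u l by exact: res_surj.
(* With denominators cleared the relation lifts to R0, with an error in the kernel of [res]. *)
have /choice[d hd] l : exists d, w * pquo_rep (phi x l) - v l * f l = d * ga.
  apply: res_ker; rewrite rmorphB !rmorphM ew hv -[RHS](hs2 l); ring.
pose beta : dsum (fun l => principal_quo (f l)) := fun l => pquo (f l) (d l).
have phiw : phi (w *: x) = ga *: beta.
  rewrite linearZ_LR; apply: functional_extensionality_dep => l.
  transitivity (w *: phi x l) => //; rewrite -[phi x l]pquoK -pquoZ.
  transitivity (ga *: pquo (f l) (d l)) => //; rewrite -pquoZ; apply/pquoP.
  by exists (v l); rewrite mulrC [ga * _]mulrC -hd mulrC subKr.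
have [x2 ex2] : exists x2, phi x2 = b *: beta.
  have : b *: quo_pi (image_mod phi) beta = 0 by exact: hb.
  rewrite -linearZ_LR => /esym; rewrite -[LHS](linear0 (quo_pi (image_mod phi))) => /quo_piP.
  by rewrite sub0r => /submodN; rewrite opprK => -[x2 _ e2]; exists x2.
have hk : phi (b *: (w *: x) - ga *: x2) = 0.
  rewrite linearB [phi (b *: _)]linearZ_LR phiw [phi (ga *: x2)]linearZ_LR ex2.
  by rewrite !scalerA mulrC subrr.
have := congr1 (@sub_val _ _ _) (ha (SubMod (hk : lin_kernel phi _))) => /=.
rewrite scalerBr => /(congr1 q); rewrite qB q0 !qZ res_ga scale0r scaler0 subr0 ew ex.
rewrite !scalerA => hfin.
(* The accumulated denominators are units of A and cancel. *)
have [t1 et1] := isloc_unit locA (islocM locA (islocM locA Ss2 Ss1) Ss).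
rewrite -[LHS]scale1r -et1 -scalerA.
have -> : io (s2 * s1 * s) *: (t1 *: (io (res (a * b)) *: z)) =
    t1 *: (io (s2 * s1 * res (a * b)) *: (io s *: z)).
  by rewrite !scalerA; congr (_ *: z); rewrite !rmorphM; ring.
rewrite ez pure_scale mulr1 -[io _]mul1r pure_bal -ex.
by rewrite (_ : _ *: q x = 0) ?pure0r ?scaler0 // -[RHS]hfin ex; congr (_ *: _); rewrite rmorphM; ring.
Qed.

Lemma induced_coker_ann b : annihilator (lin_cokernel phi) b ->
  annihilator (lin_cokernel induced) (io (res b)).
Proof.
move=> hb; elim/quo_ind => w.
have [s [Ss [u hu]]] := common_den (fun l => pquo_rep (w l)).
have /choice[c hc] l : exists c, res c = u l by exact: res_surj.
pose beta : dsum (fun l => principal_quo (f l)) := fun l => pquo (f l) (c l).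
have [x ex] : exists x, phi x = b *: beta.
  have : b *: quo_pi (image_mod phi) beta = 0 by exact: hb.
  rewrite -linearZ_LR => /esym; rewrite -[LHS](linear0 (quo_pi (image_mod phi))) => /quo_piP.
  by rewrite sub0r => /submodN; rewrite opprK => -[x _ e]; exists x.
have [t1 et1] := isloc_unit locA Ss.
have e : io (res b) *: w = induced (pure_tensor t1 (q x)).
  rewrite tens_lift_pure psiE /psi0 ex pquo_mapZ.
  rewrite (@pquo_mapE beta c) // scalerA mulrC -scalerA; congr (_ *: _).
  apply: functional_extensionality_dep => l.
  transitivity (t1 *: pquo (io (res (f l))) (io (res (c l)))) => //.
  by rewrite -pquoZ hc -hu mulrA [t1 * _]mulrC et1 mul1r pquoK.
rewrite -linearZ_LR /=; transitivity (quo_pi (image_mod induced) 0); last exact: linear0.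
by apply/quo_piP; rewrite subr0 e; exists (pure_tensor t1 (q x)).
Qed.

(** The hypothesis is a disjunction because a prime containing all products a * b contains one of
    the two annihilators. *)
Lemma induced_pseudo_iso :
  (forall Q : set A, prime_ideal Q ->
    (forall a, annihilator (sub_mod (lin_kernel phi)) a -> Q (io (res a))) \/
    (forall a, annihilator (lin_cokernel phi) a -> Q (io (res a))) ->
    prime_height_ge 2 Q) ->
  pseudo_iso (base_change A Y) D.
Proof.
move=> hQ.
have fgY : finitely_generated Y.
  have [n [v hv]] := fgX; exists n, (fun j => q (v j)) => y.
  have [c ec] := hv (qlift y); exists (fun j => res (c j)).
  rewrite -{1}(qliftK y) ec; elim/big_rec2: _ => [|j u w _ <-]; first exact: q0.
  by rewrite qD qZ.
exists induced; split; split.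
- by apply: fg_sub_mod noeA _ _; exact: fg_base_change.
- move=> Q pQ annQ; apply: hQ => //.
  have [hA|/existsNP[a /not_implyP[ha nQa]]] :=
    pselect (forall a, annihilator (sub_mod (lin_kernel phi)) a -> Q (io (res a))); [by left|right].
  move=> b hb; have := annQ _ (induced_ker_ann ha hb).
  by rewrite !rmorphM => /(pri_prime pQ)[].
- by apply: fg_quo; exact: fg_dsum_principal.
- move=> Q pQ annQ; apply: hQ => //; right=> b hb; apply: annQ.
  exact: induced_coker_ann.
Qed.

End InducedPseudoIsomorphism.

(** * Generic subextensions *)

Lemma annihilator_is_ideal (R : comPzRingType) (M : lmodType R) :
  is_ideal (annihilator M).
Proof.
split=> [x|a b ha hb x|a b hb x]; first by rewrite scale0r.
  by rewrite scalerDl ha hb addr0.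
by rewrite -scalerA hb scaler0.
Qed.

Lemma dagger_localization (p d : nat) (k : fieldType) (K : zp_ext p d k) :
  exists S, is_localization (dagger K) S /\
    (d = 1%N -> forall g : gal_group K, g != 0 -> S (cgr_elt (padic_int p) g - 1)).
Proof.
rewrite /dagger; case: eqP => [d1|nd1].
  exists (mult_closure [set (cgr_elt (padic_int p) g - 1 : Iwasawa K) |
    g in [set g : gal_group K | g != 0]]); split.
    exact: localization_alg_localization.
  move=> _ g g0; rewrite -[X in mult_closure _ X]mulr1.
  by apply: mult_closureM; [exists g | exact: mult_closure1].
by exists [set 1]; split; [exact: trivial_alg_localization | move=> /nd1].
Qed.

Section GenericHeight.
Variables (p i : nat) (k : fieldType) (K : zp_ext p (i + 1) k).
Hypotheses (p_pr : prime p) (i_gt0 : (1 <= i)%N).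
Local Notation Zp := (padic_int p).
Variable c : zp_chart p (i + 1) (gal_group K).

Lemma Iwasawa_restr_structure (L : zp_subext i K) (cL : zp_chart p i (gal_group L)) :
  exists (A : 'M[Zp]_(i, i + 1)) (s : 'cV[Zp]_(i + 1)),
  [/\ forall v, restr L (c v) = cL (A *m v),
      forall w : 'cV[Zp]_i, exists v : 'cV[Zp]_(i + 1), A *m v = w,
      forall v : 'cV[Zp]_(i + 1), A *m v = 0 -> exists a, v = a *: s,
      forall y, exists x, Iwasawa_restr L x = y &
      forall a, Iwasawa_restr L a = 0 <-> exists b, a = b * (cgr_elt Zp (c s) - 1)].
Proof.
have [A [s [rA Asurj As Aker]]] := restr_structure p_pr c cL.
have r_surj y : exists x, restriction L x = y.
  have [v hv] := Asurj (unchart cL y); exists (c v).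
  by rewrite -[RHS](unchartK cL) -hv; exact: rA.
have r_s : restriction L (c s) = 0.
  by rewrite -[RHS](iso_mor0 cL) -As; exact: rA.
have r_ker x : restriction L x = 0 -> forall m, pcyc p_pr c m (c s) x.
  rewrite -(unchartK c x) => rx m.
  have [|a ->] := Aker (unchart c x).
    by apply: (can_inj (@chartK _ _ _ cL)); rewrite iso_mor0 -rA; exact: rx.
  by have [j hj] := zp_val_nat_eq p_pr a m; exists j; exact: chart_scale.
exists A, s; split=> // [y|a]; first exact: (push_surj p_pr c cL r_surj y).
exact: (push_ker cL r_surj r_s r_ker a).
Qed.

(** Makes H_P a Z_p-submodule: a v is a limit of natural multiples of v. *)
Lemma unipotent_scale (P : set (Iwasawa K)) (a : Zp) v : is_ideal P ->
  P (cgr_elt Zp (c v) - 1) -> P (cgr_elt Zp (c (a *: v)) - 1).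
Proof.
move=> iP Pv; apply: (cgr_elt_mem_ideal (p_pr := p_pr) (c0 := c) iP Pv) => n.
by have [m hm] := zp_val_nat_eq p_pr a n; exists m; exact: chart_scale.
Qed.

Lemma unipotent_full_or_form (P : set (Iwasawa K)) : is_ideal P ->
  exists2 l : 'rV[Zp]_(i + 1), l != 0 &
    (exists N, forall v, P (cgr_elt Zp (c ((p ^ N)%N%:R *: v)) - 1)) \/
    (forall v, P (cgr_elt Zp (c v) - 1) -> l *m v = 0).
Proof.
move=> iP.
have h0 : P (cgr_elt Zp (c 0) - 1) by rewrite iso_mor0 subrr; exact: id0.
have hD u v : P (cgr_elt Zp (c u) - 1) -> P (cgr_elt Zp (c v) - 1) ->
    P (cgr_elt Zp (c (u + v)) - 1).
  move=> hu hv; rewrite iso_morD cgr_eltD.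
  rewrite (_ : _ - 1 = cgr_elt Zp (c v) * (cgr_elt Zp (c u) - 1) + (cgr_elt Zp (c v) - 1)).
    by apply: idD => //; exact: idM.
  by rewrite mulrBr mulr1 addrA subrK mulrC.
pose H := @Submod _ 'cV[Zp]_(i + 1) [set v | P (cgr_elt Zp (c v) - 1)] h0 hD
  (fun a v => @unipotent_scale P a v iP).
have [[N hN]|[l l0 hl]] := full_or_form p_pr H; last by exists l => //; right.
have k0 : (0 < i + 1)%N by rewrite addn1.
(* A dummy nonzero form, so that every prime carries one form whatever the rank of H_P. *)
exists (delta_mx 0 (Ordinal k0)); last by left; exists N.
apply/eqP => /(congr1 (fun l : 'rV[Zp]_(i + 1) => l 0 (Ordinal k0))).
rewrite !mxE !eqxx => h1; have := zp1_neq0 p_pr.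
by rewrite [X in zp_val X _]h1 zp_val0 eqxx.
Qed.

Lemma height_generic (J : set (Iwasawa K)) : is_ideal J -> height_ge 2 J ->
  exists n (l : nat -> 'rV[Zp]_(i + 1)), (forall j, l j != 0) /\
  forall L : zp_subext i K,
    (forall j, (j < n)%N -> exists2 v, relative_gal L (c v) & l j *m v != 0) ->
    forall Q : set (dagger L), prime_ideal Q ->
      (forall a, J a -> Q (alg_map (dagger L) (Iwasawa_restr L a))) ->
      prime_height_ge 2 Q.
Proof.
move=> iJ hJ; have noeK : noetherian (Iwasawa K) := cgr_noetherian p_pr c.
have [n [P [hP cP]]] := prime_cover noeK iJ.
have /choice[l hl] : forall j, exists l : 'rV[Zp]_(i + 1), l != 0 /\ ((j < n)%N ->
    (exists N, forall v, P j (cgr_elt Zp (c ((p ^ N)%N%:R *: v)) - 1)) \/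
    (forall v, P j (cgr_elt Zp (c v) - 1) -> l *m v = 0)).
  move=> j; case: (ltnP j n) => jn.
    have [l l0 hl] := unipotent_full_or_form (prime_is_ideal (proj1 (hP j jn))).
    by exists l.
  have [l l0 _] := unipotent_full_or_form (@setT_is_ideal (Iwasawa K)).
  by exists l.
exists n, l; split=> [j|L hL Q pQ JQ]; first by have [] := hl j.
have [_ /top_iso_chart[cL _]] := gal_chart L.
have noeL : noetherian (Iwasawa L) := cgr_noetherian p_pr cL.
have [A [s [rA Asurj Aker res_surj res_ker]]] := Iwasawa_restr_structure cL.
have [S [locS Sd]] := dagger_localization L.
set io := alg_map (dagger L) in JQ *; set res := Iwasawa_restr L in JQ res_surj res_ker *.
have res_elt v : res (cgr_elt Zp (c v) - 1) = cgr_elt Zp (cL (A *m v)) - 1.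
  by rewrite rmorphB rmorph1 -rA; congr (_ - 1); exact: push_elt.
pose Q1 := io @^-1` Q; have pQ1 : prime_ideal Q1 by exact: preimage_prime.
pose Q0 := res @^-1` Q1; have pQ0 : prime_ideal Q0 by exact: preimage_prime.
have Q0s : Q0 (cgr_elt Zp (c s) - 1).
  rewrite /Q0 /=; have -> : res (cgr_elt Zp (c s) - 1) = 0.
    by apply/res_ker; exists 1; rewrite mul1r.
  exact: pri0.
have [j jn PQ] := cP Q0 pQ0 JQ.
have [pP JP] := hP j jn.
apply: (height2_loc locS pQ); rewrite -/Q1.
have [Ps|nPs] := pselect (P j (cgr_elt Zp (c s) - 1)); last first.
  have [P0 [P1 [p0 p1 P0s [P01 P1Q]]]] := krull_height noeK pQ0 Q0s hJ pP JP PQ nPs.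
  apply: (height2_surj res_surj pQ1 p0 p1 _ P01 P1Q) => x /res_ker[b ->].
  exact: priM.
(* Otherwise the form of P j vanishes at s, hence on all of Gal(K/L), whose elements are multiples
   of s; the assumption on L excludes this. *)
have [N hN] : exists N, forall v, P j (cgr_elt Zp (c ((p ^ N)%N%:R *: v)) - 1).
  have [_ /(_ jn)[//|hform]] := hl j.
  have [v /relative_galP rv /eqP[]] := hL j jn.
  have [|a ->] := Aker v; last by rewrite -scalemxAr hform // scaler0.
  by apply: (can_inj (@chartK _ _ _ cL)); rewrite iso_mor0 -rA; exact: rv.
have Q1N w : Q1 (cgr_elt Zp (cL ((p ^ N)%N%:R *: w)) - 1).
  have [v <-] := Asurj w; rewrite scalemxAr -res_elt.
  by have : Q0 (cgr_elt Zp (c ((p ^ N)%N%:R *: v)) - 1) by exact: PQ.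
pose E (m : 'I_i) := cL ((p ^ N)%N%:R *: delta_mx m 0).
have E_val (m : 'I_i) q : ((p ^ N)%N%:R *: (delta_mx m 0 : 'cV[Zp]_i) *+ q) m 0 = (q * p ^ N)%:R.
  by rewrite -scaler_nat !mxE !eqxx mulr1 natrM.
have E_mult (m : 'I_i) n' q : pmult p n' (E m *+ q) -> (p ^ n' %| q * p ^ N)%N.
  by rewrite /E -iso_morMn => /(pmultP p_pr)/(_ m); rewrite E_val => /natr_val0.
have [i1|i1] := eqVneq i 1%N.
  have m0 : 'I_i by rewrite i1; exact: ord0.
  exfalso; apply: (isloc_prime locS pQ _ (Q1N (delta_mx m0 0))).
  apply: Sd i1 _ _; apply/eqP => e0.
  (* If p^N times a basis vector were 0, p^(N+1) would divide p^N. So the corresponding group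
     element minus 1 is a unit, yet lies in Q. *)
  have := @E_mult m0 N.+1 1; rewrite mul1n mulr1n /E e0 => /(_ (pmult0 _ _ _)).
  by rewrite dvdn_Pexp2l ?prime_gt1 // ltnn.
have i2 : (1 < i)%N by rewrite ltn_neqAle eq_sym i1.
pose m1 := Ordinal i_gt0; pose m2 := Ordinal i2.
apply: (height2_regular noeL pQ1 (Q1N (delta_mx m1 0)) (Q1N (delta_mx m2 0))).
  move=> b; apply: (cgr_regular0 p_pr cL (N := N)) => n' q; exact: E_mult.
(* The coordinate m2 sees only the second of the two group elements, which gives the divisibility
   with loss p^N. *)
move=> b; apply: (cgr_regular (p_pr := p_pr) (c0 := cL) (N := N)) => n' q [q' hq'].
have := hq'; rewrite -!iso_morMn -chartB => /(pmultP p_pr)/(_ m2).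
have m12 : ((p ^ N)%N%:R *: (delta_mx m1 0 : 'cV[Zp]_i) *+ q') m2 0 = 0.
  by rewrite -scaler_nat !mxE (_ : (m2 == m1) = false) // !mulr0.
rewrite mxE E_val [X in _ + X]mxE m12 subr0.
exact: natr_val0.
Qed.

End GenericHeight.

Section ExceptionalSet.
Variables (p i : nat).
Hypothesis p_pr : prime p.
Local Notation Zp := (padic_int p).
Variables (R : realType) (mu : probability (Borel (GL p (i + 1))) R).
Hypothesis haar : is_haar mu.
Variables (n : nat) (l : nat -> 'rV[Zp]_(i + 1)).
Hypothesis l_neq0 : forall j, l j != 0.

Definition exceptional : set (Gr p i 1) :=
  [set N | exists2 j, (j < n)%N & forall v, N v -> l j *m v = 0].

(** A generator of the base point N_0, which has rank one here. *)
Definition last_vector : 'cV[Zp]_(i + 1) := col_mx 0 1%:M.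

Lemma base_modP v : base_mod p i 1 v <-> exists a, v = a *: last_vector.
Proof.
split=> [hv|[a ->]]; last by rewrite /= /base_set /= scale_col_mx col_mxKu scaler0.
exists (dsubmx v 0 0); rewrite scale_col_mx scaler0 scale_scalar_mx mulr1.
by rewrite -mx11_scalar -(hv : usubmx v = 0) vsubmxK.
Qed.

Lemma exceptional_orbit g : exceptional (@gr_orbit p i 1 g) <->
  exists2 j, (j < n)%N & vanishing last_vector (l j) g.
Proof.
split=> [[j jn hj]|[j jn hj]]; exists j => //.
  by apply: hj; exists last_vector => //; apply/base_modP; exists 1; rewrite scale1r.
by move=> _ [v /base_modP[a ->] <-]; rewrite -!scalemxAr hj scaler0.
Qed.

Lemma vanishing_union m : [set g | exists2 j, (j < m)%N & vanishing last_vector (l j) g] =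
  \big[setU/set0]_(j < m) vanishing last_vector (l j).
Proof.
apply/seteqP; split=> g.
  by move=> [j jm hj]; rewrite -(bigcup_mkord m (fun j => vanishing last_vector (l j))); exists j.
by rewrite -(bigcup_mkord m (fun j => vanishing last_vector (l j))) => -[j jm hj]; exists j.
Qed.

Lemma closed_exceptional : closed exceptional.
Proof.
rewrite -[exceptional]setCK; apply: open_closedC.
suff : open (@gr_orbit p i 1 @^-1` (~` exceptional) : set (GL p (i + 1))) by [].
have -> : @gr_orbit p i 1 @^-1` (~` exceptional) =
    ~` [set g | exists2 j, (j < n)%N & vanishing last_vector (l j) g].
  by apply/seteqP; split=> g /= h h'; apply: h; apply/exceptional_orbit.
elim: n => [|m IH].
  by rewrite (_ : ~` _ = setT); [exact: openT | apply/seteqP; split=> // g _ []].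
rewrite vanishing_union big_ord_recr /= setCU -vanishing_union.
by apply: openI => //; exact: open_not_vanishing.
Qed.

Lemma null_exceptional : Defs.null_set mu exceptional.
Proof.
rewrite /Defs.null_set /pushforward.
have -> : @gr_orbit p i 1 @^-1` exceptional =
    [set g | exists2 j, (j < n)%N & vanishing last_vector (l j) g].
  by apply/seteqP; split=> g /exceptional_orbit.
have e0 : last_vector != 0.
  apply/eqP => /(congr1 (fun v : 'cV[Zp]_(i + 1) => dsubmx v 0 0)).
  rewrite col_mxKd !mxE => h; have := zp1_neq0 p_pr.
  by rewrite [X in zp_val X _]h zp_val0 eqxx.
suff [] : measurable ([set g | exists2 j, (j < n)%N & vanishing last_vector (l j) g]
      : set (Borel (GL p (i + 1)))) /\
    mu [set g | exists2 j, (j < n)%N & vanishing last_vector (l j) g] = 0%E by [].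
rewrite vanishing_union; elim: n => [|m [mm m0]].
  by rewrite big_ord0; split; [exact: measurable0 | exact: measure0].
have mv := @measurable_vanishing p (i + 1) last_vector (l m).
rewrite big_ord_recr /=; split; first exact: measurableU.
apply: null_set_setU => //; exact: (vanishing_null p_pr haar e0).
Qed.

End ExceptionalSet.

Lemma subext_gr (p i : nat) (k : fieldType) (K : zp_ext p (i + 1) k) (L : zp_subext i K)
    (c : zp_chart p (i + 1) (gal_group K)) : prime p ->
  exists N : Gr p i 1, forall v, N v <-> relative_gal L (c v).
Proof.
move=> p_pr; have [_ /top_iso_chart[cL _]] := gal_chart L.
have [A [s [rA Asurj _ _]]] := restr_structure p_pr c cL.
have kerA v : relative_gal L (c v) <-> A *m v = 0.
  rewrite relative_galP rA -[X in _ = X <-> _](iso_mor0 cL); split=> [|-> //].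
  exact: (can_inj (@chartK _ _ _ cL)).
have h0 : relative_gal L (c 0) by apply/kerA; rewrite mulmx0.
have hD u v : relative_gal L (c u) -> relative_gal L (c v) -> relative_gal L (c (u + v)).
  by move=> /kerA eu /kerA ev; apply/kerA; rewrite mulmxDr eu ev addr0.
have hZ a u : relative_gal L (c u) -> relative_gal L (c (a *: u)).
  by move=> /kerA eu; apply/kerA; rewrite -scalemxAr eu scaler0.
pose N : submod 'cV[padic_int p]_(i + 1) :=
  @Submod _ _ [set v | relative_gal L (c v)] h0 hD hZ.
have free : exists g : {linear quo_mod N -> 'cV[padic_int p]_i}, bijective g.
  by apply: (@quo_linear_iso p i 1 N (mulmx A)) => // v; exact: kerA.
by exists (MkGr free).
Qed.

Theorem theorem6p6 (p i t : nat) (k : fieldExtType rat)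
    (K : zp_ext p (i + 1) k) (X : lmodType (Iwasawa K))
    (f : 'I_t -> Iwasawa K)
    (e : 'cV[padic_int p]_(i + 1) -> gal_group K)
    (R : realType) (mu : probability (Borel (GL p (i + 1))) R) :
  prime p -> (1 <= i)%N ->
  is_top_iso e -> is_haar mu ->
  finitely_generated X -> torsion X ->
  (forall l, f l != 0) ->
  pseudo_iso X (dsum (fun l => principal_quo (f l))) ->
  generic e mu (fun L : zp_subext i K =>
    forall (Y : lmodType (Iwasawa L)) (q : X -> Y), is_coinvariants q ->
      pseudo_iso (base_change (dagger L) Y)
        (dsum (fun l => principal_quo
                          (alg_map (dagger L) (Iwasawa_restr L (f l)))))).
Proof.
move=> p_pr i_gt0 /top_iso_chart[c ->{e}] haar fgX _ _ [phi [[_ hA] [_ hB]]].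
have [nA [lA [lA0 genA]]] := height_generic p_pr i_gt0 c (annihilator_is_ideal _) hA.
have [nB [lB [lB0 genB]]] := height_generic p_pr i_gt0 c (annihilator_is_ideal _) hB.
(* One list of forms for the kernel and the cokernel together. *)
pose l j := if (j < nA)%N then lA j else lB (j - nA)%N.
have l0 j : l j != 0 by rewrite /l; case: ifP.
exists (exceptional (nA + nB) l).
split; [exact: closed_exceptional|exact: null_exceptional|].
move=> L failsL; have [N hN] := subext_gr L c p_pr.
have eN : c @` N = relative_gal L.
  apply/seteqP; split=> [_ [v /hN hv <-] //|g hg].
  by exists (unchart c g); [apply/hN; rewrite unchartK | exact: unchartK].
(* By contraposition: if N is not exceptional, no form of the list vanishes on Gal(K/L), and the
   conclusion holds for L. *)
exists N => //; apply: contrapT => goodN; apply: failsL => Y q [qB q_surj q_ker qZ].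
have good j : (j < nA + nB)%N -> exists2 v, relative_gal L (c v) & l j *m v != 0.
  move=> jn; apply: contrapT => hn; apply: goodN; exists j => // v /hN hv.
  by apply: contrapT => /eqP lv; apply: hn; exists v.
have [_ /top_iso_chart[cL _]] := gal_chart L.
have [A [s [_ _ _ res_surj res_ker]]] := Iwasawa_restr_structure p_pr c cL.
have [S [locS _]] := dagger_localization L.
have res_elt g : Iwasawa_restr L (cgr_elt (padic_int p) g) = cgr_elt (padic_int p) (restr L g).
  exact: push_elt.
apply: (@induced_pseudo_iso _ _ (Iwasawa_restr L) (cgr_elt (padic_int p) (c s) - 1)
  res_surj _ _ _ S locS _ X Y q qB q_surj qZ _ t f phi fgX).
- by move=> a /res_ker.
- by apply/res_ker; exists 1; rewrite mul1r.
- exact: noetherian_loc locS (cgr_noetherian p_pr cL).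
(* Each g - 1 with g in Gal(K/L) maps to 0 in the Iwasawa algebra of L. *)
- move=> x /q_ker h N' sN'; apply: h => y [g [x' hg ->]]; apply: sN'.
  exists (cgr_elt (padic_int p) g - 1), x'; split=> //.
  by rewrite rmorphB rmorph1 res_elt (proj1 (relative_galP L g) hg) subrr.
move=> Q pQ [hQ|hQ].
- apply: (genA L _ Q pQ hQ) => j jn; have [|v rv] := good j; first exact: ltn_addr.
  by rewrite /l jn => lv; exists v.
- apply: (genB L _ Q pQ hQ) => j jn; have [|v rv] := good (nA + j)%N; first by rewrite ltn_add2l.
  by rewrite /l ltnNge leq_addr /= addKn => lv; exists v.
Qed.
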